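(* Consider the composite optimization problem $$\text{minimize }\ \varphi_0(x)+(\vartheta\circ f)(x)\ \text{ over }x\in\mathbb{R}^n,\qquad(\mathrm{P})$$ where $\varphi_0\colon\mathbb{R}^n\to\mathbb{R}$ and $f\colon\mathbb{R}^n\to\mathbb{R}^m$ are twice differentiable at $\bar x$, and where $\vartheta\colon\mathbb{R}^m\to\overline{\mathbb{R}}$ is a convex piecewise linear-quadratic function with $f(\bar x)\in\operatorname{dom}\vartheta$. Let $\varphi:=\vartheta\circ f$, and let the metric subregularity qualification condition (MSQC) for $\vartheta\circ f$ hold at $\bar x$, where $\bar x$ satisfies the stationarity condition $0\in\nabla\varphi_0(\bar x)+\partial\varphi(\bar x)$. Let $\bar v:=-\nabla\varphi_0(\bar x)$. The following hold: (i) If $\bar x$ is a local minimizer of (P), then for any $\bar\lambda\in\Lambda(\bar x,\bar v)$ the second-order necessary condition $$\mathrm{d}^2\vartheta\big(f(\bar x),\bar\lambda\big)\big(\nabla f(\bar x)w\big)+\max_{\lambda\in\Lambda(\bar x,\bar v)}\langle\nabla^2_{xx}L(\bar x,\lambda)w,w\rangle\ge0\quad\text{whenever }w\in K_\varphi(\bar x,\bar v)$$ is satisfied. (ii) The validity of the second-order condition $$\mathrm{d}^2\vartheta\big(f(\bar x),\bar\lambda\big)\big(\nabla f(\bar x)w\big)+\max_{\lambda\in\Lambda(\bar x,\bar v)}\langle\nabla^2_{xx}L(\bar x,\lambda)w,w\rangle>0\quad\text{whenever }w\in K_\varphi(\bar x,\bar v)\setminus\{0\}$$ for any $\bar\lambda\in\Lambda(\bar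 x,\bar v)$ is equivalent to the existence of numbers $\ell>0$ and $\varepsilon>0$ such that $$\psi(x)\ge\psi(\bar x)+\ell\|x-\bar x\|^2\quad\text{for all }x\text{ with }\|x-\bar x\|\le\varepsilon,$$ where $\psi:=\varphi_0+\vartheta\circ f$. In particular, the second-order condition in (ii) is sufficient for local optimality of $\bar x$ in (P).
   Context: $\overline{\mathbb{R}}:=(-\infty,\infty]$, $\operatorname{dom}\varphi:=\{x\mid\varphi(x)<\infty\}$, $\operatorname{epi}\varphi:=\{(x,\alpha)\mid\alpha\ge\varphi(x)\}$; $^*$ on matrices denotes transpose. A mapping is twice differentiable at $\bar x$ if it is differentiable in a neighborhood of $\bar x$ and its derivative is differentiable at $\bar x$. $\vartheta\colon\mathbb{R}^m\to\overline{\mathbb{R}}$ is piecewise linear-quadratic if $\operatorname{dom}\vartheta=\bigcup_{i=1}^s\Omega_i$ with polyhedral convex sets $\Omega_i$ and $\vartheta(y)=\frac12\langle A_iy,y\rangle+\langle a_i,y\rangle+\alpha_i$ for $y\in\Omega_i$, with symmetric matrices $A_i$, $a_i\in\mathbb{R}^m$, $\alpha_i\in\mathbb{R}$. MSQC for $\vartheta\circ f$ at $\bar x$: there are $\kappa\ge0$ and a neighborhood $U$ of $\bar x$ with $\operatorname{dist}(x;\Omega)\le\kappa\operatorname{dist}(f(x);\operatorname{dom}\vartheta)$ for all $x\in U$, where $\Omega:=\{x\mid f(x)\in\operatorname{dom}\vartheta\}$. Regular normal cone: $\widehat N_\Omega(\bar x):=\{v\mid\limsup_{x\to\bar x,\,x\in\Omega}\frac{\langle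 v,x-\bar x\rangle}{\|x-\bar x\|}\le 0\}$; limiting normal cone $N_\Omega(\bar x)$: all limits of $v_k\in\widehat N_\Omega(x_k)$ with $x_k\to\bar x$, $x_k\in\Omega$. Limiting subdifferential: $\partial\varphi(\bar x):=\{v\mid(v,-1)\in N_{\operatorname{epi}\varphi}(\bar x,\varphi(\bar x))\}$ (the usual subdifferential for convex functions). Subderivative: $\mathrm{d}\varphi(\bar x)(\bar w):=\liminf_{t\downarrow 0,\,w\to\bar w}\frac{\varphi(\bar x+tw)-\varphi(\bar x)}{t}$. Second subderivative: $\mathrm{d}^2\varphi(\bar x,\bar v)(w):=\liminf_{t\downarrow0,\,u\to w}\frac{\varphi(\bar x+tu)-\varphi(\bar x)-t\langle\bar v,u\rangle}{\frac12t^2}$. Critical cone: $K_\varphi(\bar x,\bar v):=\{w\mid\mathrm{d}\varphi(\bar x)(w)=\langle\bar v,w\rangle\}$. Multiplier set: $\Lambda(\bar x,\bar v):=\{\lambda\in\mathbb{R}^m\mid\nabla f(\bar x)^*\lambda=\bar v,\ \lambda\in\partial\vartheta(f(\bar x))\}$. Lagrangian: $L(x,\lambda):=\varphi_0(x)+\langle\lambda,f(x)\rangle-\vartheta^*(\lambda)$ with $\vartheta^*$ the Fenchel conjugate, so $\nabla^2_{xx}L(\bar x,\lambda)=\nabla^2\varphi_0(\bar x)+\nabla^2\langle\lambda,f\rangle(\bar x)$. *)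

(* Defs.v *)
From HB Require Import structures.
From mathcomp Require Import all_boot all_order all_algebra.
From mathcomp Require Import all_classical all_reals all_analysis.

Set Implicit Arguments.
Unset Strict Implicit.
Unset Printing Implicit Defensive.

Import Order.TTheory GRing.Theory Num.Theory.
Import numFieldNormedType.Exports.

Local Open Scope classical_set_scope.
Local Open Scope ring_scope.

(* R^n is 'rV[R]_n.  The library norm `|x| on 'rV[R]_n is the sup norm (with  *)
(* the usual topology); the Euclidean norm is enorm.  Vectors are rows, so    *)
(* 'd f x w = w *m jacobian f x, and a matrix A acts on a vector y as y *m A. *)

Section Euclidean.
Context {R : realType} {n : nat}.
Implicit Types (u v x : 'rV[R]_n) (C : set 'rV[R]_n).

Definition dotp u v : R := (u *m v^T) 0 0.

Definition enorm u : R := Num.sqrt (dotp u u).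

(* dist(x; C), with value +oo if C is empty *)
Definition dist x C : \bar R := ereal_inf [set (enorm (x - y))%:E | y in C].

Definition polyhedral C : Prop :=
  exists (k : nat) (b : 'I_k -> 'rV[R]_n) (beta : 'I_k -> R),
    C = [set y | forall i, dotp (b i) y <= beta i].

End Euclidean.

Section Derivatives.
Context {R : realType} {n : nat}.
Implicit Types (g : 'rV[R]_n -> R) (x : 'rV[R]_n).

Definition grad g x : 'rV[R]_n := \row_i 'd g x (delta_mx 0 i).

Definition hessian g x : 'M[R]_n := jacobian (grad g) x.

Definition twice_differentiable_fun g x : Prop :=
  (\forall y \near x, differentiable g y) /\ differentiable (grad g) x.

Definition twice_differentiable_map {m : nat} (f : 'rV[R]_n -> 'rV[R]_m) x :
    Prop :=
  (\forall y \near x, differentiable f y) /\ differentiable (jacobian f) x.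

(* nabla f(x)^* lambda; jacobian f x is the transpose of the usual matrix of  *)
(* nabla f(x).                                                                *)
Definition adjoint_deriv {m : nat} (f : 'rV[R]_n -> 'rV[R]_m) x
    (lambda : 'rV[R]_m) : 'rV[R]_n :=
  lambda *m (jacobian f x)^T.

End Derivatives.

Section ExtendedRealFunctions.
Context {R : realType} {n : nat}.
Implicit Types (phi : 'rV[R]_n -> \bar R) (x v w : 'rV[R]_n).

Definition dom phi : set 'rV[R]_n := [set x | (phi x < +oo)%E].

(* R^n x R is identified with R^(n + 1): (x, alpha) is row_mx x alpha%:M.     *)
Definition epi phi : set 'rV[R]_(n + 1) :=
  [set z | (phi (lsubmx z) <= (rsubmx z 0 0)%:E)%E].

Definition convex_efun phi : Prop :=
  forall x y (t : R), 0 < t -> t < 1 ->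
    (phi (t *: x + (1 - t) *: y)%R
       <= t%:E * phi x + (1 - t)%:E * phi y)%E.

(* v *m A is A v since A is symmetric. *)
Definition piecewise_linear_quadratic phi : Prop :=
  exists (s : nat) (Om : 'I_s -> set 'rV[R]_n)
         (A : 'I_s -> 'M[R]_n) (a : 'I_s -> 'rV[R]_n) (alpha : 'I_s -> R),
    [/\ forall i, polyhedral (Om i),
        forall i, (A i)^T = A i,
        dom phi = \bigcup_i Om i &
        forall i y, Om i y ->
          phi y = (2^-1 * dotp (y *m A i) y + dotp (a i) y + alpha i)%:E].

Definition conjugate phi v : \bar R :=
  ereal_sup [set ((dotp v y)%:E - phi y)%E | y in [set: 'rV[R]_n]].

Definition subderivative phi x w : \bar R :=
  limf_einf (fun p : R * 'rV[R]_n =>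
      ((phi (x + p.1 *: p.2)%R - phi x) * (p.1^-1)%:E)%E)
    (filter_prod 0^'+ (nbhs w)).

Definition second_subderivative phi x v w : \bar R :=
  limf_einf (fun p : R * 'rV[R]_n =>
      ((phi (x + p.1 *: p.2)%R - phi x - (p.1 * dotp v p.2)%:E)
         * ((2^-1 * p.1 ^+ 2)^-1)%:E)%E)
    (filter_prod 0^'+ (nbhs w)).

Definition critical_cone phi x v : set 'rV[R]_n :=
  [set w | subderivative phi x w = (dotp v w)%:E].

End ExtendedRealFunctions.

Section NormalCones.
Context {R : realType} {n : nat}.
Implicit Types (C : set 'rV[R]_n) (x v : 'rV[R]_n).

(* for x in C *)
Definition regular_normal_cone C x : set 'rV[R]_n :=
  [set v | (limf_esup (fun y : 'rV[R]_n => (dotp v (y - x) / enorm (y - x))%:E)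
              (within C x^') <= 0)%E].

Definition limiting_normal_cone C x : set 'rV[R]_n :=
  [set v | exists (x_ v_ : nat -> 'rV[R]_n),
    [/\ forall k, C (x_ k),
        forall k, regular_normal_cone C (x_ k) (v_ k),
        x_ @ \oo --> x &
        v_ @ \oo --> v]].

End NormalCones.

(* empty when phi x is infinite *)
Definition subdifferential {R : realType} {n : nat}
    (phi : 'rV[R]_n -> \bar R) (x : 'rV[R]_n) : set 'rV[R]_n :=
  [set v | phi x \is a fin_num /\
    limiting_normal_cone (epi phi) (row_mx x (fine (phi x))%:M)
      (row_mx v (-1)%:M)].

Section Composite.
Context {R : realType} {n m : nat}.
Variables (phi0 : 'rV[R]_n -> R) (f : 'rV[R]_n -> 'rV[R]_m)
          (theta : 'rV[R]_m -> \bar R).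
Implicit Types (x v w : 'rV[R]_n) (lambda : 'rV[R]_m).

Definition MSQC x : Prop :=
  exists2 kappa : R, 0 <= kappa &
    \forall y \near x,
      (dist y [set z | dom theta (f z)] <= kappa%:E * dist (f y) (dom theta))%E.

Definition multipliers x v : set 'rV[R]_m :=
  [set lambda | adjoint_deriv f x lambda = v
             /\ subdifferential theta (f x) lambda].

(* theta^*(lambda) is finite whenever lambda is a subgradient of the convex   *)
(* function theta, hence for every multiplier.                                *)
Definition lagrangian x lambda : R :=
  phi0 x + dotp lambda (f x) - fine (conjugate theta lambda).

(* < nabla^2_xx L(x, lambda) w, w > *)
Definition lagrangian_quad x lambda w : R :=
  dotp (w *m hessian (fun y => lagrangian y lambda) x) w.

(* The supremum below is a maximum when w is critical; this is part of the    *)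
(* conclusion of the theorem.                                                 *)
Definition second_order_form x v lambda w : \bar R :=
  (second_subderivative theta (f x) lambda ('d f x w)
   + ereal_sup [set (lagrangian_quad x mu w)%:E | mu in multipliers x v])%E.

End Composite.

Definition local_minimizer {R : realType} {n : nat}
    (psi : 'rV[R]_n -> \bar R) (x : 'rV[R]_n) : Prop :=
  \forall y \near x, (psi x <= psi y)%E.

Definition quadratic_growth {R : realType} {n : nat}
    (psi : 'rV[R]_n -> \bar R) (x : 'rV[R]_n) : Prop :=
  exists (l eps : R), [/\ 0 < l, 0 < eps &
    forall y, enorm (y - x) <= eps ->
      (psi x + (l * enorm (y - x) ^+ 2)%:E <= psi y)%E].

(* Main.v *)
(* Write z for f(xbar), J for the derivative of f at xbar and B(w) for half   *)
(* its second derivative along w.  Near z the domain of theta is z + T with T *)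
(* a finite union of polyhedral cones, and theta(z + h) = theta(z) + p(h) +   *)
(* q(h)/2 with p convex piecewise linear and q positively homogeneous of      *)
(* degree 2.  A multiplier is a lambda <= p on T with J^* lambda = vbar, the  *)
(* critical cone is {w | Jw in T, p(Jw) = <vbar, w>}, and the second          *)
(* subderivative of theta at such Jw is q(Jw).  So each multiplier bounds the *)
(* second-order quotients of psi along directions tending to w from below by  *)
(* q(Jw) + <nabla^2 L(lambda) w, w>; this gives sufficiency by compactness of *)
(* the sphere.  Conversely, metric subregularity corrects the curves          *)
(* xbar + t w + t^2 u to feasible ones whenever Ju + B(w) is tangent to T at  *)
(* Jw, and provides one such u.  The infimum over u of the resulting          *)
(* quotients is a feasible linear program whose dual is the maximum of        *)
(* <lambda, B(w)> over the multipliers, so the lower bounds are sharp and the *)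
(* maximum is attained even though the multiplier set may be unbounded.       *)
(* Multipliers exist because the inequality <vbar, w> <= p(Jw) survives the   *)
(* passage to the limit from regular normals at nearby points, and the same   *)
(* duality turns it into a multiplier.                                        *)

Require Import Defs.
From HB Require Import structures.
From mathcomp Require Import all_boot all_order all_algebra.
From mathcomp Require Import all_classical all_reals all_analysis.
From mathcomp Require Import ring lra.

Set Implicit Arguments.
Unset Strict Implicit.
Unset Printing Implicit Defensive.

Import Order.TTheory GRing.Theory Num.Theory.
Import numFieldNormedType.Exports.

Local Open Scope classical_set_scope.
Local Open Scope ring_scope.

(** * Norms and inner products *)

(** Everything takes place near z = f(xbar). [plq_localize] replaces theta there by theta(z) + p(h)
    + q(h)/2 on a cone T, with p convex and piecewise linear and q homogeneous of degree two. In
    this model a multiplier is a functional l below p on T whose pullback by the derivative J of f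
    is vbar ([subdifferential_cone]), a direction w is critical when Jw lies in T and p(Jw) = <vbar,
    w> ([critical_coneE]), and d^2 theta(z, l)(Jw) = q(Jw) for every multiplier l
    ([second_subderivative_cone]). Hence the second-order form does not depend on the chosen
    multiplier, and it equals [form_value] at a multiplier maximizing <l, B(w)>, where B(w) is half
    the second derivative of f along w ([second_order_formE]).

    The proof compares this form with the second-order quotients of psi. The lower bound
    ([gap_lower]) is weak duality: l <= p on T, evaluated at the difference quotients of f. The
    upper bound ([critical_gap_upper]) is strong duality: metric subregularity makes the curves xbar
    + t w + t^2 u feasible after a small change of u ([upper_path]), and minimizing over u is a
    linear program whose dual is the maximization over multipliers ([lp_duality], [critical_upper]).
    One such u exists, again by metric subregularity ([feasible_direction]), so the program is
    feasible and the dual maximum is attained.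

    Local minimality or quadratic growth, tested along the curves of the upper bound, gives the sign
    of the form ([necessary], [growth_positive]). If growth fails, normalized violating points
    cluster at a direction, which the first-order bound forces to be critical and at which the lower
    bound contradicts positivity ([sufficient]). A multiplier exists because the limiting normals
    defining the subgradient vbar satisfy <vbar, w> <= p(Jw) whenever Jw lies in T
    ([approx_normal_slope]), and duality converts this inequality into a functional
    ([multiplier_exists]). *)

Section MatrixNorm.
Context {R : realType}.

Lemma entry_le_norm k l (A : 'M[R]_(k, l)) i j : `|A i j| <= `|A|.
Proof.
rewrite {2}/Num.Def.normr /= mx_normrE.
exact: (le_bigmax _ (fun ij : 'I_k * 'I_l => `|A ij.1 ij.2|) (i, j)).
Qed.

Lemma norm_le_entry k l (A : 'M[R]_(k, l)) (c : R) :
  0 <= c -> (forall i j, `|A i j| <= c) -> `|A| <= c.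
Proof.
move=> c0 Ac; rewrite /Num.Def.normr /= mx_normrE.
by apply/bigmax_leP; split=> // -[i j] _; exact: Ac.
Qed.

Lemma norm_mulmx k l p (A : 'M[R]_(k, l)) (B : 'M[R]_(l, p)) :
  `|A *m B| <= l%:R * `|A| * `|B|.
Proof.
apply: norm_le_entry => [|i j]; first by rewrite !mulr_ge0.
rewrite mxE; apply: le_trans (ler_norm_sum _ _ _) _.
apply: (@le_trans _ _ (\sum_(x < l) `|A| * `|B|)).
  by apply: ler_sum => x _; rewrite normrM ler_pM // entry_le_norm.
by rewrite sumr_const card_ord -mulrA mulr_natl.
Qed.

Lemma norm_trmx k l (A : 'M[R]_(k, l)) : `|A^T| = `|A|.
Proof.
apply/le_anti/andP; split; apply: norm_le_entry => // i j.
  by rewrite mxE entry_le_norm.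
by rewrite -[A]trmxK mxE trmxK entry_le_norm.
Qed.

End MatrixNorm.

Section DotProduct.
Context {R : realType} {n : nat}.
Implicit Types (u v x : 'rV[R]_n) (a : R).

Lemma dotpE u v : dotp u v = \sum_i u 0 i * v 0 i.
Proof. by rewrite /dotp mxE; apply: eq_bigr => i _; rewrite mxE. Qed.

Lemma dotpC u v : dotp u v = dotp v u.
Proof. by rewrite !dotpE; apply: eq_bigr => i _; rewrite mulrC. Qed.

Lemma dotpDl u v x : dotp (u + v) x = dotp u x + dotp v x.
Proof. by rewrite /dotp mulmxDl mxE. Qed.

Lemma dotpDr u v x : dotp x (u + v) = dotp x u + dotp x v.
Proof. by rewrite dotpC dotpDl !(dotpC x). Qed.

Lemma dotpZl a u v : dotp (a *: u) v = a * dotp u v.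
Proof. by rewrite /dotp -scalemxAl mxE. Qed.

Lemma dotpZr a u v : dotp u (a *: v) = a * dotp u v.
Proof. by rewrite dotpC dotpZl dotpC. Qed.

Lemma dotpNl u v : dotp (- u) v = - dotp u v.
Proof. by rewrite -scaleN1r dotpZl mulN1r. Qed.

Lemma dotpNr u v : dotp u (- v) = - dotp u v.
Proof. by rewrite dotpC dotpNl dotpC. Qed.

Lemma dotpBl u v x : dotp (u - v) x = dotp u x - dotp v x.
Proof. by rewrite dotpDl dotpNl. Qed.

Lemma dotpBr u v x : dotp x (u - v) = dotp x u - dotp x v.
Proof. by rewrite dotpDr dotpNr. Qed.

Lemma dotp0l v : dotp 0 v = 0.
Proof. by rewrite /dotp mul0mx mxE. Qed.

Lemma dotp0r v : dotp v 0 = 0.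
Proof. by rewrite dotpC dotp0l. Qed.

Lemma dotp_delta u j : dotp (delta_mx 0 j) u = u 0 j.
Proof.
rewrite dotpE (bigD1 j) //= !mxE !eqxx mul1r big1 ?addr0 // => i ij.
by rewrite mxE eqxx (negbTE ij) mul0r.
Qed.

Lemma dotp_inj u v : (forall x, dotp u x = dotp v x) -> u = v.
Proof.
by move=> uv; apply/rowP => i; rewrite -!dotp_delta !(dotpC (delta_mx _ _)) uv.
Qed.

Lemma dotp_le_norm u v : `|dotp u v| <= n%:R * `|u| * `|v|.
Proof.
rewrite -[`|v|]norm_trmx; apply: le_trans (entry_le_norm _ _ _) _.
exact: norm_mulmx.
Qed.

Lemma dotp_ge0 u : 0 <= dotp u u.
Proof. by rewrite dotpE sumr_ge0 // => i _; rewrite -expr2 sqr_ge0. Qed.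

Lemma norm_le_enorm u : `|u| <= enorm u.
Proof.
apply: norm_le_entry => [|i j]; first exact: sqrtr_ge0.
rewrite ord1 -sqrtr_sqr ler_sqrt ?dotp_ge0 // dotpE (bigD1 j) //= expr2 lerDl.
by rewrite sumr_ge0 // => k _; rewrite -expr2 sqr_ge0.
Qed.

Lemma enorm_le_norm u : enorm u <= n%:R * `|u|.
Proof.
rewrite /enorm -[leRHS]ger0_norm ?mulr_ge0 // -sqrtr_sqr ler_sqrt ?sqr_ge0 //.
apply: le_trans (ler_norm _) _; apply: le_trans (dotp_le_norm _ _) _.
rewrite exprMn -mulrA -expr2 ler_wpM2r ?sqr_ge0 // -natrX ler_nat.
by case: (n) => // k; rewrite leq_pmulr.
Qed.

End DotProduct.

Lemma dotp_mulmx {R : realType} {n m} (u : 'rV[R]_n) (A : 'M[R]_(n, m))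
  (l : 'rV[R]_m) : dotp l (u *m A) = dotp (l *m A^T) u.
Proof. by rewrite /dotp trmx_mul mulmxA. Qed.

(** Closed balls are compact. The cluster point is described by indices k >= N with [u k] close to
    x, which avoids extracting subsequences. *)
Lemma bounded_row_cluster {R : realType} {n} (u : nat -> 'rV[R]_n) (C : R) :
  (forall k, `|u k| <= C) ->
  exists x, forall (e : R) (N : nat), 0 < e ->
    exists2 k, (N <= k)%N & `|u k - x| < e.
Proof.
move=> uC; pose B := [set x : 'rV[R]_n | `|x| <= C].
have cB : compact B.
  apply: bounded_closed_compact.
    exists C; split; first exact: num_real.
    by move=> M CM x /= Bx; apply: le_trans Bx (ltW CM).
  have -> : B = closed_ball_ Num.norm (0 : 'rV[R]_n) C.
    by apply/seteqP; split => x /=; rewrite /B/closed_ball_ /= sub0r normrN.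
  exact: closed_closed_ball_.
have [|x [_ cx]] := cB (u @ \oo) _; first by exists 0%N => // k _; exact: uC.
exists x => e N e0.
have [] := cx (u @` [set k | (N <= k)%N]) (ball x e); last 2 first.
- exact: nbhsx_ballx.
- move=> y [[k /= Nk <-]].
  by rewrite -ball_normE /= distrC; exists k.
by exists N => // k /= Nk; exists k.
Qed.

(** * Farkas' lemma *)

(* Bartl's induction on the number of functionals.  That g is a nonnegative   *)
(* combination of s is expressed by membership in every convex cone.          *)
Lemma farkas {R : realType} {V : lmodType R} (s : seq (V -> R)) (g : V -> R)
  (Cone : (V -> R) -> Prop) :
  (forall a, List.In a s -> scalar a) -> scalar g ->
  Cone (fun=> 0) -> (forall a, List.In a s -> Cone a) ->
  (forall (c : R) a b, 0 <= c -> Cone a -> Cone b ->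
     Cone (fun x => a x + c * b x)) ->
  (forall x, (forall a, List.In a s -> a x <= 0) -> g x <= 0) ->
  Cone g.
Proof.
move=> + + Cone0 + ConeD.
have lin0 (h : V -> R) : scalar h -> h 0 = 0.
  by move=> lh; have := lh (-1) 0 0; rewrite scaler0 addr0; lra.
have linZ (h : V -> R) c x : scalar h -> h (c *: x) = c * h x.
  by move=> lh; have := lh c x 0; rewrite addr0 (lin0 h lh) addr0.
have [n] := ubnP (size s); elim: n => // n IH in s g *.
case: s => [|b s] /= sn slin glin sCone sg.
  suff -> : g = fun=> 0 by [].
  apply/funext => x; apply/le_anti/andP; split; first exact: sg.
  by have := sg (- x) (fun _ => False_ind _); rewrite -scaleN1r linZ //; lra.
(* If the constraints in [s] alone force g <= 0, the functional [b] gets coefficient 0. Otherwise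
   some x satisfies [s] but has g x > 0, which forces b x > 0. *)
have [sg'|] := pselect (forall x, (forall a, List.In a s -> a x <= 0) -> g x <= 0).
  by apply: (IH s) => // a sa; [apply: slin|apply: sCone]; right.
move=> /existsNP[x /not_implyP[sx /negP]]; rewrite -ltNge => gx.
have blin : scalar b by apply: slin; left.
have bx : 0 < b x.
  rewrite ltNge; apply/negP => bx; have := sg x; rewrite leNgt gx => H.
  by suff: false by []; apply: H => a [<-//|]; exact: sx.
(* [r h] is h composed with the projection along x onto the kernel of [b]. The induction applies to
   the projected functionals, and g = r g + (g x / b x) b has a nonnegative coefficient. *)
pose r (h : V -> R) := fun y => h y + - (h x / b x) * b y.
have rE h y : scalar h -> r h y = h (y - (b y / b x) *: x).
  by move=> lh; rewrite /r [y - _]addrC -[- (_ *: x)]scaleNr (lh _ x y) /=; ring.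
have rlin h : scalar h -> scalar (r h).
  by move=> lh c y z; rewrite /r lh blin; ring.
have Cb : Cone b by apply: sCone; left.
suff /(ConeD (g x / b x)) /(_ Cb) : Cone (r g).
  rewrite divr_ge0 ?ltW // => /(_ isT).
  by congr Cone; apply/funext => y; rewrite /r; ring.
apply: (IH (List.map r s)).
- by rewrite size_map.
- by move=> _ /List.in_map_iff[a [<- sa]]; apply/rlin/slin; right.
- exact: rlin.
- move=> _ /List.in_map_iff[a [<- sa]]; apply: ConeD => //.
    by rewrite oppr_ge0 mulr_le0_ge0 ?sx // invr_ge0 ltW.
  by apply: sCone; right.
- move=> y sy; rewrite rE //; apply: sg => a [<-|sa].
    by rewrite addrC -[- (_ *: x)]scaleNr (blin _ x y) /= mulNr divfK ?gt_eqF // addNr.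
  by rewrite -rE; [apply: sy; exact: List.in_map|apply: slin; right].
Qed.

Lemma near_normP {R : realType} {n} (z : 'rV[R]_n) (P : 'rV[R]_n -> Prop) :
  (\forall y \near z, P y) <->
  exists2 d : R, 0 < d & forall y, `|y - z| < d -> P y.
Proof.
split=> [/nbhs_normP[d /= d0 dP]|[d d0 dP]].
  by exists d => // y yd; apply: dP; rewrite /= distrC.
by apply/nbhs_normP; exists d => //= y; rewrite /= distrC => /dP.
Qed.

(** * Piecewise linear-quadratic functions *)

Section PiecewiseQuadratic.
Context {R : realType} {m : nat}.

(* ([:: (b_i, beta_i)], (A, a, alpha)) is the polyhedron of the inequalities  *)
(* <b_i, y> <= beta_i with the quadratic <y A, y> / 2 + <a, y> + alpha.       *)
Definition piece : Type :=
  (seq ('rV[R]_m * R) * ('M[R]_m * 'rV[R]_m * R))%type.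
Implicit Types (c : piece) (L : seq piece) (D : set 'rV[R]_m)
  (g : 'rV[R]_m -> R) (x y z h : 'rV[R]_m).

Definition quad c := c.2.1.1.
Definition lin c := c.2.1.2.

Definition in_piece c y : bool := all (fun b => dotp b.1 y <= b.2) c.1.

Definition piece_val c y : R :=
  2^-1 * dotp (y *m quad c) y + dotp (lin c) y + c.2.2.

(** The extended-valued function is split into its domain [D] and a real function [g] constrained
    only on [D]; overlapping pieces must agree because they share [g]. *)
Definition plq_rep L D g :=
  (forall y, D y <-> has (in_piece^~ y) L) /\
  (forall c y, c \in L -> in_piece c y -> g y = piece_val c y).

Definition convex_on D g := forall x y (a b : R), D x -> D y ->
  0 <= a -> 0 <= b -> a + b = 1 ->
  D (a *: x + b *: y) /\ g (a *: x + b *: y) <= a * g x + b * g y.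

(** Every piece is a polyhedral cone carrying a linear function, so the represented function is
    positively homogeneous. *)
Definition conic_pieces L := forall c, c \in L ->
  [/\ forall b, b \in c.1 -> b.2 = 0, quad c = 0 & c.2.2 = 0].

Lemma near_seq (T : Type) (F : set_system T) (I : eqType) (s : seq I)
    (P : I -> T -> Prop) (FF : Filter F) :
  (forall i, i \in s -> \forall x \near F, P i x) ->
  \forall x \near F, forall i, i \in s -> P i x.
Proof.
elim: s => [|i s IH] sP; first by apply: nearW => x j.
have := IH (fun j sj => sP j (mem_behead (s := i :: s) sj)).
apply: filterS2 (sP i (mem_head _ _)) => x Pi Ps j.
by rewrite inE => /predU1P[->|/Ps].
Qed.

Lemma dotp_gt_near (b : 'rV[R]_m) z (c : R) :
  c < dotp b z -> \forall y \near z, c < dotp b y.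
Proof.
move=> cz; have C0 : 0 < m%:R * `|b| + 1 by rewrite ltr_wpDl ?mulr_ge0.
apply/near_normP; exists ((dotp b z - c) / (m%:R * `|b| + 1)).
  by rewrite divr_gt0 // subr_gt0.
move=> y; rewrite ltr_pdivlMr // => yz.
have := le_trans (ler_norm _) (dotp_le_norm b (z - y)).
by rewrite dotpBr distrC; have := normr_ge0 (y - z); nra.
Qed.

Lemma in_piece_near L z :
  \forall y \near z, forall c, c \in L -> in_piece c y -> in_piece c z.
Proof.
apply: (@near_seq _ (nbhs z) _ _ _ (nbhs_filter z)) => c _; have [cz|] := boolP (in_piece c z); first exact: nearW.
move=> /allPn[b cb]; rewrite -ltNge => bz.
have : \forall y \near z, b.2 < dotp b.1 y.
  exact: dotp_gt_near.
by apply: filterS => y by_ /allP /(_ b cb) /=; rewrite leNgt by_.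
Qed.

Lemma piece_val_bound L (rho : R) : exists2 C : R, 0 <= C &
  forall c x y, c \in L -> `|x| <= rho -> `|y| <= rho ->
    `|piece_val c x - piece_val c y| <= C * `|x - y|.
Proof.
elim: L => [|c L [C C0 IH]]; first by exists 0.
pose K := m%:R * (m%:R * `|rho| * `|quad c|) + m%:R * `|lin c|.
have K0 : 0 <= K by rewrite addr_ge0 ?mulr_ge0.
exists (K + C); first exact: addr_ge0.
move=> d x y; rewrite inE => /predU1P[->|dL] xr yr; last first.
  apply: le_trans (IH d x y dL xr yr) _; rewrite ler_wpM2r //; lra.
apply: (@le_trans _ _ (K * `|x - y|)); last by rewrite ler_wpM2r //; lra.
have -> : piece_val c x - piece_val c y =
    2^-1 * dotp (x *m quad c) (x - y) + 2^-1 * dotp ((x - y) *m quad c) y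
    + dotp (lin c) (x - y).
  by rewrite /piece_val mulmxBl !dotpBr !dotpBl; lra.
have rr : rho <= `|rho| by exact: ler_norm.
have half (a b : R) : `|a| <= b -> `|2^-1 * a| <= 2^-1 * b.
  by move=> ab; rewrite normrM (@ger0_norm _ 2^-1) // ler_wpM2l.
have B1 : `|dotp (x *m quad c) (x - y)| <=
    m%:R * (m%:R * `|rho| * `|quad c|) * `|x - y|.
  apply: le_trans (dotp_le_norm _ _) _; rewrite ler_wpM2r // ler_wpM2l //.
  apply: le_trans (norm_mulmx _ _) _; rewrite ler_wpM2r // ler_wpM2l //.
  exact: le_trans rr.
have B2 : `|dotp ((x - y) *m quad c) y| <=
    m%:R * (m%:R * `|rho| * `|quad c|) * `|x - y|.
  apply: le_trans (dotp_le_norm _ _) _.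
  have -> : m%:R * (m%:R * `|rho| * `|quad c|) * `|x - y| =
    m%:R * (m%:R * `|x - y| * `|quad c|) * `|rho| by ring.
  apply: ler_pM; rewrite ?mulr_ge0 //; last exact: le_trans rr.
  by rewrite ler_wpM2l // norm_mulmx.
have B3 := dotp_le_norm (lin c) (x - y).
apply: le_trans (ler_normD _ _) _; apply: le_trans (lerD (ler_normD _ _) B3) _.
have := lerD (half _ _ B1) (half _ _ B2).
by rewrite /K; lra.
Qed.

(** The pieces are closed and finitely many, so points near z avoid the pieces that miss z. Values
    at y and z can thus be compared inside one piece, which yields closedness of D and continuity
    relative to D. *)
Lemma plq_share L D g z : plq_rep L D g ->
  \forall y \near z, D y -> exists2 c, c \in L & in_piece c y && in_piece c z.
Proof.
move=> [DL gL]; apply: filterS (in_piece_near L z) => y yz /DL /hasP[c cL cy].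
by exists c => //; rewrite cy (yz c).
Qed.

Lemma plq_cont L D g z (e : R) : plq_rep L D g -> 0 < e ->
  \forall y \near z, D y -> `|g y - g z| <= e.
Proof.
move=> Lg e0; have [C C0 CL] := piece_val_bound L (`|z| + 1).
have C1 : 0 < C + 1 by lra.
have /near_normP[d d0 dP] := plq_share z Lg.
apply/near_normP; exists (Num.min d (Num.min 1 (e / (C + 1)))).
  by rewrite !lt_min d0 ltr01 divr_gt0.
move=> y; rewrite !lt_min ltr_pdivlMr // => /and3P[yd y1 ye] Dy.
have [c cL /andP[cy cz]] := dP y yd Dy.
rewrite !(Lg.2 c) //; apply: le_trans (CL _ _ _ cL _ _) _; last first.
- by have := normr_ge0 (y - z); nra.
- by rewrite lerDl.
- rewrite -(subrK z y) addrC; apply: le_trans (ler_normD _ _) _.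
  by rewrite lerD2l ltW.
Qed.

Lemma plq_closed L D g z : plq_rep L D g ->
  (forall e : R, 0 < e -> exists2 y, D y & `|y - z| < e) -> D z.
Proof.
move=> Lg zD; have /near_normP[e /= e0 eP] := plq_share z Lg.
have [y Dy yz] := zD e e0.
have [c cL /andP[_ cz]] := eP y yz Dy.
by apply/Lg.1/hasP; exists c.
Qed.

(* By convexity the slope of g from x to y is at most the slope from any      *)
(* point of the segment to y; points close to y share a piece with y.         *)
Lemma plq_lipschitz L D g (rho : R) : plq_rep L D g -> convex_on D g ->
  exists2 C : R, 0 <= C & forall x y, D x -> D y -> `|x| <= rho -> `|y| <= rho ->
    g y - g x <= C * `|y - x|.
Proof.
move=> Lg cg; have [C C0 CL] := piece_val_bound L rho; exists C => // x y Dx Dy xr yr.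
have /near_normP[d /= d0 dP] := plq_share y Lg.
pose M := `|y - x| + 1 + d.
have M0 : 0 < M by rewrite /M -addrA ltr_wpDl // addr_gt0.
have [s [s0 s1 sM]] : exists s : R, [/\ 0 < s, s <= 1 & s * M = d / 2].
  exists (d / (2 * M)); split; first by rewrite divr_gt0 ?mulr_gt0.
    rewrite ler_pdivrMr ?mulr_gt0 // mul1r /M.
    by have := normr_ge0 (y - x); lra.
  by field; rewrite gt_eqF.
pose w := s *: x + (1 - s) *: y.
have [||Dw gw] := cg x y s (1 - s) Dx Dy (ltW s0); [lra|lra|].
have wy : w - y = - (s *: (y - x)).
  by rewrite /w scalerBl scale1r scalerBr opprB addrCA addrAC subrr add0r.
have nwy : `|w - y| = s * `|y - x| by rewrite wy normrN normrZ gtr0_norm.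
have [|c cL /andP[cw cy]] := dP w _ Dw.
  rewrite nwy.
  apply: (@le_lt_trans _ _ (s * M)).
    by rewrite (ler_wpM2l (ltW s0)) // /M -addrA lerDl addr_ge0 // ltW.
  by rewrite sM; lra.
have wr : `|w| <= rho.
  rewrite /w; apply: le_trans (ler_normD _ _) _; rewrite !normrZ.
  rewrite (ger0_norm (ltW s0)) (@ger0_norm _ (1 - s)) ?subr_ge0 //.
  have -> : rho = s * rho + (1 - s) * rho by ring.
  by rewrite lerD // ler_wpM2l ?subr_ge0 // ltW.
have := CL c w y cL wr yr; rewrite -!(Lg.2 c) // nwy distrC => H.
have := le_trans (ler_norm _) H => H1.
rewrite -(ler_pM2l s0).
move: gw; rewrite -/w; nra.
Qed.

End PiecewiseQuadratic.

(** * First- and second-order parts of a piecewise quadratic at a point *)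

Lemma near0_scale {R : realType} {n} (P : 'rV[R]_n -> Prop) (h : 'rV[R]_n) :
  (\forall y \near (0 : 'rV[R]_n), P y) -> \forall t \near (0 : R)^'+, P (t *: h).
Proof.
move=> /near_normP[d d0 dP].
have h1 : 0 < `|h| + 1 by rewrite ltr_wpDl.
have : \forall t \near (0 : R)^'+, 0 < t /\ t < d / (`|h| + 1).
  near=> t; split; first by near: t; exact: nbhs_right_gt.
  by near: t; apply: nbhs_right_lt; rewrite divr_gt0.
apply: filterS => t [t0]; rewrite ltr_pdivlMr // => td; apply: dP.
by rewrite subr0 normrZ gtr0_norm //; nra.
Unshelve. all: by end_near. Qed.

(** Divide by t and let t tend to 0. This extracts first-order inequalities from second-order
    expansions along rays. *)
Lemma near0_linear_le {R : realType} (a b : R) :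
  (\forall t \near (0 : R)^'+, t * a <= t ^+ 2 * b) -> a <= 0.
Proof.
move=> ab; rewrite leNgt; apply/negP => a0.
have b1 : 0 < `|b| + 1 by rewrite ltr_wpDl.
suff [t [t0 tb tab]] : exists t : R, [/\ 0 < t, t < a / (`|b| + 1) & t * a <= t ^+ 2 * b].
  move: tb tab; rewrite ltr_pdivlMr // => tb.
  by rewrite expr2 -mulrA ler_pM2l //; have := ler_norm b; nra.
apply: (@filter_ex _ (0 : R)^'+); near=> t; split.
- by near: t; exact: nbhs_right_gt.
- by near: t; apply: nbhs_right_lt; rewrite divr_gt0.
- by near: t.
Unshelve. all: by end_near. Qed.

(** Compare the terms of order t, then those of order t^2. It shows that two pieces containing the
    same direction define the same p and q there. *)
Lemma near0_quadratic_inj {R : realType} (a b c d : R) :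
  (\forall t \near (0 : R)^'+,
     t * a + 2^-1 * (t ^+ 2 * b) = t * c + 2^-1 * (t ^+ 2 * d)) ->
  a = c /\ b = d.
Proof.
move=> abcd.
have ac : a = c.
  apply/le_anti/andP; split; rewrite -subr_le0.
    apply: (@near0_linear_le _ _ (2^-1 * (d - b))).
    by apply: filterS abcd => t; lra.
  apply: (@near0_linear_le _ _ (2^-1 * (b - d))).
  by apply: filterS abcd => t; lra.
split=> //; rewrite -ac in abcd.
have /filter_ex[t [t0 tE]] : \forall t \near (0 : R)^'+, 0 < t /\
     t * a + 2^-1 * (t ^+ 2 * b) = t * a + 2^-1 * (t ^+ 2 * d).
  by apply: filterI; first exact: nbhs_right_gt.
have t20 : t ^+ 2 != 0 by rewrite expf_neq0 // gt_eqF.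
by apply: (mulfI t20); lra.
Qed.

Section Localization.
Context {R : realType} {m : nat}.
Implicit Types (c : @piece R m) (L : seq (@piece R m)) (D : set 'rV[R]_m)
  (g : 'rV[R]_m -> R) (x y z h : 'rV[R]_m).

(** The piece as seen from z: the constraints active at z made homogeneous, with the gradient at z
    of the quadratic as linear function. The gradient is written with A + A^T, so that it is correct
    for any matrix A. *)
Definition loc z c : @piece R m :=
  ([seq (b.1, 0) | b <- c.1 & dotp b.1 z == b.2],
   (0, 2^-1 *: (z *m (quad c + (quad c)^T)) + lin c, 0)).

Lemma piece_val_shift c z h : piece_val c (z + h) =
  piece_val c z + dotp (lin (loc z c)) h + 2^-1 * dotp (h *m quad c) h.
Proof.
have -> : dotp (lin (loc z c)) h =
    2^-1 * (dotp (z *m quad c) h + dotp (h *m quad c) z) + dotp (lin c) h.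
  rewrite [lin (loc _ _)]/= dotpDl dotpZl mulmxDr dotpDl -dotp_mulmx.
  by rewrite [dotp z (h *m _)]dotpC.
by rewrite /piece_val mulmxDl !dotpDl !dotpDr; lra.
Qed.

Lemma in_loc z c h : in_piece (loc z c) h =
  all (fun b => (dotp b.1 z == b.2) ==> (dotp b.1 h <= 0)) c.1.
Proof. by rewrite /in_piece /= all_map all_filter. Qed.

(** Near z the constraints inactive at z stay strict, and pieces that miss z remain out of reach. *)
Lemma loc_near L z : \forall h \near (0 : 'rV[R]_m), forall c, c \in L ->
  in_piece c (z + h) = in_piece c z && in_piece (loc z c) h.
Proof.
apply: (@near_seq _ (nbhs (0 : 'rV[R]_m)) _ _ _ (nbhs_filter _)) => c cL.
have [cz|ncz] /= := boolP (in_piece c z); last first.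
  have /near_normP[d d0 dP] := in_piece_near L z.
  apply/near_normP; exists d => // h; rewrite subr0 => hd.
  apply/negP => /(dP (z + h) _ c cL) => H; apply/negP: ncz; rewrite H //.
  by rewrite addrAC subrr add0r.
suff : \forall h \near (0 : 'rV[R]_m), forall b, b \in c.1 ->
    (dotp b.1 (z + h) <= b.2) = (dotp b.1 z == b.2) ==> (dotp b.1 h <= 0).
  apply: filterS => h hb; rewrite in_loc; exact: eq_in_all.
apply: (@near_seq _ (nbhs (0 : 'rV[R]_m)) _ _ _ (nbhs_filter _)) => b bc.
have := allP cz b bc; rewrite /= le_eqVlt => /predU1P[bz|bz].
  by apply: nearW => h; rewrite dotpDr bz eqxx /= gerDl.
have /near_normP[d d0 dP] : \forall y \near z, - b.2 < dotp (- b.1) y.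
  by apply: dotp_gt_near; rewrite dotpNl ltrN2.
apply/near_normP; exists d => // h; rewrite subr0 => hd.
rewrite lt_eqF //=; apply/ltW; have := dP (z + h); rewrite addrAC subrr add0r.
by move=> /(_ hd); rewrite dotpNl ltrN2.
Qed.

Lemma conic_in L c h (t : R) : conic_pieces L -> c \in L -> 0 < t ->
  in_piece c (t *: h) = in_piece c h.
Proof.
move=> cL cinL t0; apply: eq_in_all => b bc; have [b0 _ _] := cL c cinL.
by rewrite /= b0 // dotpZr pmulr_rle0.
Qed.

Lemma conic_val L c h : conic_pieces L -> c \in L -> piece_val c h = dotp (lin c) h.
Proof.
move=> cL cinL; have [_ q0 a0] := cL c cinL.
by rewrite /piece_val q0 a0 mulmx0 dotp0l mulr0 add0r addr0.
Qed.

Lemma conic_has L h (t : R) : conic_pieces L -> 0 < t ->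
  has (in_piece^~ (t *: h)) L = has (in_piece^~ h) L.
Proof. by move=> cL t0; apply: eq_in_has => c cinL; rewrite (conic_in _ cL). Qed.

Lemma conic_dom L D g h (t : R) : plq_rep L D g -> conic_pieces L -> 0 < t ->
  D (t *: h) <-> D h.
Proof. by move=> Lg cL t0; rewrite !Lg.1 conic_has. Qed.

Lemma conic_homog L D g h (t : R) : plq_rep L D g -> conic_pieces L -> 0 < t ->
  D h -> g (t *: h) = t * g h.
Proof.
move=> Lg cL t0 /Lg.1/hasP[c cinL ch].
rewrite !(Lg.2 c) ?(conic_in _ cL) //.
by rewrite !(conic_val _ cL) // dotpZr.
Qed.

(* L' represents the directional derivative p of g at z, and L'' the          *)
(* quadratic part q.                                                          *)
Lemma plq_localize L D g z : plq_rep L D g -> convex_on D g -> D z ->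
  exists (L' L'' : seq (@piece R m)) T p q,
    [/\ [/\ plq_rep L' T p, conic_pieces L' & convex_on T p],
        plq_rep L'' T q,
        forall h (t : R), 0 < t -> q (t *: h) = t ^+ 2 * q h,
        (forall c, c \in L -> quad c = 0) -> forall h, q h = 0 &
        \forall h \near (0 : 'rV[R]_m), (D (z + h) <-> T h) /\
          (T h -> g (z + h) = g z + p h + 2^-1 * q h)].
Proof.
move=> Lg cg Dz.
pose La := [seq c <- L | in_piece c z].
pose c0 : @piece R m := ([::], (0, 0, 0)).
(* [p] and [q] are read off the first piece whose cone contains h. Outside T the default [c0] gives
   q = 0, so the homogeneity of q holds for all h. *)
pose sel h := nth c0 La (find (fun c => in_piece (loc z c) h) La).
pose T : set 'rV[R]_m := [set h | has (fun c => in_piece (loc z c) h) La].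
pose p h := dotp (lin (loc z (sel h))) h.
pose q h := dotp (h *m quad (sel h)) h.
have LaP c : c \in La -> c \in L /\ in_piece c z.
  by rewrite mem_filter => /andP[].
have conicL' : conic_pieces [seq loc z c | c <- La].
  by move=> _ /mapP[c _ ->]; split=> // b /mapP[b' _ ->].
have locZ c h (t : R) : c \in La -> 0 < t ->
    in_piece (loc z c) (t *: h) = in_piece (loc z c) h.
  by move=> cLa; apply: (conic_in _ conicL'); exact: map_f.
have locD c h : c \in La -> in_piece (loc z c) h ->
    \forall t \near (0 : R)^'+, g (z + t *: h) = g z +
      (t * dotp (lin (loc z c)) h + 2^-1 * (t ^+ 2 * dotp (h *m quad c) h)).
  move=> cLa ch; have [cL cz] := LaP _ cLa.
  have := near0_scale h (loc_near L z).
  apply: filterS2 (nbhs_right_gt 0) => t t0 /(_ c cL).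
  rewrite cz locZ // ch /= => czh.
  rewrite (Lg.2 c) // piece_val_shift -(Lg.2 c) // -addrA; congr (_ + _).
  by rewrite dotpZr -scalemxAl dotpZl dotpZr; ring.
(* The choice of piece is immaterial: two pieces containing h both expand g along the ray z + t h,
   hence have equal coefficients. *)
have pq c h : c \in La -> in_piece (loc z c) h ->
    p h = dotp (lin (loc z c)) h /\ q h = dotp (h *m quad c) h.
  move=> cLa ch; have hh : has (fun c => in_piece (loc z c) h) La.
    by apply/hasP; exists c.
  have sLa : sel h \in La by rewrite mem_nth // -has_find.
  apply: near0_quadratic_inj; have := locD _ _ sLa (nth_find c0 hh).
  apply: filterS2 (locD _ _ cLa ch) => t -> /addrI; exact.
have loc_dom : \forall h \near (0 : 'rV[R]_m), (D (z + h) <-> T h) /\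
    (T h -> g (z + h) = g z + p h + 2^-1 * q h).
  apply: filterS (loc_near L z) => h hL; split.
    rewrite Lg.1; split => /hasP[c].
      move=> cL; rewrite hL // => /andP[cz ch]; apply/hasP; exists c => //.
      by rewrite mem_filter cz.
    by move=> /LaP[cL cz] ch; apply/hasP; exists c => //; rewrite hL ?cz.
  move=> /hasP[c cLa ch]; have [cL cz] := LaP _ cLa.
  have [-> ->] := pq _ _ cLa ch.
  by rewrite (Lg.2 c) ?hL ?cz // piece_val_shift -(Lg.2 c).
have L'rep : plq_rep [seq loc z c | c <- La] T p.
  split=> [h|_ h /mapP[c cLa ->] ch]; first by rewrite has_map.
  by rewrite (conic_val _ conicL') ?map_f // (pq c _ cLa ch).1.
exists [seq loc z c | c <- La].
(* The factor 2 cancels the 1/2 in [piece_val]. *)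
exists [seq ((loc z c).1, (2 *: quad c, 0, 0)) | c <- La], T, p, q.
split=> //; last first.
- move=> L0 h; rewrite /q; suff -> : quad (sel h) = 0 by rewrite mulmx0 dotp0l.
  rewrite /sel; have [/(mem_nth c0)/LaP[/L0]//|] :=
    ltnP (find (fun c => in_piece (loc z c) h) La) (size La).
  by move=> /(nth_default c0) ->.
- move=> h t t0; rewrite /q.
  have -> : sel (t *: h) = sel h.
    by rewrite /sel; congr nth; apply: eq_in_find => c cLa; rewrite locZ.
  by rewrite -scalemxAl dotpZl dotpZr; ring.
- split=> [h|_ h /mapP[c cLa ->] ch]; first by rewrite has_map.
  rewrite (pq c _ cLa ch).2 /piece_val /= dotp0l -scalemxAr dotpZl; lra.
(* Convexity of p: write the convexity of g between z + t x and z + t y and keep the terms of order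
   t. *)
- split=> // x y a b Tx Ty a0 b0 ab.
  have TZ h (t : R) : 0 < t -> T (t *: h) <-> T h.
    exact: conic_dom L'rep conicL'.
  have pZ h (t : R) : 0 < t -> T h -> p (t *: h) = t * p h.
    exact: conic_homog L'rep conicL'.
  have qZ h (t : R) : 0 < t -> q (t *: h) = t ^+ 2 * q h.
    move=> t0; rewrite /q.
    have -> : sel (t *: h) = sel h.
      by rewrite /sel; congr nth; apply: eq_in_find => c cLa; rewrite locZ.
    by rewrite -scalemxAl dotpZl dotpZr; ring.
  have comb (t : R) : a *: (z + t *: x) + b *: (z + t *: y) =
      z + t *: (a *: x + b *: y).
    rewrite !scalerDr addrACA -scalerDl ab scale1r; congr (_ + (_ + _)).
      by rewrite !scalerA mulrC.
    by rewrite !scalerA mulrC.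
  have := near0_scale (a *: x + b *: y) loc_dom.
  have := near0_scale y loc_dom; have := near0_scale x loc_dom.
  move=> nx ny nxy.
  have near_xy : \forall t \near (0 : R)^'+, T (a *: x + b *: y) /\
     t * (p (a *: x + b *: y) - (a * p x + b * p y)) <=
     t ^+ 2 * (2^-1 * (a * q x + b * q y - q (a *: x + b *: y))).
    near=> t; have t0 : 0 < t by near: t; exact: nbhs_right_gt.
    have [Dx gx] : (D (z + t *: x) <-> T (t *: x)) /\
      (T (t *: x) -> g (z + t *: x) = g z + p (t *: x) + 2^-1 * q (t *: x)).
      by near: t.
    have [Dy gy] : (D (z + t *: y) <-> T (t *: y)) /\
      (T (t *: y) -> g (z + t *: y) = g z + p (t *: y) + 2^-1 * q (t *: y)).
      by near: t.
    have [Dxy gxy] : let w := a *: x + b *: y in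
      (D (z + t *: w) <-> T (t *: w)) /\
      (T (t *: w) -> g (z + t *: w) = g z + p (t *: w) + 2^-1 * q (t *: w)).
      by near: t.
    have Tx' : T (t *: x) by exact: (TZ _ _ t0).2 Tx.
    have Ty' : T (t *: y) by exact: (TZ _ _ t0).2 Ty.
    have [] := cg (z + t *: x) (z + t *: y) a b (Dx.2 Tx') (Dy.2 Ty') a0 b0 ab.
    rewrite comb => /Dxy Txy'; have Txy : T (a *: x + b *: y) by exact: (TZ _ _ t0).1 Txy'.
    rewrite gxy // gx // gy // !qZ // !pZ // => H; split=> //.
    have az : a * g z + b * g z = g z by rewrite -mulrDl ab mul1r.
    move: H az; set w := a *: x + b *: y; lra.
  split; first by have [t [Txy _]] := filter_ex near_xy.
  rewrite -subr_le0; apply: (@near0_linear_le _ _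
    (2^-1 * (a * q x + b * q y - q (a *: x + b *: y)))).
  by apply: filterS near_xy => t [].
Unshelve. all: by end_near. Qed.

End Localization.

(** * Linear programming duality *)

Section Duality.
Context {R : realType} {m : nat}.
Implicit Types (L : seq (@piece R m)) (D : set 'rV[R]_m)
  (g : 'rV[R]_m -> R) (x y z : 'rV[R]_m).

(** x + y is the midpoint of 2x and 2y. *)
Lemma conic_sublinear L D g x y : plq_rep L D g -> conic_pieces L ->
  convex_on D g -> D x -> D y -> D (x + y) /\ g (x + y) <= g x + g y.
Proof.
move=> Lg cL cg Dx Dy.
have D2 z : D z -> D (2 *: z) by move=> /(conic_dom z Lg cL (@ltr0Sn R 1)).
have half : (2 : R)^-1 + 2^-1 = 1 by lra.
have h0 : (0 : R) <= 2^-1 by lra.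
have [] := cg _ _ 2^-1 2^-1 (D2 _ Dx) (D2 _ Dy) h0 h0 half.
rewrite !scalerA mulVf // !scale1r => Dxy gxy; split=> //.
by move: gxy; rewrite !(conic_homog Lg cL) //; lra.
Qed.

Lemma conic_zero L D g x : plq_rep L D g -> conic_pieces L -> D x ->
  D 0 /\ g 0 = 0.
Proof.
move=> Lg cL /Lg.1/hasP[c cinL _].
have c0 : in_piece c 0.
  by apply/allP => b bc; have [b0 _ _] := cL c cinL; rewrite /= b0 // dotp0r.
split; first by apply/Lg.1/hasP; exists c.
by rewrite (Lg.2 c) // (conic_val _ cL) // dotp0r.
Qed.

Lemma conic_sum L D g (I : finType) (y : I -> 'rV[R]_m) z :
  plq_rep L D g -> conic_pieces L -> convex_on D g -> D z ->
  (forall i, D (y i)) -> D (\sum_i y i) /\ g (\sum_i y i) <= \sum_i g (y i).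
Proof.
move=> Lg cL cg Dz Dy; have [D0 g0] := conic_zero Lg cL Dz.
elim/big_rec2: _ => [|i b x _ [Dx gx]]; first by rewrite g0.
have [Dyx gyx] := conic_sublinear Lg cL cg (Dy i) Dx.
by split=> //; apply: le_trans gyx _; rewrite lerD2l.
Qed.

Lemma InP (T : eqType) (s : seq T) (x : T) : reflect (List.In x s) (x \in s).
Proof.
elim: s => [|y s IH]; first exact: ReflectF.
rewrite inE; apply: (iffP orP) => [[/eqP ->|/IH]|[->|/IH]]; by [left|right].
Qed.

(* Farkas' lemma in the variables (y_i)_i, u, s, where y_i lies in the i-th    *)
(* cone: the equation says sum_i y_i = u J + s b.                              *)
Lemma lp_duality n L D g (J : 'M[R]_(n, m)) (v : 'rV[R]_n) (b : 'rV[R]_m)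
    (c : R) (u0 : 'rV[R]_n) :
  plq_rep L D g -> conic_pieces L -> convex_on D g ->
  D (u0 *m J + b) ->
  (forall u, D (u *m J + b) -> c <= g (u *m J + b) - dotp v u) ->
  exists l : 'rV[R]_m, [/\ forall y, D y -> dotp l y <= g y,
    l *m J^T = v & c <= dotp l b].
Proof.
move=> Lg cL cg Du0 cu.
pose s := size L; pose c0 : @piece R m := ([::], (0, 0, 0)).
pose C (i : 'I_s) := nth c0 L i.
have CL i : C i \in L by exact: mem_nth.
pose V : lmodType R := ('M[R]_(s, m) * 'rV[R]_n * R^o)%type.
pose E (x : V) : 'rV[R]_m := \sum_i row i x.1.1 - x.1.2 *m J - x.2 *: b.
(* The functional to be bounded: f <= 0 on E = 0 with y_i in the cones and s >= 0 is the homogenized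
   form of the hypothesis that c is a lower bound. *)
pose f (x : V) : R := dotp v x.1.2 + x.2 * c - \sum_i dotp (lin (C i)) (row i x.1.1).
have Elin (a : R) (x y : V) : E (a *: x + y) = a *: E x + E y.
  rewrite /E /= mulmxDl -scalemxAl scalerDl.
  have -> : \sum_i row i (a *: x.1.1 + y.1.1) =
      a *: (\sum_i row i x.1.1) + \sum_i row i y.1.1.
    by rewrite scaler_sumr -big_split; apply: eq_bigr => i _; rewrite linearP.
  move: (\sum_i _) (\sum_i _) (x.1.2 *m J) (y.1.2 *m J) => S1 S2 U1 U2.
  by apply/rowP => j; rewrite !mxE /GRing.scale /=; ring.
have flin : scalar f.
  move=> a x y; rewrite /f /= dotpDr dotpZr.
  have -> : \sum_i dotp (lin (C i)) (row i (a *: x.1.1 + y.1.1)) =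
      a * \sum_i dotp (lin (C i)) (row i x.1.1) +
      \sum_i dotp (lin (C i)) (row i y.1.1).
    rewrite mulr_sumr -big_split /=; apply: eq_bigr => i _.
    by rewrite linearP dotpDr dotpZr.
  rewrite /GRing.scale /=; ring.
pose cons : seq (V -> R) :=
  (fun x : V => - x.2) ::
  List.app (List.flat_map (fun i => List.map
      (fun bb (x : V) => dotp bb.1 (row i x.1.1)) (C i).1) (enum 'I_s))
  (List.app (List.map (fun j (x : V) => E x 0 j) (enum 'I_m))
            (List.map (fun j (x : V) => - E x 0 j) (enum 'I_m))).
have consP (Q : (V -> R) -> Prop) : (forall a, List.In a cons -> Q a) <->
  [/\ Q (fun x : V => - x.2),
      forall i bb, bb \in (C i).1 -> Q (fun x : V => dotp bb.1 (row i x.1.1)),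
      forall j, Q (fun x : V => E x 0 j) & forall j, Q (fun x : V => - E x 0 j)].
  split=> [H|[H1 H2 H3 H4] a].
    split=> [|i bb bC|j|j]; apply: H; first by left.
    - right; apply/List.in_app_iff; left; apply/List.in_flat_map.
      exists i; split; first by apply/InP; rewrite mem_enum.
      by apply/List.in_map_iff; exists bb; split=> //; exact/InP.
    - right; apply/List.in_app_iff; right; apply/List.in_app_iff; left.
      by apply/List.in_map_iff; exists j; split=> //; apply/InP; rewrite mem_enum.
    - right; apply/List.in_app_iff; right; apply/List.in_app_iff; right.
      by apply/List.in_map_iff; exists j; split=> //; apply/InP; rewrite mem_enum.
  case=> [<- //|/List.in_app_iff[/List.in_flat_map[i [_ ]]|]].
    by move=> /List.in_map_iff[bb [<- /InP]]; exact: H2.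
  by move=> /List.in_app_iff[] /List.in_map_iff[j [<- _]].
(* This plays the role of the cone generated by [cons]. The multipliers of the equations E = 0 are
   collected in the vector l, while the inequality constraints only enter as the conditions under
   which h <= <l, E> is claimed. *)
pose Cone (h : V -> R) := exists l, forall x : V,
  (forall i, in_piece (C i) (row i x.1.1)) -> 0 <= x.2 -> h x <= dotp l (E x).
have [l lP] : Cone f.
  apply: (@farkas _ _ cons) => //.
  - apply/(consP (fun a => scalar a)); split.
    + by move=> a x y /=; rewrite opprD mulrN.
    + by move=> i bb _ a x y; rewrite linearP dotpDr dotpZr.
    + by move=> j a x y; rewrite Elin !mxE.
    + by move=> j a x y; rewrite Elin !mxE opprD mulrN.
  - by exists 0 => x _ _; rewrite dotp0l.
  - apply/(consP Cone); split.
    + by exists 0 => x _ x0; rewrite dotp0l oppr_le0.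
    + move=> i bb bC; exists 0 => x /(_ i) /allP /(_ bb bC) /= xi _.
      by have [bz _ _] := cL _ (CL i); rewrite dotp0l -(bz bb).
    + by move=> j; exists (delta_mx 0 j) => x _ _; rewrite dotp_delta.
    + by move=> j; exists (- delta_mx 0 j) => x _ _; rewrite dotpNl dotp_delta.
  - move=> a h1 h2 a0 [l1 H1] [l2 H2]; exists (l1 + a *: l2) => x xC x0.
    by rewrite dotpDl dotpZl lerD ?H1 // ler_wpM2l ?H2.
  - move=> x /(consP (fun a => a x <= 0))[x0 xC E1 E2].
    have xC' i : in_piece (C i) (row i x.1.1).
      apply/allP => bb bC; have [bz _ _] := cL _ (CL i).
      by rewrite /= bz // xC.
    have Ex : E x = 0.
      apply/rowP => j; rewrite [RHS]mxE; apply/le_anti.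
      by rewrite E1 /= -oppr_le0 E2.
    have Dxi i : D (row i x.1.1) by apply/Lg.1/hasP; exists (C i).
    have [Ds gs] := conic_sum Lg cL cg Du0 Dxi.
    have sE : \sum_i row i x.1.1 = x.1.2 *m J + x.2 *: b.
      by move/eqP: Ex; rewrite /E -addrA -opprD subr_eq0 => /eqP.
    have gE : \sum_i g (row i x.1.1) = \sum_i dotp (lin (C i)) (row i x.1.1).
      by apply: eq_bigr => i _; rewrite (Lg.2 (C i)) // (conic_val _ cL).
    rewrite /f -gE subr_le0; apply: le_trans gs; rewrite sE in Ds *.
    (* Case s = 0: if <v, u> exceeded g(uJ), then going from [u0] far along u would push the
       objective below c. *)
    move: x0; rewrite oppr_le0 le_eqVlt => /predU1P[x0|x0].
      rewrite -x0 scale0r addr0 in Ds *; rewrite mul0r addr0 leNgt; apply/negP => gv.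
      set u := x.1.2 in Ds gv.
      pose K := g (u0 *m J + b) - dotp v u0 - c.
      pose N := (`|K| + 1) / (dotp v u - g (u *m J)).
      have d0 : 0 < dotp v u - g (u *m J) by rewrite subr_gt0.
      have N0 : 0 < N by rewrite divr_gt0 // ltr_wpDl.
      have DN : D (N *: (u *m J)) by apply/(conic_dom _ Lg cL N0).
      have [] := conic_sublinear Lg cL cg DN Du0.
      have -> : N *: (u *m J) + (u0 *m J + b) = (u0 + N *: u) *m J + b.
        by rewrite mulmxDl -scalemxAl addrA [_ + u0 *m J]addrC.
      move=> /cu; rewrite (conic_homog Lg cL N0) // dotpDr dotpZr.
      have : N * (dotp v u - g (u *m J)) = `|K| + 1 by rewrite divfK // gt_eqF.
      have := ler_norm K; rewrite /K; lra.
    (* Case s > 0: rescale to s = 1, where the lower bound c applies directly. *)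
    have xb : (x.2^-1 *: x.1.2) *m J + b = x.2^-1 *: (x.1.2 *m J + x.2 *: b).
      by rewrite scalerDr scalerA mulVf ?gt_eqF // scale1r scalemxAl.
    have x0V : 0 < x.2^-1 by rewrite invr_gt0.
    have := cu (x.2^-1 *: x.1.2); rewrite xb (conic_dom _ Lg cL x0V).
    move=> /(_ Ds); rewrite (conic_homog Lg cL x0V Ds) dotpZr -mulrBr.
    rewrite -(ler_pM2l x0) mulrA divff ?gt_eqF // mul1r; lra.
have C0 i : in_piece (C i) 0.
  apply/allP => bb bC; have [bz _ _] := cL _ (CL i).
  by rewrite /= bz // dotp0r.
have row0 i : row i (0 : 'M[R]_(s, m)) = 0 by apply/rowP => j; rewrite !mxE.
have sum0 : \sum_(i < s) row i (0 : 'M[R]_(s, m)) = 0 by rewrite big1.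
have fsum0 : \sum_(i < s) dotp (lin (C i)) (row i (0 : 'M[R]_(s, m))) = 0.
  by rewrite big1 // => i _; rewrite row0 dotp0r.
have lu (u : 'rV[R]_n) : dotp v u <= dotp (- l) (u *m J).
  have := lP (0, u, 0); rewrite /f /E /= fsum0 sum0 mul0r addr0 subr0 scale0r.
  rewrite subr0 sub0r dotpNr dotpNl; apply => // i; by rewrite row0.
(* The three claims are the inequality f <= <l, E> at points with a single nonzero component: one
   y_i, then u with both signs, then s = 1. *)
exists (- l); split.
- move=> y Dy; have /Lg.1/(has_nthP c0)[i iL iy] := Dy.
  pose k : 'I_s := Ordinal iL.
  pose Y : 'M[R]_(s, m) := delta_mx k 0 *m y.
  have rowY j : row j Y = if j == k then y else 0.
    apply/rowP => a; rewrite !mxE big_ord1 !mxE eqxx andbT.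
    by case: eqP => _; rewrite ?mul1r ?mul0r // mxE.
  have := lP (Y, 0, 0); rewrite /f /E /= dotp0r mul0r add0r sub0r mul0mx scale0r.
  have -> : \sum_i row i Y = y.
    rewrite (bigD1 k) //= rowY eqxx big1 ?addr0 // => j jk.
    by rewrite rowY (negbTE jk).
  have -> : \sum_i dotp (lin (C i)) (row i Y) = g y.
    rewrite (bigD1 k) //= rowY eqxx big1 ?addr0 => [|j jk]; last first.
      by rewrite rowY (negbTE jk) dotp0r.
    by rewrite (Lg.2 (C k)) // (conic_val _ cL).
  rewrite !subr0 dotpNl => H; rewrite lerNl; apply: H => // j.
  by rewrite rowY; case: eqP => [->|].
- apply: dotp_inj => u; apply/le_anti; rewrite -dotp_mulmx lu andbT.
  by have := lu (- u); rewrite mulNmx !dotpNr lerN2.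
- have := lP (0, 0, 1); rewrite /f /E /= fsum0 sum0 dotp0r mul0mx scale1r.
  rewrite mul1r !subr0 !sub0r add0r dotpNr dotpNl; apply => // i.
  by rewrite row0.
Qed.

End Duality.

(** * Second-order Taylor expansions *)

Section Differentiability.
Context {R : realType}.
Implicit Types V W : normedModType R.

Lemma diff_eps V W (f : V -> W) x (e : R) : differentiable f x -> 0 < e ->
  \forall h \near (0 : V), `|f (x + h) - f x - 'd f x h| <= e * `|h|.
Proof.
move=> /diff_locally /eqaddoP fo e0; have := fo e e0.
apply: filterS => h /=.
by rewrite /cst !fctE /= opprD addrA [h + x]addrC.
Qed.

Lemma eps_diff V W (f : V -> W) (df : {linear V -> W}) x : continuous df ->
  (forall e : R, 0 < e ->
    \forall h \near (0 : V), `|f (x + h) - f x - df h| <= e * `|h|) ->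
  differentiable f x /\ 'd f x = df :> (V -> W).
Proof.
move=> cdf fe.
have fo : f \o shift x = cst (f x) + df +o_ 0 id.
  apply/eqaddoP => e e0; have := fe e e0; apply: filterS => h.
  by rewrite /cst !fctE /= opprD addrA [h + x]addrC.
have dE := diff_unique cdf fo; split=> //.
by apply/diff_locallyP; rewrite dE.
Qed.

Lemma is_derive_line V (g : V -> R) (x h : V) (t : R) :
  differentiable g (x + t *: h) ->
  is_derive t 1 (fun s : R => g (x + s *: h)) ('d g (x + t *: h) h).
Proof.
move=> dg.
have lineE : (fun s : R => s^-1 *: (((fun s : R => g (x + s *: h)) \o shift t) (s *: 1)
      - g (x + t *: h))) =
    (fun s : R => s^-1 *: ((g \o shift (x + t *: h)) (s *: h) - g (x + t *: h))).
  apply/funext => s /=; congr (_ *: (g _ - _)).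
  by rewrite /GRing.scale /= mulr1 -/(GRing.scale _ _) scalerDl addrCA.
split; first by rewrite /derivable lineE; exact: diff_derivable.
by rewrite -(deriveE h dg) /derive lineE.
Qed.

Lemma mvt01 (F dF : R -> R) :
  (forall t : R, 0 <= t <= 1 -> is_derive t 1 F (dF t)) ->
  exists2 c, 0 <= c <= 1 & F 1 - F 0 = dF c.
Proof.
move=> Fd.
have Fc : {within `[0, 1], continuous F}.
  apply: derivable_within_continuous => t t01.
  have [] // := Fd t.
have Fo (t : R) : t \in `]0, 1[%R -> is_derive t 1 F (dF t).
  by rewrite in_itv /= => /andP[t0 t1]; apply: Fd; rewrite !ltW.
by have [c c01] := MVT_segment ler01 Fo Fc; rewrite subr0 mulr1; exists c.
Qed.

Lemma is_derive_poly2 (a b t : R) :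
  is_derive t 1 (fun s : R => a * s + b * s ^+ 2) (a + 2 * b * t).
Proof.
have := is_deriveD (is_deriveZ a (is_derive_id t 1))
                   (is_deriveZ b (is_deriveX 2 (is_derive_id t 1))).
suff -> : a *: 1 + b *: (2 * t ^+ 1 *: 1) = a + 2 * b * t :> R by [].
by rewrite /GRing.scale /= !mulr1; ring.
Qed.

(** Second derivatives exist only at x, so the mean value theorem is applied once, to t |-> g(x + t
    h) minus its candidate quadratic in t. The derivative is <G(x + t h) - G(x) - E(t h), h>, which
    is o(|h|^2). G stands for the gradient and E for its derivative at x. *)
Lemma taylor2 n (g : 'rV[R]_n -> R) (G E : 'rV[R]_n -> 'rV[R]_n) x (e : R) :
  (\forall y \near x, differentiable g y /\ forall h, 'd g y h = dotp (G y) h) ->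
  (forall e, 0 < e ->
    \forall h \near (0 : 'rV[R]_n), `|G (x + h) - G x - E h| <= e * `|h|) ->
  (forall t h, E (t *: h) = t *: E h) -> 0 < e ->
  \forall h \near (0 : 'rV[R]_n),
    `|g (x + h) - g x - dotp (G x) h - 2^-1 * dotp (E h) h| <= e * `|h| ^+ 2.
Proof.
move=> /near_normP[d d0 dg] GE EZ e0.
have e1 : 0 < e / (n%:R + 1) by rewrite divr_gt0 // ltr_wpDl.
have /near_normP[d' d'0 dG] := GE _ e1.
apply/near_normP; exists (Num.min d d'); first by rewrite lt_min d0.
move=> h; rewrite subr0 lt_min => /andP[hd hd'].
have small (c : R) : 0 <= c <= 1 -> `|c *: h| <= `|h|.
  by move=> /andP[c0 c1]; rewrite normrZ ger0_norm // ler_piMl.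
pose a := dotp (G x) h; pose b := dotp (E h) h.
pose F1 (t : R) := g (x + t *: h).
pose F2 (t : R) := a * t + (2^-1 * b) * t ^+ 2.
pose F : R -> R := F1 - F2.
pose dF t := dotp (G (x + t *: h) - G x - E (t *: h)) h.
have FE t : F t = F1 t - F2 t by [].
have Fd (t : R) : 0 <= t <= 1 -> is_derive t 1 F (dF t).
  move=> /small th.
  have [|dgt gt] := dg (x + t *: h).
    by rewrite addrAC subrr add0r; exact: le_lt_trans hd.
  have Hl := is_derive_line dgt.
  suff -> : dF t = 'd g (x + t *: h) h - (a + 2 * (2^-1 * b) * t).
    exact: is_deriveB Hl (is_derive_poly2 a (2^-1 * b) t).
  rewrite gt /dF EZ !dotpBl dotpZl -/a -/b; lra.
have [c c01 H] := mvt01 Fd; have ch := small _ c01.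
have -> : g (x + h) - g x - a - 2^-1 * b = dF c.
  by rewrite -H !FE /F1 /F2 scale1r scale0r addr0; lra.
apply: le_trans (dotp_le_norm _ _) _.
have Gc := dG (c *: h); rewrite subr0 in Gc.
have Gc' := le_trans (Gc (le_lt_trans ch hd')) (ler_wpM2l (ltW e1) ch).
rewrite expr2 mulrA ler_wpM2r //.
apply: le_trans (ler_wpM2l (ler0n _ n) Gc') _.
rewrite mulrA ler_wpM2r // mulrCA (ler_piMr (ltW e0)) //.
by rewrite ler_pdivrMr ?ltr_wpDl // mul1r lerDl.
Qed.

End Differentiability.

Lemma addrACA3 (V : zmodType) (p q r u v w : V) :
  p + u - (q + v) - (r + w) = (p - q - r) + (u - v - w).
Proof. by rewrite (opprD q v) (addrACA p u) (opprD r w) (addrACA (p - q)). Qed.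

Lemma bounded_linear_continuous (R : realType) (V W : normedModType R) (u : {linear V -> W})
  (C : R) : (forall x : V, `|u x| <= C * `|x|) -> continuous u.
Proof.
move=> uC x; apply/cvgrPdist_le => e e0.
have C1 : 0 < `|C| + 1 by rewrite ltr_wpDl.
near=> y; rewrite -linearB; apply: le_trans (uC _) _.
apply: (@le_trans _ _ ((`|C| + 1) * `|x - y|)).
  by rewrite ler_wpM2r // (le_trans (ler_norm _)) // lerDl.
rewrite -ler_pdivlMl // mulrC; near: y; apply: cvgr_dist_le; first exact: cvg_id.
by rewrite divr_gt0.
Unshelve. all: by end_near. Qed.

Lemma bounded_linear_diff (R : realType) (V W : normedModType R) (f T : V -> W)
    x (C : R) : linear T -> (forall h, `|T h| <= C * `|h|) ->
  (forall e : R, 0 < e ->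
    \forall h \near (0 : V), `|f (x + h) - f x - T h| <= e * `|h|) ->
  differentiable f x /\ forall h, 'd f x h = T h.
Proof.
move=> lin TC fT; pose linM := GRing.isLinear.Build _ _ _ _ _ lin.
pose D : {linear V -> W} := HB.pack T linM.
have cD : continuous D by exact: (@bounded_linear_continuous _ _ _ D C TC).
by have [df dE] := @eps_diff _ _ _ f D x cD fT; split=> // h; rewrite dE.
Qed.

Section SecondOrderCalculus.
Context {R : realType} {n m : nat}.
Implicit Types (f : 'rV[R]_n -> 'rV[R]_m) (g : 'rV[R]_n -> R)
  (x y h w : 'rV[R]_n) (l : 'rV[R]_m).

Lemma diff_dotp f y l : differentiable f y ->
  differentiable (fun z => dotp l (f z)) y /\
  forall h, 'd (fun z => dotp l (f z)) y h = dotp l ('d f y h).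
Proof.
move=> df.
have [k k0 dk] := linear_lipschitz (@diff_continuous _ _ _ _ _ df).
apply: (@bounded_linear_diff _ _ _ _ (fun h => dotp l ('d f y h)) _
  (m%:R * `|l| * k)) => [a u v|h|].
- by rewrite linearP dotpDr dotpZr.
- apply: le_trans (dotp_le_norm _ _) _.
  by rewrite -[leRHS]mulrA ler_wpM2l // mulr_ge0.
move=> e e0; have l1 : 0 < m%:R * `|l| + 1 by rewrite ltr_wpDl // mulr_ge0.
have := diff_eps df (divr_gt0 e0 l1); apply: filterS => h Hh.
rewrite -!dotpBr; apply: le_trans (dotp_le_norm _ _) _.
apply: (@le_trans _ _ ((m%:R * `|l| + 1) * (e / (m%:R * `|l| + 1) * `|h|))).
  apply: ler_pM => //.
  by rewrite lerDl.
by rewrite mulrA [_ * (e / _)]mulrC divfK // gt_eqF.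
Qed.

Lemma jacobianE f y h : h *m jacobian f y = 'd f y h.
Proof. by rewrite /jacobian mul_rV_lin1. Qed.

Lemma gradE g y h : dotp (grad g y) h = 'd g y h.
Proof.
rewrite [in RHS](row_sum_delta h) linear_sum dotpE; apply: eq_bigr => i _.
by rewrite linearZ mxE mulrC.
Qed.

(** Componentwise application of [taylor2]: the gradient of the j-th component is the j-th column of
    the Jacobian, and the sup norm is controlled by the components. *)
Lemma taylor2_map f x (e : R) : twice_differentiable_map f x -> 0 < e ->
  \forall h \near (0 : 'rV[R]_n),
    `|f (x + h) - f x - h *m jacobian f x
      - 2^-1 *: (h *m 'd (jacobian f) x h)| <= e * `|h| ^+ 2.
Proof.
move=> [df dJ] e0.
have H j : \forall h \near (0 : 'rV[R]_n),
    `|f (x + h) 0 j - f x 0 j - (h *m jacobian f x) 0 j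
      - 2^-1 * (h *m 'd (jacobian f) x h) 0 j| <= e * `|h| ^+ 2.
  pose col' (A : 'M[R]_(n, m)) := (col j A)^T.
  have colE A h : dotp (col' A) h = (h *m A) 0 j.
    rewrite dotpE mxE; apply: eq_bigr => i _; by rewrite !mxE mulrC.
  have near_d : \forall y \near x, differentiable (fun z => f z 0 j) y /\
      forall h, 'd (fun z => f z 0 j) y h = dotp (col' (jacobian f y)) h.
    have fj : (fun z => f z 0 j) = (fun z => dotp (delta_mx 0 j) (f z)).
      by apply/funext => z; rewrite dotp_delta.
    apply: filterS df => y /(diff_dotp (delta_mx 0 j)); rewrite -fj => -[? dE].
    by split=> // h; rewrite dE dotp_delta colE jacobianE.
  have near_J e1 : 0 < e1 -> \forall h \near (0 : 'rV[R]_n),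
      `|col' (jacobian f (x + h)) - col' (jacobian f x)
        - col' ('d (jacobian f) x h)| <= e1 * `|h|.
    move=> /(diff_eps dJ); apply: filterS => h; apply: le_trans.
    apply: norm_le_entry => // i k; rewrite !mxE.
    have := entry_le_norm (jacobian f (x + h) - jacobian f x
      - 'd (jacobian f) x h) k j; by rewrite !mxE.
  have colZ (t : R) h : col' ('d (jacobian f) x (t *: h)) =
      t *: col' ('d (jacobian f) x h).
    by rewrite linearZ; apply/rowP => k; rewrite !mxE.
  by have := taylor2 near_d near_J colZ e0; apply: filterS => h; rewrite !colE.
have := @near_seq _ (nbhs (0 : 'rV[R]_n)) 'I_m (enum 'I_m) _ (nbhs_filter _)
  (fun j _ => H j).
apply: filterS => h Hh; apply: norm_le_entry => [|i j].
  by rewrite mulr_ge0 ?exprn_ge0 // ltW.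
suff -> : (f (x + h) - f x - h *m jacobian f x
    - 2^-1 *: (h *m 'd (jacobian f) x h)) i j = f (x + h) 0 j - f x 0 j
  - (h *m jacobian f x) 0 j - 2^-1 * (h *m 'd (jacobian f) x h) 0 j.
  by apply: Hh; rewrite mem_enum.
by rewrite [i]ord1; move: (h *m _) (h *m _) => A B; rewrite !mxE.
Qed.

Lemma taylor2_fun g x (e : R) : twice_differentiable_fun g x -> 0 < e ->
  \forall h \near (0 : 'rV[R]_n),
    `|g (x + h) - g x - dotp (grad g x) h - 2^-1 * dotp ('d (grad g) x h) h|
      <= e * `|h| ^+ 2.
Proof.
move=> [dg dG] e0; apply: taylor2 => //.
- by apply: filterS dg => y dgy; split=> // h; rewrite gradE.
- by move=> e1; exact: diff_eps.
- by move=> t h; rewrite linearZ.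
Qed.

(** The conjugate is constant in x. The formula for the gradient of the Lagrangian holds on a
    neighbourhood of x, and is then differentiated at x. *)
Lemma lagrangian_quadE (phi0 : 'rV[R]_n -> R) f (theta : 'rV[R]_m -> \bar R)
    x l w :
  twice_differentiable_fun phi0 x -> twice_differentiable_map f x ->
  lagrangian_quad phi0 f theta x l w =
    dotp ('d (grad phi0) x w) w + dotp l (w *m 'd (jacobian f) x w).
Proof.
move=> [dp dG] [df dJ].
pose Lg y := lagrangian phi0 f theta y l.
have gradL : \forall y \near x,
    grad Lg y = grad phi0 y + l *m (jacobian f y)^T.
  apply: filterS2 dp df => y dpy dfy.
  have [dl dlE] := diff_dotp l dfy.
  pose c : R := - fine (conjugate theta l).
  have LgE : Lg = phi0 + (fun z => dotp l (f z)) + cst c by apply/funext.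
  have dLg h : 'd Lg y h = 'd phi0 y h + dotp l (h *m jacobian f y).
    pose F z := dotp l (f z).
    have d1 : 'd (phi0 + F + cst c) y h = 'd (phi0 + F) y h + 'd (cst c) y h.
      exact: (congr1 (fun u : _ -> _ => u h)
        (diffD (differentiableD dpy dl) (differentiable_cst c y))).
    have d2 : 'd (phi0 + F) y h = 'd phi0 y h + 'd F y h.
      exact: (congr1 (fun u : _ -> _ => u h) (diffD dpy dl)).
    have d3 : 'd (cst c) y h = 0.
      exact: (congr1 (fun u : _ -> _ => u h) (@diff_cst _ _ _ c y)).
    rewrite LgE; apply: (etrans d1); apply: (etrans (congr2 +%R d2 d3)).
    apply: (etrans (addr0 _)); congr (_ + _); apply: (etrans (dlE h)).
    by rewrite jacobianE.
  apply: dotp_inj => h.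
  by rewrite gradE dLg dotpDl gradE dotp_mulmx.
pose T h := 'd (grad phi0) x h + l *m ('d (jacobian f) x h)^T.
suff [_ dE] : differentiable (grad Lg) x /\ forall h, 'd (grad Lg) x h = T h.
  have hE : w *m hessian Lg x = T w := etrans (mul_rV_lin1 _ _) (dE w).
  apply: (etrans (congr1 (dotp^~ w) hE)).
  by rewrite /T dotpDl -dotp_mulmx.
move: (grad Lg) gradL => GL gradL.
have [k k0 dk] := linear_lipschitz (@diff_continuous _ _ _ _ _ dG).
have [k' k'0 dk'] := linear_lipschitz (@diff_continuous _ _ _ _ _ dJ).
apply: (@bounded_linear_diff _ _ _ _ T _ (k + m%:R * `|l| * k')) => [a u v|h|].
- by rewrite /T !linearP /= scalerDr addrACA.
- apply: le_trans (ler_normD _ _) _; rewrite mulrDl lerD //.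
  apply: le_trans (norm_mulmx _ _) _.
  by rewrite norm_trmx -[leRHS]mulrA ler_wpM2l // mulr_ge0.
move=> e e0; have l1 : 0 < 1 + m%:R * `|l| by rewrite ltr_wpDr // mulr_ge0.
have e1 := divr_gt0 e0 l1.
have /near_normP[d d0 dP] := gradL.
have gx := nbhs_singleton gradL.
have /near_normP[d1 d10 H1] := diff_eps dG e1.
have /near_normP[d2 d20 H2] := diff_eps dJ e1.
apply/near_normP; exists (Num.min d (Num.min d1 d2)).
  by rewrite !lt_min d0 d10.
move=> h; rewrite !lt_min => /and3P[hd /H1{}H1 /H2{}H2].
rewrite gx (dP (x + h)); last first.
  by rewrite addrAC subrr add0r -[h]subr0.
set a := grad phi0 (x + h) - grad phi0 x - 'd (grad phi0) x h in H1.
set b := jacobian f (x + h) - jacobian f x - 'd (jacobian f) x h in H2.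
have -> : grad phi0 (x + h) + l *m (jacobian f (x + h))^T
    - (grad phi0 x + l *m (jacobian f x)^T) - T h = a + l *m b^T.
  have -> : b^T = (jacobian f (x + h))^T - (jacobian f x)^T - ('d (jacobian f) x h)^T.
    by apply/matrixP => i j; rewrite !mxE.
  rewrite !mulmxBr /a /T.
  exact: addrACA3.
apply: le_trans (ler_normD _ _) _.
have H3 : `|l *m b^T| <= m%:R * `|l| * (e / (1 + m%:R * `|l|) * `|h|).
  apply: le_trans (norm_mulmx _ _) _.
  by rewrite norm_trmx ler_wpM2l // mulr_ge0.
apply: le_trans (lerD H1 H3) _.
rewrite -[X in X + _]mul1r -mulrDl mulrA [_ * (e / _)]mulrC divfK // gt_eqF //.
Qed.

End SecondOrderCalculus.

(** * Lower limits, normal cones and subgradients *)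

Section LimInf.
Context {R : realType} {T : choiceType} {X : filteredType T}.
Implicit Types (f : X -> \bar R) (F : set_system X) (l : R).

Lemma limf_einf_freq f F l (e : R) (A : set X) : (limf_einf f F <= l%:E)%E ->
  0 < e -> F A -> exists2 x, A x & (f x <= (l + e)%:E)%E.
Proof.
move=> fl e0 FA; apply: contrapT => /forall2NP nA.
suff : ((l + e)%:E <= limf_einf f F)%E.
  by move=> /le_trans /(_ fl); rewrite lee_fin gerDl leNgt e0.
rewrite limf_einfE; apply: (@le_trans _ _ (ereal_inf (f @` A))).
  apply: le_ereal_inf_tmp => _ [x Ax <-].
  by have [//|/negP] := nA x; rewrite -ltNge => /ltW.
by apply: ereal_sup_ubound; exists A.
Qed.

Lemma limf_einf_le f F l :
  (forall (e : R) A, 0 < e -> F A -> exists2 x, A x & (f x <= (l + e)%:E)%E) ->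
  (limf_einf f F <= l%:E)%E.
Proof.
move=> H; rewrite limf_einfE; apply: ge_ereal_sup => _ [A FA <-].
apply/lee_addgt0Pr => e e0; have [x Ax fx] := H e A e0 FA.
by rewrite -EFinD; apply: le_trans fx; apply: ereal_inf_lbound; exists x.
Qed.

Lemma le_limf_einf f F l : Filter F ->
  (forall e : R, 0 < e -> \forall x \near F, ((l - e)%:E <= f x)%E) ->
  (l%:E <= limf_einf f F)%E.
Proof.
move=> FF H; rewrite limf_einfE; apply/lee_addgt0Pr => e e0.
rewrite -leeBlDr // -EFinB.
apply: (@le_trans _ _ (ereal_inf (f @` [set x | ((l - e)%:E <= f x)%E]))).
  by apply: le_ereal_inf_tmp => _ [x fx <-].
by apply: ereal_sup_ubound; exists [set x | ((l - e)%:E <= f x)%E] => //; exact: H.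
Qed.

End LimInf.

Lemma near_prodP {R : realType} {n} (w : 'rV[R]_n) (A : set (R * 'rV[R]_n)) :
  filter_prod (0 : R)^'+ (nbhs w) A <->
  exists2 d : R, 0 < d &
    forall t u, 0 < t -> t < d -> `|u - w| < d -> A (t, u).
Proof.
split=> [[[/= P Q] [P0 /near_normP[d d0 Qd]] PQA]|[d d0 dA]].
  have [e /= e0 Pe] := P0.
  exists (Num.min d e) => [|t u t0]; first by rewrite lt_min d0.
  rewrite !lt_min => /andP[_ te] /andP[/Qd Qu _]; apply: PQA; split=> //=.
  by apply: Pe => //=; rewrite sub0r normrN gtr0_norm.
exists ([set t | 0 < t < d], [set u | `|u - w| < d]).
  split; last by apply/near_normP; exists d.
  exists d => //= t /=; rewrite sub0r normrN => td t0; rewrite t0 /=.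
  exact: le_lt_trans (ler_norm _) td.
by move=> [t u] /= [/andP[t0 td] ud]; exact: dA.
Qed.

Section NormalCone.
Context {R : realType} {n : nat}.
Implicit Types (C : set 'rV[R]_n) (x y v : 'rV[R]_n).

Lemma regular_normal_near C x v (e : R) : regular_normal_cone C x v -> 0 < e ->
  \forall y \near x, C y -> dotp v (y - x) <= e * `|y - x|.
Proof.
rewrite /regular_normal_cone /= -[limf_esup _ _]oppeK -limf_einfN oppe_le0 => H e0.
have n1 : 0 < n%:R + 1 :> R by rewrite ltr_wpDl.
have {}H : (0%:E <= limf_einf (\- (fun y => (dotp v (y - x) / enorm (y - x))%:E))
   (within C x^'))%E by [].
(* The Euclidean norm is at most n times the sup norm, so this threshold yields the bound e in the
   sup norm. *)
have e1 : 0 < e / (n%:R + 1) by rewrite divr_gt0.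
have [A [/near_normP[d d0 dA] Ae]] : exists A, within C x^' A /\
    forall y, A y -> dotp v (y - x) / enorm (y - x) <= e / (n%:R + 1).
  apply: contrapT => /forallNP nA.
  move: H; rewrite limf_einfE leNgt => /negP; apply.
  apply: (@le_lt_trans _ _ (- (e / (n%:R + 1)))%:E); last by rewrite lte_fin oppr_lt0.
  apply: ge_ereal_sup => _ [A FA <-].
  have /not_andP[//|/existsNP[y /not_implyP[Ay /negP]]] := nA A.
  rewrite -ltNge => ye; apply: (@le_trans _ _ (- (dotp v (y - x) / enorm (y - x)))%:E).
    by apply: ereal_inf_lbound; exists y.
  by rewrite lee_fin lerN2 ltW.
apply/near_normP; exists d => // y yd Cy.
have [->|yx] := eqVneq y x; first by rewrite subrr dotp0r normr0 mulr0.
have := Ae y (dA y yd yx Cy).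
have en : 0 < enorm (y - x).
  by apply: lt_le_trans (norm_le_enorm _); rewrite normr_gt0 subr_eq0.
rewrite ler_pdivrMr // => /le_trans; apply.
apply: le_trans (ler_wpM2l (ltW e1) (enorm_le_norm _)) _.
rewrite mulrA ler_wpM2r // mulrAC ler_pdivrMr // ler_wpM2l ?(ltW e0) //.
by rewrite lerDl.
Qed.

Definition star_convex C x :=
  forall y (t : R), C y -> 0 < t -> t <= 1 -> C (x + t *: (y - x)).

(** The quotient <v, y - x> / |y - x| is constant along the segment from x to y, so its upper limit
    at x decides its sign. *)
Lemma regular_normal_convex C x v : star_convex C x ->
  regular_normal_cone C x v -> forall y, C y -> dotp v (y - x) <= 0.
Proof.
move=> sC vN y Cy; rewrite leNgt; apply/negP => vy.
have n1 : 0 < `|y - x| + 1 by rewrite ltr_wpDl.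
have e0 : 0 < dotp v (y - x) / (`|y - x| + 1) by rewrite divr_gt0.
have /near_normP[d d0 dC] := regular_normal_near vN e0.
have [t [t0 t1 td]] : exists t : R, [/\ 0 < t, t <= 1 & t * (`|y - x| + 1) < d].
  exists (Num.min 1 (d / (2 * (`|y - x| + 1)))); split.
  - by rewrite lt_min ltr01 divr_gt0 // mulr_gt0.
  - by rewrite ge_min lexx.
  - rewrite -ltr_pdivlMr // gt_min; apply/orP; right.
    by rewrite invfM mulrA ltr_pM2r ?invr_gt0 //; lra.
have xt : x + t *: (y - x) - x = t *: (y - x) by rewrite addrAC subrr add0r.
have := dC (x + t *: (y - x)); rewrite xt normrZ gtr0_norm // dotpZr.
have yx := normr_ge0 (y - x).
have tyd : t * `|y - x| < d by nra.
move=> /(_ tyd (sC _ _ Cy t0 t1)); rewrite mulrCA ler_pM2l // leNgt => /negP; apply.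
rewrite mulrAC ltr_pdivrMr // ltr_pM2l //; lra.
Qed.

Lemma convex_regular_normal C x v : (forall y, C y -> dotp v (y - x) <= 0) ->
  regular_normal_cone C x v.
Proof.
move=> vC; rewrite /regular_normal_cone /= limf_esupE.
apply: (@le_trans _ _ (ereal_sup ((fun y => (dotp v (y - x) / enorm (y - x))%:E) @` C))).
  apply: ereal_inf_lbound; exists C => //.
  rewrite /within /=; apply: nearW => y. by [].
apply: ge_ereal_sup => _ [y Cy <-]; rewrite lee_fin.
by rewrite mulr_le0_ge0 ?vC // invr_ge0 sqrtr_ge0.
Qed.

End NormalCone.

Lemma cvg_seq_near {R : realType} {n} (x_ : nat -> 'rV[R]_n) (x : 'rV[R]_n) (e : R) :
  x_ @ \oo --> x -> 0 < e -> \forall k \near \oo, `|x_ k - x| < e.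
Proof.
move=> xx e0; have : nbhs x [set y | `|y - x| < e] by apply/near_normP; exists e.
by move/xx.
Qed.

Lemma dotp_row_mx {R : realType} {n k} (a c : 'rV[R]_n) (b d : 'rV[R]_k) :
  dotp (row_mx a b) (row_mx c d) = dotp a c + dotp b d.
Proof. by rewrite /dotp tr_row_mx mul_row_col mxE. Qed.

Lemma dotp_scalar {R : realType} (a b : R) : dotp (a%:M : 'rV_1) b%:M = a * b.
Proof. by rewrite dotpE big_ord1 !mxE eqxx. Qed.

Lemma row_mx_hsub {R : realType} {n} (Y : 'rV[R]_(n + 1)) :
  Y = row_mx (lsubmx Y) (rsubmx Y 0 0)%:M.
Proof. by rewrite -[(rsubmx Y 0 0)%:M]mx11_scalar hsubmxK. Qed.

Lemma norm_lsubmx {R : realType} {n} (Y : 'rV[R]_(n + 1)) : `|lsubmx Y| <= `|Y|.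
Proof. by apply: norm_le_entry => // i j; rewrite mxE entry_le_norm. Qed.

Lemma norm_rsubmx {R : realType} {n} (Y : 'rV[R]_(n + 1)) : `|rsubmx Y 0 0| <= `|Y|.
Proof. by rewrite mxE entry_le_norm. Qed.

Lemma norm_row_mx {R : realType} {n} (y : 'rV[R]_n) (a : R) :
  `|row_mx y (a%:M : 'rV_1)| <= `|y| + `|a|.
Proof.
apply: norm_le_entry => [|i j]; first by rewrite addr_ge0.
rewrite mxE; case: splitP => k _; first by rewrite (le_trans (entry_le_norm _ _ _)) ?lerDl.
rewrite ord1 [k]ord1 mxE eqxx; by rewrite lerDr.
Qed.

Section ExtendedValued.
Context {R : realType} {m : nat}.
Variable theta : 'rV[R]_m -> \bar R.
Implicit Types (x y z l : 'rV[R]_m).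

Definition fval y : R := fine (theta y).

Hypothesis theta_proper : forall y, theta y != -oo%E.

Lemma fvalE y : dom theta y -> theta y = (fval y)%:E.
Proof.
rewrite /dom /= /fval => yD; rewrite fineK // fin_numE theta_proper /=.
by rewrite lt_eqF.
Qed.

Lemma dom_le y (a : R) : (theta y <= a%:E)%E <-> dom theta y /\ fval y <= a.
Proof.
split=> [ya|[Dy]]; last by rewrite (fvalE Dy) lee_fin.
have Dy : dom theta y by apply: le_lt_trans ya _; rewrite ltry.
by split=> //; rewrite -lee_fin -fvalE.
Qed.

Lemma convex_on_fval : convex_efun theta -> convex_on (dom theta) fval.
Proof.
move=> cth x y a b Dx Dy; rewrite le_eqVlt => /predU1P[<-|a0].
  by rewrite add0r => _ ->; rewrite !scale0r !scale1r add0r mul0r mul1r add0r.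
rewrite le_eqVlt => /predU1P[<-|b0].
  by rewrite addr0 => ->; rewrite !scale0r !scale1r addr0 mul0r mul1r addr0.
move=> ab; have bE : b = 1 - a by rewrite -ab addrC addKr.
have a1 : a < 1 by rewrite -ab ltrDl.
have := cth x y a a0 a1; rewrite (fvalE Dx) (fvalE Dy) -!EFinM -EFinD bE.
by move=> /dom_le.
Qed.

Lemma plq_fval : piecewise_linear_quadratic theta ->
  exists L, plq_rep L (dom theta) fval.
Proof.
move=> [s [Om [A [a [alpha [Omp _ domE thE]]]]]].
have /choice[cs csP] : forall i, exists c : seq ('rV[R]_m * R),
    forall y, Om i y <-> all (fun b => dotp b.1 y <= b.2) c.
  move=> i; have [k [b [beta ->]]] := Omp i.
  exists [seq (b j, beta j) | j <- enum 'I_k] => y; rewrite all_map /=.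
  split=> [bP|/allP bP j]; first by apply/allP => j _ /=.
  by apply: (bP j); rewrite mem_enum.
exists [seq (cs i, (A i, a i, alpha i)) | i <- enum 'I_s]; split=> [y|c y].
  rewrite domE has_map; split=> [[i _ /csP yi]|/hasP[i _ /csP yi]].
    by apply/hasP; exists i; rewrite ?mem_enum.
  by exists i.
by move=> /mapP[i _ ->] /csP /thE; rewrite /fval => ->.
Qed.

Hypothesis theta_convex : convex_efun theta.

Lemma epi_star_convex X : epi theta X -> star_convex (epi theta) X.
Proof.
rewrite /epi /= => /dom_le[DX gX] Y t /dom_le[DY gY] t0 t1.
have t1' : 0 <= 1 - t by rewrite subr_ge0.
have tt : t + (1 - t) = 1 by rewrite addrC subrK.
have [] := convex_on_fval theta_convex DY DX (ltW t0) t1' tt.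
have -> : X + t *: (Y - X) = t *: Y + (1 - t) *: X.
  by rewrite scalerBr scalerBl scale1r addrCA addrA.
move=> Dc gc; apply/dom_le; split.
  suff -> : lsubmx (t *: Y + (1 - t) *: X) = t *: lsubmx Y + (1 - t) *: lsubmx X by [].
  by rewrite linearD !linearZ.
have -> : lsubmx (t *: Y + (1 - t) *: X) = t *: lsubmx Y + (1 - t) *: lsubmx X.
  by rewrite linearD !linearZ.
apply: le_trans gc _; rewrite !mxE -/(rsubmx Y 0 0).
by rewrite lerD // ler_wpM2l // ?(ltW t0) //; move: gY gX; rewrite !mxE.
Qed.

(** The epigraph is star convex at each of its points, so every approximating regular normal
    satisfies a global inequality, and such inequalities pass to the limit. Conversely, the
    subgradient inequality makes (l, -1) a regular normal, and constant sequences suffice. *)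
Lemma subdifferentialP z l : dom theta z ->
  subdifferential theta z l <->
  forall y, dom theta y -> dotp l (y - z) <= fval y - fval z.
Proof.
move=> Dz; split=> [[_ [X_ [V_ [XC VN XX VV]]]] y Dy|H].
  pose X := row_mx z (fine (theta z))%:M; pose V := row_mx l ((-1)%:M : 'rV_1).
  pose Y := row_mx y ((fval y)%:M : 'rV_1).
  have YC : epi theta Y.
    by rewrite /epi /= row_mxKl row_mxKr mxE eqxx mulr1n -fvalE.
  suff : dotp V (Y - X) <= 0.
    rewrite /V /Y /X opp_row_mx add_row_mx -raddfB /= dotp_row_mx dotp_scalar.
    by rewrite -/(fval z); lra.
  rewrite leNgt; apply/negP => a0.
  have Vk k : dotp (V_ k) (Y - X_ k) <= 0.
    exact: (regular_normal_convex (epi_star_convex (XC k)) (VN k)).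
  set a := dotp V (Y - X) in a0.
  pose c : R := (m + 1)%:R; pose r := `|Y - X|; pose s := `|V|.
  (* If <V, Y - X> = a were positive, perturbations of X and V below min(1, a / K) would change it
     by less than a, contradicting [Vk]. *)
  pose K := c * (r + s + 1) + 1.
  have c0 : 0 <= c by rewrite ler0n.
  have r0 : 0 <= r by exact: normr_ge0.
  have s0 : 0 <= s by exact: normr_ge0.
  have K0 : 0 < K by rewrite ltr_wpDl // mulr_ge0 // !addr_ge0.
  have e0 : 0 < Num.min 1 (a / K) by rewrite lt_min ltr01 divr_gt0.
  have [k [Xk Vk']] := filter_ex (filterI (cvg_seq_near XX e0) (cvg_seq_near VV e0)).
  move: Xk Vk'; rewrite !lt_min -/X -/V => /andP[X1 X2] /andP[V1 V2].
  have := Vk k; apply/negP; rewrite -ltNge.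
  have -> : dotp (V_ k) (Y - X_ k) = a - dotp (V_ k - V) (X_ k - X)
      + dotp (V_ k - V) (Y - X) - dotp V (X_ k - X).
    by rewrite /a !(dotpBl, dotpBr); lra.
  have := le_trans (ler_norm _) (dotp_le_norm (V_ k - V) (X_ k - X)).
  have := le_trans (ler_norm _) (dotp_le_norm (V_ k - V) (- (Y - X))).
  have := le_trans (ler_norm _) (dotp_le_norm V (X_ k - X)).
  rewrite normrN dotpNr -/c -/r -/s; move: X1 X2 V1 V2.
  have := normr_ge0 (X_ k - X); have := normr_ge0 (V_ k - V).
  move: `|X_ k - X| `|V_ k - V| => p q q0 p0 X1 X2 V1 V2 B3 B2 B1.
  move: X2 V2; rewrite !ltr_pdivlMr // => X2 V2.
  have M1 : c * q * p <= c * p by rewrite mulrAC ler_piMr ?mulr_ge0 // ltW.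
  have [M [pM qM MK]] : exists M, [/\ p <= M, q <= M & M * K < a].
    exists (Num.max p q); split; rewrite ?le_max ?lexx ?orbT //.
    by rewrite /Num.max; case: ifP.
  have M0 : 0 <= M by apply: le_trans pM.
  have E1 : c * p <= c * M by rewrite ler_wpM2l.
  have E2 : c * q * r <= c * M * r by rewrite ler_wpM2r // ler_wpM2l.
  have E3 : c * s * p <= c * s * M by rewrite ler_wpM2l // mulr_ge0.
  have E4 : M * K = c * M + c * M * r + c * s * M + M by rewrite /K; ring.
  lra.
split; first by rewrite fvalE.
exists (fun=> row_mx z (fine (theta z))%:M), (fun=> row_mx l (-1)%:M).
split=> [k|k||]; [| |exact: cvg_cst|exact: cvg_cst].
  by rewrite /epi /= row_mxKl row_mxKr mxE eqxx mulr1n -fvalE.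
apply: convex_regular_normal => Y; rewrite /epi /= => /dom_le[DY gY].
rewrite [Y in Y - _]row_mx_hsub opp_row_mx add_row_mx -raddfB /= dotp_row_mx.
by rewrite dotp_scalar -/(fval z); have := H _ DY; lra.
Qed.

End ExtendedValued.

(** * Existence of multipliers *)

Lemma subr_telescope (V : zmodType) (a b c p q : V) :
  a - (b + c) = a - b - (p + q) + p + (q - c).
Proof. by rewrite -!addrA (addrA p) addKr opprD. Qed.

Lemma le_small_mul {R : realType} (X Y C e0 : R) : 0 < e0 ->
  (forall e : R, 0 < e -> e < e0 -> X <= Y + e * C) -> X <= Y.
Proof.
move=> e00 H; rewrite -subr_le0 leNgt; apply/negP => a0.
have C1 : 0 < `|C| + 1 by rewrite ltr_wpDl.
have [e [e1 ee0 eC]] : exists e : R, [/\ 0 < e, e < e0 & e * (`|C| + 1) < X - Y].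
  exists (Num.min (e0 / 2) ((X - Y) / (2 * (`|C| + 1)))); split.
  - by rewrite lt_min !divr_gt0 // mulr_gt0.
  - by rewrite gt_min; apply/orP; left; lra.
  - rewrite -ltr_pdivlMr // gt_min; apply/orP; right.
    by rewrite invfM mulrA ltr_pM2r ?invr_gt0 //; lra.
have := H e e1 ee0; have := ler_norm C; nra.
Qed.

Lemma exists_small {R : realType} (t d K : R) : 0 < t -> 0 < d -> 0 <= K ->
  exists s : R, [/\ 0 < s, s <= t & s * K < d].
Proof.
move=> t0 d0 K0; have K1 : 0 < K + 1 by rewrite ltr_wpDl.
exists (Num.min t (d / (K + 1))); split.
- by rewrite lt_min t0 divr_gt0.
- by rewrite ge_min lexx.
- apply: (@le_lt_trans _ _ (d / (K + 1) * K)).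
    by rewrite ler_wpM2r // ge_min lexx orbT.
  by rewrite mulrAC ltr_pdivrMr // ltr_pM2l // ltrDl.
Qed.

Section RegularSlope.
Context {R : realType} {n m : nat}.
Variables (f : 'rV[R]_n -> 'rV[R]_m) (D : set 'rV[R]_m) (g : 'rV[R]_m -> R).
Variables (xi nu w : 'rV[R]_n) (y : 'rV[R]_m) (kappa rho Lp alpha beta tau d : R).

Let e := `|w *m jacobian f xi - y|.
Let slope := (g (f xi + tau *: y) - g (f xi)) / tau.

(* Metric subregularity replaces xi + s w by a feasible point x' at distance  *)
(* O(s e); the value of g at f x' is compared with the chord of g between     *)
(* f xi and f xi + tau y by the Lipschitz property, and s tends to 0.         *)
Lemma regular_slope : convex_on D g -> differentiable f xi ->
  D (f xi) -> D (f xi + tau *: y) -> 0 < tau -> 0 <= kappa -> 0 < d ->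
  (forall x z (eta : R), `|x - xi| < d -> D z -> 0 < eta ->
     exists x', D (f x') /\ `|x' - x| <= kappa * `|f x - z| + eta) ->
  0 <= Lp -> `|f xi| < rho ->
  (forall z z', D z -> D z' -> `|z| <= rho -> `|z'| <= rho ->
     g z' - g z <= Lp * `|z' - z|) ->
  0 <= beta -> g (f xi) <= alpha ->
  (forall eta : R, 0 < eta -> exists2 d' : R, 0 < d' &
     forall x a, D (f x) -> g (f x) <= a -> `|x - xi| < d' -> `|a - alpha| < d' ->
       dotp nu (x - xi) - beta * (a - alpha) <= eta * (`|x - xi| + `|a - alpha|)) ->
  dotp nu w <= n%:R * `|nu| * kappa * e +
    beta * (slope + Lp * ((n%:R * `|jacobian f xi| * kappa + 1) * e)).
Proof.
move=> cg df Dxi Dtau tau0 kappa0 d0 msqc Lp0 frho lip beta0 galpha normal.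
pose J := jacobian f xi; rewrite -/J.
set nJ := n%:R * `|J|; set nnu := n%:R * `|nu|.
have e0 : 0 <= e by exact: normr_ge0.
have nJ0 : 0 <= nJ by rewrite mulr_ge0.
have nnu0 : 0 <= nnu by rewrite mulr_ge0.
have w0 := normr_ge0 w.
pose K1 := kappa * `|w| + 1; pose A := kappa * e + K1.
have K10 : 0 <= K1 by rewrite addr_ge0 // mulr_ge0.
have A0 : 0 <= A by rewrite addr_ge0 // mulr_ge0.
pose r0 := (nJ * kappa + 1) * e; pose K2 := nJ * K1 + `|w| + A.
have r00 : 0 <= r0 by rewrite mulr_ge0 // addr_ge0 // mulr_ge0.
have K20 : 0 <= K2 by rewrite !addr_ge0 // mulr_ge0.
pose B := r0 + K2; have B0 : 0 <= B by rewrite addr_ge0.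
(* Divided by s, all displacements below, in x, in f(x) and in height, are at most S + |y| + B; one
   small s therefore serves every neighbourhood. *)
pose S := `|w| + A + `|slope| + Lp * B.
have LpB : 0 <= Lp * B by rewrite mulr_ge0.
have S0 : 0 <= S by rewrite /S addr_ge0 // addr_ge0 // addr_ge0.
apply: (@le_small_mul _ _ _ (nnu * K1 + beta * (Lp * K2) + S) 1 ltr01).
move=> eta eta0 eta1.
have [d1 d10 nd1] := normal eta eta0.
have /near_normP[d2 d20 fd2] := diff_eps df eta0.
pose dd := Num.min (Num.min d d1) (Num.min d2 (rho - `|f xi|)).
have dd0 : 0 < dd by rewrite !lt_min d0 d10 d20 subr_gt0.
have KS : 0 <= S + `|y| + B by rewrite addr_ge0 // addr_ge0.
have [s [s0 stau sK]] := exists_small tau0 dd0 KS.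
have small (c : R) : c <= S + `|y| + B -> s * c < dd.
  by move=> cS; apply: le_lt_trans sK; rewrite ler_wpM2l // ltW.
have [ddd dd1 dd2 ddr] : [/\ dd <= d, dd <= d1, dd <= d2 & dd <= rho - `|f xi|].
  by rewrite /dd !ge_min !lexx !orbT.
have sw : `|s *: w| < dd.
  by rewrite normrZ gtr0_norm //; apply: small; rewrite /S; have := normr_ge0 slope; have := normr_ge0 y; lra.
have Dsy : D (f xi + s *: y) /\ g (f xi + s *: y) <= g (f xi) + s * slope.
  have st0 : 0 <= s / tau by rewrite divr_ge0 ?ltW.
  have st1 : 0 <= 1 - s / tau by rewrite subr_ge0 ler_pdivrMr // mul1r.
  have [|] := cg _ _ (s / tau) (1 - s / tau) Dtau Dxi st0 st1; first by lra.
  have -> : (s / tau) *: (f xi + tau *: y) + (1 - s / tau) *: f xi = f xi + s *: y.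
    rewrite scalerDr scalerA divfK ?gt_eqF // scalerBl scale1r.
    by rewrite addrAC [_ + (f xi - _)]addrC subrK.
  move=> Dsy gsy; split=> //; apply: le_trans gsy _.
  rewrite /slope mulrA; have -> : s * (g (f xi + tau *: y) - g (f xi)) / tau =
    s / tau * (g (f xi + tau *: y) - g (f xi)) by ring.
  lra.
have f1 : `|f (xi + s *: w) - f xi - s *: (w *m J)| <= eta * (s * `|w|).
  have := fd2 (s *: w); rewrite subr0 normrZ gtr0_norm // -jacobianE -scalemxAl.
  by apply; move: sw; rewrite normrZ gtr0_norm // => /lt_le_trans; exact.
have f2 : `|f (xi + s *: w) - (f xi + s *: y)| <= s * (e + eta * `|w|).
  have -> : f (xi + s *: w) - (f xi + s *: y) =
     (f (xi + s *: w) - f xi - s *: (w *m J)) + s *: (w *m J - y).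
    by rewrite scalerBr addrA subrK opprD addrA.
  apply: le_trans (ler_normD _ _) _; rewrite normrZ gtr0_norm // -/e; lra.
have [|x' [Dx' x'w]] := msqc (xi + s *: w) (f xi + s *: y) (eta * s) _ Dsy.1 (mulr_gt0 eta0 s0).
  by rewrite addrAC subrr add0r; exact: lt_le_trans ddd.
pose a := kappa * e + eta * K1.
have aA : a <= A by rewrite /a /A lerD2l ler_piMl // ltW.
have a0 : 0 <= a by rewrite addr_ge0 // mulr_ge0 // ltW.
have x'a : `|x' - (xi + s *: w)| <= s * a.
  apply: le_trans x'w _; have := ler_wpM2l kappa0 f2.
  by rewrite /a /K1; lra.
have x'xi : `|x' - xi| <= s * (`|w| + a).
  have -> : x' - xi = (x' - (xi + s *: w)) + s *: w by rewrite opprD addrA subrK.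
  apply: le_trans (ler_normD _ _) _; rewrite normrZ gtr0_norm //; lra.
have x'dd : `|x' - xi| < dd.
  apply: le_lt_trans x'xi _; apply: small; rewrite /S.
  by have := normr_ge0 slope; have := normr_ge0 y; lra.
pose r := eta * (`|w| + a) + nJ * a + e.
have r_ge0 : 0 <= r.
  have ew : 0 <= eta * (`|w| + a) by rewrite mulr_ge0 ?(ltW eta0) // addr_ge0.
  have nJa : 0 <= nJ * a by rewrite mulr_ge0.
  by rewrite /r; lra.
have rB : r <= r0 + eta * K2.
  have : eta * a <= eta * A by rewrite ler_wpM2l // ltW.
  by rewrite /r /r0 /K2 /a; lra.
have rB' : r <= B.
  apply: le_trans rB _; rewrite /B lerD2l ler_piMl // ltW //.
have fx' : `|f x' - (f xi + s *: y)| <= s * r.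
  have := fd2 (x' - xi); rewrite subr0 [xi + _]addrC subrK => /(_ (lt_le_trans x'dd dd2)).
  rewrite -jacobianE -/J => H1.
  have -> : f x' - (f xi + s *: y) = (f x' - f xi - (x' - xi) *m J)
      + (x' - (xi + s *: w)) *m J + s *: (w *m J - y).
    have {1}-> : x' - xi = (x' - (xi + s *: w)) + s *: w by rewrite opprD addrA subrK.
    rewrite mulmxDl -scalemxAl scalerBr; exact: subr_telescope.
  apply: le_trans (ler_normD _ _) _; rewrite normrZ gtr0_norm // -/e.
  have H2 := norm_mulmx (x' - (xi + s *: w)) J.
  have H2' : `|(x' - (xi + s *: w)) *m J| <= nJ * (s * a).
    apply: le_trans H2 _; rewrite mulrAC -/nJ.
    by rewrite ler_wpM2l.
  have H1' : `|f x' - f xi - (x' - xi) *m J| <= eta * (s * (`|w| + a)).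
    by apply: le_trans H1 _; rewrite ler_wpM2l // ltW.
  have := ler_normD (f x' - f xi - (x' - xi) *m J) ((x' - (xi + s *: w)) *m J).
  by rewrite /r; lra.
have n1 : `|f xi + s *: y| <= rho.
  apply: le_trans (ler_normD _ _) _; rewrite normrZ gtr0_norm //.
  have : s * `|y| < dd by apply: small; lra.
  by lra.
have n2 : `|f x'| <= rho.
  have -> : f x' = f xi + s *: y + (f x' - (f xi + s *: y)) by rewrite addrC subrK.
  apply: le_trans (ler_normD _ _) _.
  apply: le_trans (lerD (ler_normD _ _) fx') _; rewrite normrZ gtr0_norm //.
  have : s * (`|y| + r) < dd by apply: small; lra.
  by lra.
(* The chord contributes s * slope and the Lipschitz estimate Lp * s * r, so alpha + De is an
   admissible height over x'; the normal inequality is tested at (x', alpha + De). *)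
pose De := s * (slope + Lp * r).
have gx' : g (f x') <= alpha + De.
  have := lip _ _ Dsy.1 Dx' n1 n2; have := ler_wpM2l Lp0 fx'.
  by have := Dsy.2; rewrite /De; lra.
have De_le : `|De| <= s * (`|slope| + Lp * r).
  rewrite normrM gtr0_norm // ler_wpM2l ?(ltW s0) //.
  apply: le_trans (ler_normD _ _) _; rewrite lerD2l ger0_norm // mulr_ge0 //.
have LrB : Lp * r <= Lp * B by rewrite ler_wpM2l.
have Dedd : `|alpha + De - alpha| < d1.
  rewrite addrAC subrr add0r; apply: lt_le_trans dd1; apply: le_lt_trans De_le _.
  by apply: small; rewrite /S; have := normr_ge0 y; lra.
have := nd1 x' (alpha + De) Dx' gx' (lt_le_trans x'dd dd1) Dedd.
rewrite [alpha + De - alpha]addrAC subrr add0r => N1.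
have N2 : eta * (`|x' - xi| + `|De|) <= eta * (s * S).
  rewrite ler_wpM2l ?(ltW eta0) //; apply: le_trans (lerD x'xi De_le) _.
  by rewrite -mulrDr ler_wpM2l ?(ltW s0) // /S; lra.
have N3 : s * dotp nu w - nnu * (s * a) <= dotp nu (x' - xi).
  have -> : x' - xi = (x' - (xi + s *: w)) + s *: w by rewrite opprD addrA subrK.
  rewrite dotpDr dotpZr.
  have := dotp_le_norm nu (x' - (xi + s *: w)); rewrite ler_norml -/nnu => /andP[H _].
  have := ler_wpM2l nnu0 x'a; lra.
have N4 : beta * De <= s * (beta * (slope + Lp * (r0 + eta * K2))).
  rewrite /De mulrCA ler_wpM2l ?(ltW s0) // ler_wpM2l // lerD2l ler_wpM2l //.
have : s * dotp nu w <= s * (nnu * a + beta * (slope + Lp * (r0 + eta * K2)) + eta * S).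
  lra.
rewrite ler_pM2l // => /le_trans; apply.
by rewrite /a -/r0 /nnu; lra.
Qed.

End RegularSlope.

Lemma slope_combine {R : realType} (b s s0 e a : R) :
  (b - 1) * s <= e * (a + 2) -> s - s0 <= 2 * e -> b * s <= s0 + e * (2 + a + 2).
Proof. lra. Qed.

Lemma slope_final {R : realType} (vw nw e E F k s0 a G X Y Z W : R) :
  vw <= nw + e * E -> X <= F * (E * e) -> Y <= s0 + e * (2 + a + 2) ->
  Z <= 2 * (k * (G * (E * e))) -> nw <= X + (Y + Z) ->
  vw <= s0 + e * (E + F * E + (2 + a + 2) + 2 * k * G * E).
Proof. lra. Qed.

Section LocalAnalysis.
Context {R : realType} {n m : nat}.
Variables (f : 'rV[R]_n -> 'rV[R]_m) (x0 : 'rV[R]_n).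
Variables (D T : set 'rV[R]_m) (g p q : 'rV[R]_m -> R).
Variables (L L' L'' : seq (@piece R m)) (kappa d0 : R).

Let J := jacobian f x0.
Let z0 := f x0.

Hypothesis f2 : twice_differentiable_map f x0.
Hypothesis (Lg : plq_rep L D g) (cg : convex_on D g) (Dz0 : D z0).
Hypothesis (Lp : plq_rep L' T p) (cL' : conic_pieces L') (cp : convex_on T p).
Hypothesis (Lq : plq_rep L'' T q)
  (qZ : forall h (t : R), 0 < t -> q (t *: h) = t ^+ 2 * q h).
Hypothesis near_z0 : \forall h \near (0 : 'rV[R]_m), (D (z0 + h) <-> T h) /\
  (T h -> g (z0 + h) = g z0 + p h + 2^-1 * q h).
Hypothesis (kappa0 : 0 <= kappa) (d00 : 0 < d0).
Hypothesis msqc : forall x z (eta : R), `|x - x0| < d0 -> D z -> 0 < eta ->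
  exists x', D (f x') /\ `|x' - x| <= kappa * `|f x - z| + eta.

Implicit Types (u v w x : 'rV[R]_n) (h l y z : 'rV[R]_m) (t e : R).

Lemma T0 : T 0.
Proof.
by have /nbhs_singleton[] := near_z0; rewrite addr0 => -[/(_ Dz0)].
Qed.

(* The regular normals (nu, - beta) to the epigraph of g o f at points        *)
(* (xi, alpha), which define a limiting subgradient v at x0.                  *)
Definition approx_normal v := forall e, 0 < e -> exists xi nu (alpha beta : R),
  [/\ `|xi - x0| < e, `|nu - v| < e, `|beta - 1| < e,
      D (f xi) /\ g (f xi) <= alpha &
      forall eta : R, 0 < eta -> exists2 d' : R, 0 < d' &
        forall x a, D (f x) -> g (f x) <= a -> `|x - xi| < d' ->
          `|a - alpha| < d' -> dotp nu (x - xi) - beta * (a - alpha)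
            <= eta * (`|x - xi| + `|a - alpha|)].

Lemma jacobian_cont e : 0 < e ->
  \forall x \near x0, `|jacobian f x - J| <= e.
Proof.
move=> e0; have [k k0 dk] := linear_lipschitz (@diff_continuous _ _ _ _ _ f2.2).
have /near_normP[d1 d10 H1] := diff_eps f2.2 (@ltr01 R).
have k1 : 0 < k + 1 by rewrite addr_gt0.
apply/near_normP; exists (Num.min d1 (e / (k + 1))).
  by rewrite lt_min d10 divr_gt0.
move=> x; rewrite lt_min ltr_pdivlMr // => /andP[xd1 xe].
have := H1 (x - x0); rewrite subr0 [x0 + _]addrC subrK => /(_ xd1) H2.
have := ler_normD (jacobian f x - J - 'd (jacobian f) x0 (x - x0))
  ('d (jacobian f) x0 (x - x0)).
by rewrite subrK; have := dk (x - x0); lra.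
Qed.

Lemma f_cont e : 0 < e -> \forall x \near x0, `|f x - z0| <= e.
Proof.
move=> e0; have df := nbhs_singleton f2.1.
have /near_normP[d1 d10 H1] := diff_eps df (@ltr01 R).
have k0 : 0 <= n%:R * `|J| by rewrite mulr_ge0.
have k1 : 0 < n%:R * `|J| + 1 by rewrite ltr_wpDl.
apply/near_normP; exists (Num.min d1 (e / (n%:R * `|J| + 1))).
  by rewrite lt_min d10 divr_gt0.
move=> x; rewrite lt_min ltr_pdivlMr // => /andP[xd1 xe].
have := H1 (x - x0); rewrite subr0 [x0 + _]addrC subrK => /(_ xd1).
rewrite -jacobianE -/J -/z0 => H2.
have := ler_normD (f x - z0 - (x - x0) *m J) ((x - x0) *m J).
by rewrite subrK; have := norm_mulmx (x - x0) J; lra.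
Qed.

(** At the points xi the derivative of f maps w to y = wJ up to a defect that vanishes as xi tends
    to x0, and t y is a feasible step from all points of D near z0 because T is closed under
    addition. The limit of [regular_slope] gives <v, w> <= (g(z0 + t y) - g(z0)) / t for small t,
    and then t tends to 0. *)
Lemma approx_normal_slope v w : approx_normal v -> T (w *m J) ->
  dotp v w <= p (w *m J).
Proof.
move=> nv Ty; set y := w *m J in Ty *.
have /near_normP[d d_gt0 locd] := near_z0.
have locz h : `|h| < d -> (D (z0 + h) <-> T h) /\
    (T h -> g (z0 + h) = g z0 + p h + 2^-1 * q h).
  by move=> hd; apply: locd; rewrite subr0.
suff claim t : 0 < t -> t * `|y| < d / 2 ->
    t * dotp v w <= g (z0 + t *: y) - g z0.
  rewrite -subr_le0; apply: (@near0_linear_le _ _ (2^-1 * q y)).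
  have y1 : 0 < `|y| + 1 by rewrite ltr_wpDl.
  have : \forall t \near (0 : R)^'+, 0 < t /\ t < (d / 2) / (`|y| + 1).
    near=> t; split; first by near: t; exact: nbhs_right_gt.
    by near: t; apply: nbhs_right_lt; rewrite !divr_gt0.
  apply: filterS => t [t0]; rewrite ltr_pdivlMr // => td.
  have tyd : t * `|y| < d / 2 by nra.
  have Tty : T (t *: y) by exact: (conic_dom _ Lp cL' t0).2.
  have [_ /(_ Tty) gE] : (D (z0 + t *: y) <-> T (t *: y)) /\
    (T (t *: y) -> g (z0 + t *: y) = g z0 + p (t *: y) + 2^-1 * q (t *: y)).
    by apply: locz; rewrite normrZ gtr0_norm //; lra.
  have := claim t t0 tyd; rewrite gE qZ // (conic_homog Lp) //; lra.
move=> t0 tyd.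
have DzT h : `|h| < d / 2 -> D (z0 + h) -> D (z0 + h + t *: y).
  move=> hd Dh; have hd' : `|h| < d by lra.
  have hyd : `|h + t *: y| < d.
    by apply: le_lt_trans (ler_normD _ _) _; rewrite normrZ gtr0_norm //; lra.
  have Th := (locz h hd').1.1 Dh; rewrite -addrA; apply: (locz _ hyd).1.2.
  by have [] := conic_sublinear Lp cL' cp Th ((conic_dom y Lp cL' t0).2 Ty).
have [Lip Lip0 LipP] := plq_lipschitz (`|z0| + 1) Lg cg.
set slope0 := (g (z0 + t *: y) - g z0) / t.
have slope0E : t * slope0 = g (z0 + t *: y) - g z0 by rewrite mulrC divfK // gt_eqF.
rewrite -slope0E ler_pM2l //.
pose E1 := n%:R * `|w|; pose M := n%:R * (`|J| + 1) * kappa + 1.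
pose C := E1 + n%:R * (`|v| + 1) * kappa * E1 + (2 + `|slope0| + 2)
  + 2 * Lip * M * E1.
have E10 : 0 <= E1 by rewrite mulr_ge0.
have M0 : 0 <= M by rewrite addr_ge0 // !mulr_ge0 // addr_ge0.
apply: (@le_small_mul _ _ _ C 1 ltr01) => e e0 e1.
have et0 : 0 < e * t by rewrite mulr_gt0.
have d2 : 0 < Num.min (d / 4) (2^-1) by rewrite lt_min invr_gt0 ltr0n divr_gt0.
have /near_normP[a1 a10 A1] := f2.1.
have /near_normP[a2 a20 A2] := jacobian_cont e0.
have /near_normP[b3 b30 B3] := plq_cont z0 Lg et0.
have /near_normP[b4 b40 B4] := plq_cont (z0 + t *: y) Lg et0.
have b0 : 0 < Num.min (Num.min (d / 4) (2^-1)) (Num.min (b3 / 2) (b4 / 2)).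
  by rewrite !lt_min invr_gt0 ltr0n !divr_gt0.
have /near_normP[a3 a30 A3] := f_cont b0.
pose r := Num.min (Num.min e (d0 / 2)) (Num.min a1 (Num.min a2 a3)).
have r0 : 0 < r by rewrite !lt_min e0 divr_gt0 // a10 a20 a30.
have [xi [nu [alpha [beta [xiP nuP betaP [Dxi galpha] normal]]]]] := nv r r0.
move: xiP; rewrite !lt_min -!andbA => /and5P[xie xid xi1 xi2 xi3].
have nue : `|nu - v| < e by apply: lt_le_trans nuP _; rewrite /r !ge_min lexx.
have betae : `|beta - 1| < e by apply: lt_le_trans betaP _; rewrite /r !ge_min lexx.
have dfxi := A1 _ xi1; have Jxi := A2 _ xi2.
have := A3 _ xi3; rewrite !le_min -!andbA => /and4P[F1 F2 F3 F4].
have fxiE : f xi = z0 + (f xi - z0) by rewrite addrC subrK.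
have Dxit : D (f xi + t *: y).
  by rewrite fxiE; apply: DzT; rewrite -?fxiE //; lra.
have g1 := B3 (f xi); rewrite -/z0 in g1.
have {}g1 : `|g (f xi) - g z0| <= e * t by apply: g1 => //; lra.
have g2 : `|g (f xi + t *: y) - g (z0 + t *: y)| <= e * t.
  by apply: B4 => //; rewrite opprD addrACA subrr addr0; lra.
have fxirho : `|f xi| < `|z0| + 1.
  by rewrite fxiE; apply: le_lt_trans (ler_normD _ _) _; lra.
have := betae; rewrite ltr_norml => /andP[be1 be2].
have beta0 : 0 <= beta by lra.
have d20 : 0 < d0 / 2 by rewrite divr_gt0.
have msqc' x z eta : `|x - xi| < d0 / 2 -> D z -> 0 < eta ->
    exists x', D (f x') /\ `|x' - x| <= kappa * `|f x - z| + eta.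
  move=> xxi; apply: msqc; rewrite -[x](subrK xi) -addrA.
  by apply: le_lt_trans (ler_normD _ _) _; lra.
have := @regular_slope _ _ _ f D g xi nu w y kappa (`|z0| + 1) Lip alpha beta t
  (d0 / 2) cg dfxi Dxi Dxit t0 kappa0 d20 msqc' Lip0 fxirho LipP beta0 galpha normal.
set ee := `|w *m jacobian f xi - y|; set slope := (_ / t).
have ee0 : 0 <= ee by exact: normr_ge0.
have eeE : ee <= E1 * e.
  rewrite /ee /y -mulmxBr; apply: le_trans (norm_mulmx _ _) _.
  by rewrite /E1 ler_wpM2l // mulr_ge0.
have sl : `|slope - slope0| <= 2 * e.
  have -> : slope - slope0 = ((g (f xi + t *: y) - g (z0 + t *: y)) -
     (g (f xi) - g z0)) / t by rewrite /slope /slope0; ring.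
  rewrite normrM normfV (gtr0_norm t0) ler_pdivrMr //.
  by apply: le_trans (ler_normB _ _) _; lra.
have := sl; rewrite ler_norml => /andP[_ sl2].
have nuv : `|nu| <= `|v| + 1.
  by rewrite -[nu](subrK v); apply: le_trans (ler_normD _ _) _; lra.
have Jn : `|jacobian f xi| <= `|J| + 1.
  by rewrite -[jacobian f xi](subrK J); apply: le_trans (ler_normD _ _) _; lra.
have I1 : dotp v w <= dotp nu w + e * E1.
  have H : n%:R * `|nu - v| * `|w| <= e * E1.
    by rewrite /E1 mulrAC mulrC ler_wpM2r // ltW.
  rewrite -lerBlDl -dotpBl; apply: le_trans H; rewrite distrC.
  exact: le_trans (ler_norm _) (dotp_le_norm (v - nu) w).
have I2 : n%:R * `|nu| * kappa * ee <= n%:R * (`|v| + 1) * kappa * (E1 * e).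
  apply: ler_pM => //; first by rewrite !mulr_ge0.
  by rewrite ler_wpM2r // ler_wpM2l.
have I3 : Lip * ((n%:R * `|jacobian f xi| * kappa + 1) * ee) <= Lip * (M * (E1 * e)).
  rewrite ler_wpM2l //; apply: ler_pM => //; first by rewrite addr_ge0 // !mulr_ge0.
  by rewrite lerD2r ler_wpM2r // ler_wpM2l.
have I30 : 0 <= Lip * (M * (E1 * e)) by rewrite !mulr_ge0 // ltW.
have I4 : beta * slope <= slope0 + e * (2 + `|slope0| + 2).
  have slope_abs : `|slope| <= `|slope0| + 2.
    rewrite -[slope](subrK slope0); apply: le_trans (ler_normD _ _) _.
    by rewrite addrC lerD2l; apply: le_trans sl _; rewrite ler_piMr // ltW.
  have b1 : (beta - 1) * slope <= e * (`|slope0| + 2).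
    apply: le_trans (ler_norm _) _; rewrite normrM; apply: ler_pM => //.
    exact: ltW.
  exact: slope_combine b1 sl2.
have I5 : beta * (Lip * ((n%:R * `|jacobian f xi| * kappa + 1) * ee)) <=
    2 * (Lip * (M * (E1 * e))).
  apply: ler_pM => //; last by rewrite -lerBlDr (le_trans (ltW be2)) // ltW.
  by rewrite mulr_ge0 // mulr_ge0 // addr_ge0 // !mulr_ge0.
by rewrite mulrDr => I6; exact: slope_final I1 I2 I4 I5 I6.
Unshelve. all: by end_near. Qed.

(** [lp_duality] with b = 0 and c = 0: the linear program has lower bound 0 by
    [approx_normal_slope]. *)
Lemma multiplier_exists v : approx_normal v ->
  exists l, (forall y, T y -> dotp l y <= p y) /\ l *m J^T = v.
Proof.
move=> nv; have T00 : T (0 *m J + 0) by rewrite mul0mx addr0; exact: T0.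
have [|l [lp lJ _]] := @lp_duality _ _ _ _ _ _ J v 0 0 0 Lp cL' cp T00.
  by move=> u; rewrite addr0 => /(approx_normal_slope nv); rewrite subr_ge0.
by exists l.
Qed.

End LocalAnalysis.

(** * Second-order estimates along feasible curves *)

Lemma subr_insert (V : zmodType) (a b c d : V) :
  a - c = (a - b - d) + (b - c) + d.
Proof. by rewrite [RHS]addrAC subrK addrA subrK. Qed.

Lemma subr_insert2 (V : zmodType) (a b c d : V) :
  a - (b + d) = a - (c + d) + (c - b).
Proof. by rewrite !opprD !addrA [_ - c - d + c]addrAC subrK addrAC. Qed.

(** The quadratic part may be frozen at w since Q is continuous there, but the first-order part must
    stay at u: replacing it would cost t |u - w|, not o(t^2). *)
Lemma second_expansion {R : realType} n (W : normedModType R)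
    (F A Q : 'rV[R]_n -> W) (x w : 'rV[R]_n) (e : R) :
  (forall e, 0 < e -> \forall h \near (0 : 'rV[R]_n),
     `|F (x + h) - F x - A h - Q h| <= e * `|h| ^+ 2) ->
  (forall t h, A (t *: h) = t *: A h) ->
  (forall t h, Q (t *: h) = t ^+ 2 *: Q h) ->
  (forall e, 0 < e -> \forall u \near w, `|Q u - Q w| <= e) -> 0 < e ->
  exists2 d : R, 0 < d & forall t u, 0 < t -> t < d -> `|u - w| < d ->
    `|F (x + t *: u) - F x - t *: A u - t ^+ 2 *: Q w| <= e * t ^+ 2.
Proof.
move=> FT AZ QZ Qc e0; pose N := `|w| + 1.
have N0 : 0 < N by rewrite ltr_wpDl.
have e1 : 0 < e / 2 / N ^+ 2 by rewrite !divr_gt0 // exprn_gt0.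
have e2 : 0 < e / 2 by rewrite divr_gt0.
have /near_normP[d1 d10 H1] := FT _ e1.
have /near_normP[d2 d20 H2] := Qc _ e2.
exists (Num.min (Num.min 1 d2) (d1 / N)).
  by rewrite !lt_min ltr01 d20 divr_gt0.
move=> t u t0; rewrite !lt_min ltr_pdivlMr // -!andbA => /and3P[t1 _ tN].
move=> /and3P[u1 u2 _].
have uN : `|u| <= N.
  by rewrite -[u](subrK w) addrC; apply: le_trans (ler_normD _ _) _; rewrite lerD2l ltW.
have tu : `|t *: u| <= t * N by rewrite normrZ gtr0_norm // ler_wpM2l // ltW.
have := H1 (t *: u); rewrite subr0 AZ QZ => /(_ (le_lt_trans tu tN)) K1.
have K2 := H2 _ u2.
have -> : F (x + t *: u) - F x - t *: A u - t ^+ 2 *: Q w =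
    (F (x + t *: u) - F x - t *: A u - t ^+ 2 *: Q u) + t ^+ 2 *: (Q u - Q w).
  by rewrite scalerBr addrA subrK.
apply: le_trans (ler_normD _ _) _; rewrite normrZ ger0_norm ?sqr_ge0 //.
have K3 : `|t *: u| ^+ 2 <= (t * N) ^+ 2 by rewrite lerXn2r // ?nnegrE // mulr_ge0 // ltW.
have K4 : e / 2 / N ^+ 2 * (t * N) ^+ 2 = e / 2 * t ^+ 2.
  by rewrite exprMn; field; rewrite gt_eqF.
have K5 := ler_wpM2l (ltW e1) K3; rewrite K4 in K5.
have K6 := ler_wpM2l (sqr_ge0 t) K2.
have -> : e * t ^+ 2 = e / 2 * t ^+ 2 + t ^+ 2 * (e / 2) by field.
by rewrite lerD // (le_trans K1).
Qed.

Lemma bilinear_square_cont {R : realType} n (W : normedModType R)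
    (b : 'rV[R]_n -> 'rV[R]_n -> W) (K : R) (w : 'rV[R]_n) (e : R) :
  (forall u v x, b (u - v) x = b u x - b v x) ->
  (forall u v x, b x (u - v) = b x u - b x v) ->
  (forall u v, `|b u v| <= K * `|u| * `|v|) -> 0 < e ->
  \forall u \near w, `|b u u - b w w| <= e.
Proof.
move=> bl br bK e0; pose N := `|w| + 1; pose K' := `|K| * (N + N) + 1.
have N0 : 0 < N by rewrite ltr_wpDl.
have K'0 : 0 < K' by rewrite ltr_wpDl // mulr_ge0 // addr_ge0 // ltW.
apply/near_normP; exists (Num.min 1 (e / K')); first by rewrite lt_min ltr01 divr_gt0.
move=> u; rewrite lt_min ltr_pdivlMr // => /andP[u1 ue].
have uN : `|u| <= N.
  by rewrite -[u](subrK w) addrC; apply: le_trans (ler_normD _ _) _; rewrite lerD2l ltW.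
have wN : `|w| <= N by rewrite lerDl.
have -> : b u u - b w w = b (u - w) u + b w (u - w) by rewrite bl br addrA subrK.
have K1 : `|b (u - w) u| <= `|K| * `|u - w| * N.
  apply: le_trans (bK _ _) _.
  apply: (@le_trans _ _ (`|K| * `|u - w| * `|u|)).
    by rewrite ler_wpM2r // ler_wpM2r // ler_norm.
  by rewrite ler_wpM2l // mulr_ge0.
have K2 : `|b w (u - w)| <= `|K| * N * `|u - w|.
  apply: le_trans (bK _ _) _; rewrite ler_wpM2r //.
  apply: (@le_trans _ _ (`|K| * `|w|)); first by rewrite ler_wpM2r // ler_norm.
  by rewrite ler_wpM2l.
apply: le_trans (ler_normD _ _) _; apply: le_trans (lerD K1 K2) _.
apply: le_trans (ltW ue).
have -> : `|K| * `|u - w| * N + `|K| * N * `|u - w| = `|u - w| * (`|K| * (N + N)).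
  by ring.
by rewrite ler_wpM2l // lerDl.
Qed.

(** T, p and q are homogeneous, so one threshold serves all small t and all directions y' close to
    y. *)
Lemma near_cone {R : realType} {m : nat} (D T : set 'rV[R]_m)
    (g p q : 'rV[R]_m -> R) (L : seq (@piece R m)) (z y : 'rV[R]_m) :
  plq_rep L T p -> conic_pieces L ->
  (forall h (t : R), 0 < t -> q (t *: h) = t ^+ 2 * q h) ->
  (\forall h \near (0 : 'rV[R]_m), (D (z + h) <-> T h) /\
    (T h -> g (z + h) = g z + p h + 2^-1 * q h)) ->
  exists2 d : R, 0 < d & forall (t : R) y',
  0 < t -> t < d -> `|y' - y| < d ->
  (D (z + t *: y') <-> T y') /\
  (T y' -> g (z + t *: y') = g z + t * p y' + 2^-1 * (t ^+ 2 * q y')).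
Proof.
move=> Lp cL' qZ near_z; have /near_normP[d d_gt0 H] := near_z.
have y1 : 0 < `|y| + 1 by rewrite ltr_wpDl.
exists (Num.min 1 (d / (`|y| + 1))); first by rewrite lt_min ltr01 divr_gt0.
move=> t y' t0; rewrite !lt_min ltr_pdivlMr // => /andP[t1 td] /andP[y'1 _].
have [|Dt gt] := H (t *: y').
  rewrite subr0 normrZ gtr0_norm //; apply: le_lt_trans td.
  rewrite ler_wpM2l ?(ltW t0) // -[y'](subrK y) addrC.
  by apply: le_trans (ler_normD _ _) _; rewrite lerD2l ltW.
have TZ := conic_dom y' Lp cL' t0.
split; first exact: iff_trans Dt TZ.
by move=> Ty; rewrite gt; [rewrite qZ // (conic_homog Lp cL' t0 Ty)|exact/TZ].
Qed.

Section SecondOrder.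
Context {R : realType} {n m : nat}.
Variables (f : 'rV[R]_n -> 'rV[R]_m) (x0 : 'rV[R]_n) (J : 'M[R]_(n, m)).
Variables (B : 'rV[R]_n -> 'rV[R]_m).
Variables (D T : set 'rV[R]_m) (g p q : 'rV[R]_m -> R).
Variables (L' L'' : seq (@piece R m)) (kappa d0 : R).

Let z0 := f x0.

Hypothesis f_exp : forall w (e : R), 0 < e ->
  exists2 d : R, 0 < d & forall t u, 0 < t -> t < d -> `|u - w| < d ->
    `|f (x0 + t *: u) - z0 - t *: (u *m J) - t ^+ 2 *: B w| <= e * t ^+ 2.
Hypothesis (Lp : plq_rep L' T p) (cL' : conic_pieces L') (cp : convex_on T p).
Hypothesis (Lq : plq_rep L'' T q)
  (qZ : forall h (t : R), 0 < t -> q (t *: h) = t ^+ 2 * q h).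
Hypothesis near_z0 : \forall h \near (0 : 'rV[R]_m), (D (z0 + h) <-> T h) /\
  (T h -> g (z0 + h) = g z0 + p h + 2^-1 * q h).
Hypothesis (kappa0 : 0 <= kappa) (d00 : 0 < d0).
Hypothesis msqc : forall x z (eta : R), `|x - x0| < d0 -> D z -> 0 < eta ->
  exists x', D (f x') /\ `|x' - x| <= kappa * `|f x - z| + eta.

Implicit Types (u v w x : 'rV[R]_n) (h l y z : 'rV[R]_m) (t e : R).

(** Here y is the difference quotient of f. Feasibility and values of g are read off the cone at y,
    and y is known to precision e t, as the second-order terms require. *)
Lemma local_dir w e : 0 < e -> exists2 d : R, 0 < d & forall t u,
  0 < t -> t < d -> `|u - w| < d -> exists y,
  [/\ D (f (x0 + t *: u)) <-> T y,
      T y -> g (f (x0 + t *: u)) = g z0 + t * p y + 2^-1 * (t ^+ 2 * q y),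
      `|y - w *m J| <= e & `|y - u *m J - t *: B w| <= e * t].
Proof.
move=> e0; have [d1 d10 H1] := near_cone (w *m J) Lp cL' qZ near_z0.
pose e1 := Num.min e (d1 / 2).
have e10 : 0 < e1 / 2 by rewrite divr_gt0 // lt_min e0 divr_gt0.
have [d2 d20 H2] := f_exp w e10.
pose K := n%:R * `|J| + `|B w| + 1.
have K0 : 0 < K by rewrite ltr_wpDl // addr_ge0 // mulr_ge0.
exists (Num.min (Num.min d1 d2) (Num.min 1 (e1 / 2 / K))).
  by rewrite !lt_min d10 d20 ltr01 divr_gt0.
move=> t u t0; rewrite !lt_min -!andbA => /and4P[td1 td2 t1 tK] /and4P[ud1 ud2 u1 uK].
have := H2 t u t0 td2 ud2.
have [y yE] : exists y, f (x0 + t *: u) = z0 + t *: y.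
  by exists (t^-1 *: (f (x0 + t *: u) - z0)); rewrite scalerA mulfV ?gt_eqF // scale1r [z0 + _]addrC subrK.
have -> : f (x0 + t *: u) - z0 - t *: (u *m J) - t ^+ 2 *: B w =
    t *: (y - u *m J - t *: B w).
  by rewrite yE [z0 + _]addrC addrK !scalerBr scalerA -expr2.
rewrite normrZ gtr0_norm // expr2 mulrCA ler_pM2l // => Y1.
have e1e : e1 <= e by rewrite ge_min lexx.
have e1d : e1 <= d1 / 2 by rewrite ge_min lexx orbT.
have Y2 : `|y - u *m J - t *: B w| <= e * t.
  by apply: le_trans Y1 _; rewrite ler_wpM2r ?(ltW t0) //; lra.
have Y3 : `|y - w *m J| <= e1.
  have -> : y - w *m J = (y - u *m J - t *: B w) + (u - w) *m J + t *: B w.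
    by rewrite mulmxBl; exact: subr_insert.
  apply: le_trans (ler_normD _ _) _; rewrite normrZ gtr0_norm //.
  apply: le_trans (lerD (ler_normD _ _) (lexx _)) _.
  have Z1 := norm_mulmx (u - w) J.
  have Z2 : `|u - w| * (n%:R * `|J|) <= e1 / 2 / K * (n%:R * `|J|).
    by rewrite ler_wpM2r ?mulr_ge0 // ltW.
  have Z3 : t * `|B w| <= e1 / 2 / K * `|B w| by rewrite ler_wpM2r // ltW.
  have Z4 : t * (e1 / 2) <= e1 / 2 by rewrite ler_piMl ?ltW.
  have Z5 : e1 / 2 / K * (n%:R * `|J| + `|B w|) <= e1 / 2.
    rewrite mulrAC ler_pdivrMr // ler_wpM2l ?(ltW e10) // lerDl //.
  lra.
have [|Dy gy] := H1 t y t0 td1; first by apply: le_lt_trans Y3 _; lra.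
by exists y; rewrite yE; split=> //; exact: le_trans Y3 e1e.
Qed.

Lemma dom_dir w : (forall d : R, 0 < d -> exists t u,
    [/\ 0 < t, t < d, `|u - w| < d & D (f (x0 + t *: u))]) ->
  T (w *m J).
Proof.
move=> H; apply: (plq_closed Lp) => e e0.
have e2 : 0 < e / 2 by rewrite divr_gt0.
have [d d_gt0 Hd] := local_dir w e2.
have [t [u [t0 td ud Dtu]]] := H d d_gt0.
have [y [[/(_ Dtu) Ty _] _ yw _]] := Hd t u t0 td ud.
by exists y => //; apply: le_lt_trans yw _; lra.
Qed.

Lemma first_lower w e : T (w *m J) -> 0 < e -> exists2 d : R, 0 < d &
  forall t u, 0 < t -> t < d -> `|u - w| < d -> D (f (x0 + t *: u)) ->
    t * (p (w *m J) - e) <= g (f (x0 + t *: u)) - g z0.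
Proof.
move=> Tw e0; have e2 : 0 < e / 2 by rewrite divr_gt0.
have /near_normP[b1 b10 P1] := plq_cont (w *m J) Lp e2.
have /near_normP[b2 b20 P2] := plq_cont (w *m J) Lq (@ltr01 R).
have b0 : 0 < Num.min b1 b2 / 2 by rewrite divr_gt0 // lt_min b10.
have [d d_gt0 Hd] := local_dir w b0.
pose K := `|q (w *m J)| + 1; have K0 : 0 < K by rewrite ltr_wpDl.
exists (Num.min d (e / K)); first by rewrite lt_min d_gt0 divr_gt0.
move=> t u t0; rewrite !lt_min ltr_pdivlMr // => /andP[td tK] /andP[ud _] Dtu.
have [y [[/(_ Dtu) Ty _] /(_ Ty) -> yw _]] := Hd t u t0 td ud.
have yb : `|y - w *m J| < Num.min b1 b2 by apply: le_lt_trans yw _; lra.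
move: yb; rewrite lt_min => /andP[/P1/(_ Ty) p1 /P2/(_ Ty) q1].
move: p1 q1; rewrite !ler_norml => /andP[p1 _] /andP[q1 _].
have qK : - K <= q y by rewrite /K; have := ler_norm (- q (w *m J)); rewrite normrN; lra.
have tq : - e <= t * q y.
  have : t * - K <= t * q y by rewrite ler_wpM2l // ltW.
  lra.
have -> : g z0 + t * p y + 2^-1 * (t ^+ 2 * q y) - g z0 =
  t * (p y + 2^-1 * (t * q y)) by ring.
by rewrite ler_wpM2l ?(ltW t0) //; lra.
Qed.

(** Weak duality: at the difference quotient y = uJ + t B(w) + o(t), p(y) is at least <l, y>, and
    q(y) is close to q(wJ) because q is continuous relative to T. *)
Lemma second_lower w l e : T (w *m J) -> (forall y, T y -> dotp l y <= p y) ->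
  0 < e -> exists2 d : R, 0 < d &
  forall t u, 0 < t -> t < d -> `|u - w| < d -> D (f (x0 + t *: u)) ->
    t * dotp l (u *m J) + t ^+ 2 * (dotp l (B w) + 2^-1 * q (w *m J) - e)
      <= g (f (x0 + t *: u)) - g z0.
Proof.
move=> Tw lp e0.
have /near_normP[b b0 P2] := plq_cont (w *m J) Lq e0.
pose K := m%:R * `|l| + 1; have K0 : 0 < K by rewrite ltr_wpDl // mulr_ge0.
have c0 : 0 < Num.min (b / 2) (e / (2 * K)).
  by rewrite lt_min !divr_gt0 // mulr_gt0.
have [d d_gt0 Hd] := local_dir w c0; exists d => // t u t0 td ud Dtu.
have [y [[/(_ Dtu) Ty _] /(_ Ty) -> yw yuw]] := Hd t u t0 td ud.
have c1 : Num.min (b / 2) (e / (2 * K)) <= b / 2 by rewrite ge_min lexx.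
have c2 : Num.min (b / 2) (e / (2 * K)) <= e / (2 * K) by rewrite ge_min lexx orbT.
have yb : `|y - w *m J| < b by lra.
have := P2 _ yb Ty; rewrite ler_norml => /andP[q1 _].
have py := lp y Ty.
have := dotp_le_norm l (y - u *m J - t *: B w).
rewrite ler_norml => /andP[ly _]; rewrite !dotpBr dotpZr in ly.
have le2 : m%:R * `|l| * `|y - u *m J - t *: B w| <= e / 2 * t.
  have H : `|y - u *m J - t *: B w| <= e / (2 * K) * t.
    by apply: le_trans yuw _; rewrite ler_wpM2r // ltW.
  apply: (@le_trans _ _ (K * (e / (2 * K) * t))).
    by apply: ler_pM => //; rewrite ?mulr_ge0 ?lerDl.
  by rewrite le_eqVlt; apply/orP; left; apply/eqP; field; rewrite gt_eqF.
have lyt : dotp l (u *m J) + t * dotp l (B w) - e / 2 * t <= p y by lra.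
have q2 : t * (2^-1 * q (w *m J) - 2^-1 * e) <= t * (2^-1 * q y).
  by rewrite ler_wpM2l ?(ltW t0) //; lra.
have -> : g z0 + t * p y + 2^-1 * (t ^+ 2 * q y) - g z0 =
  t * (p y + t * (2^-1 * q y)) by ring.
have -> : t * dotp l (u *m J) + t ^+ 2 * (dotp l (B w) + 2^-1 * q (w *m J) - e) =
  t * (dotp l (u *m J) + t * (dotp l (B w) + 2^-1 * q (w *m J) - e)) by ring.
by rewrite ler_wpM2l ?(ltW t0) //; lra.
Qed.

Section Tangent.
Variables (w : 'rV[R]_n) (T' : set 'rV[R]_m) (P q' : 'rV[R]_m -> R).
Variable (L3 : seq (@piece R m)).

Let y0 := w *m J.

Hypothesis (Ty0 : T y0) (LP : plq_rep L3 T' P) (cL3 : conic_pieces L3).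
Hypothesis q'0 : forall h, q' h = 0.
Hypothesis near_y0 : \forall h \near (0 : 'rV[R]_m), (T (y0 + h) <-> T' h) /\
  (T' h -> p (y0 + h) = p y0 + P h + 2^-1 * q' h).

Lemma near_tangent y : exists2 d : R, 0 < d & forall t y',
  0 < t -> t < d -> `|y' - y| < d ->
  (T (y0 + t *: y') <-> T' y') /\
  (T' y' -> p (y0 + t *: y') = p y0 + t * P y').
Proof.
have q'Z h (t : R) : 0 < t -> q' (t *: h) = t ^+ 2 * q' h.
  by rewrite !q'0 mulr0.
have [d d_gt0 H] := near_cone y LP cL3 q'Z near_y0; exists d => // t y' t0 td yd.
have [Tt pt] := H t y' t0 td yd; split=> // /pt ->.
by rewrite q'0 !mulr0 addr0.
Qed.

(* A cluster point of the corrections u given by metric subregularity at      *)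
(* x0 + t w, as t tends to 0.                                                 *)
Lemma feasible_direction : exists u, T' (u *m J + B w).
Proof.
pose C := kappa * (`|B w| + 1) + 1.
have C0 : 0 <= C by rewrite addr_ge0 // mulr_ge0 // addr_ge0.
(* The image of x0 + t w misses the feasible point z0 + t y0 by at most t^2 (|B w| + 1). Metric
   subregularity with slack t^2 then moves x0 + t w by t^2 u with |u| <= C, uniformly in t. *)
have near_u e : 0 < e -> exists u, `|u| <= C /\
    exists2 y, T' y & `|y - (u *m J + B w)| <= e.
  move=> e0.
  have e2 : 0 < e / 2 by rewrite divr_gt0.
  have [d1 d10 H1] := local_dir w e2.
  have [d2 d20 H2] := f_exp w (@ltr01 R).
  have [d3 d30 H3] := near_cone y0 Lp cL' qZ near_z0.
  pose K := n%:R * C * `|J| + `|B w| + e.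
  have K0 : 0 <= K by rewrite !addr_ge0 ?mulr_ge0 // ltW.
  have /near_normP[d4 d40 H4] := near_y0.
  pose S := C + `|w| + 1 + K.
  have S0 : 0 <= S by rewrite addr_ge0 // addr_ge0 // addr_ge0.
  pose dd := Num.min (Num.min (Num.min d0 d4) d1) (Num.min d2 d3).
  have dd0 : 0 < dd by rewrite !lt_min d00 d40 d10 d20.
  have [t [t0 tdd2 tS]] := exists_small (divr_gt0 dd0 (@ltr0Sn R 1)) dd0 S0.
  have tdd : t < dd by lra.
  have small c : c <= S -> t * c < dd.
    by move=> cS; apply: le_lt_trans tS; rewrite ler_wpM2l // ltW.
  have [ddd dd4 dd1 dd2 dd3] : [/\ dd <= d0, dd <= d4, dd <= d1, dd <= d2 & dd <= d3].
    by rewrite /dd !ge_min !lexx !orbT.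
  have ww c : 0 < c -> `|w - w| < c by rewrite subrr normr0.
  have Dt : D (z0 + t *: y0).
    by apply: (H3 t y0 t0 (lt_le_trans tdd dd3) _).1.2 => //; rewrite subrr normr0.
  have F1 := H2 t w t0 (lt_le_trans tdd dd2) (ww _ d20).
  have F2 : `|f (x0 + t *: w) - (z0 + t *: y0)| <= t ^+ 2 * (`|B w| + 1).
    rewrite opprD addrA.
    rewrite -[X in `|X|](subrK (t ^+ 2 *: B w)); apply: le_trans (ler_normD _ _) _.
    by rewrite normrZ ger0_norm ?sqr_ge0 //; rewrite mul1r in F1; lra.
  have t2 : 0 < t ^+ 2 by rewrite exprn_gt0.
  have [|x' [Dx' x'w]] := @msqc (x0 + t *: w) _ (t ^+ 2) _ Dt t2.
    rewrite addrAC subrr add0r normrZ gtr0_norm //; apply: lt_le_trans ddd.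
    by apply: small; rewrite /S; lra.
  have [u uE] : exists u, x' = x0 + t *: (w + t *: u).
    exists ((t ^+ 2)^-1 *: (x' - (x0 + t *: w))).
    rewrite scalerDr !scalerA -expr2 mulfV ?gt_eqF // scale1r.
    by rewrite addrA [_ + (x' - _)]addrC subrK.
  have uC : `|u| <= C.
    have : t ^+ 2 * `|u| <= t ^+ 2 * C.
      rewrite -[t ^+ 2 in X in X <= _]ger0_norm ?sqr_ge0 // -normrZ.
      have -> : t ^+ 2 *: u = x' - (x0 + t *: w).
        by rewrite uE scalerDr addrA scalerA -expr2 [x0 + _ + _]addrC addrK.
      apply: le_trans x'w _; have := ler_wpM2l kappa0 F2; rewrite /C; lra.
    by rewrite ler_pM2l.
  exists u; split=> //.
  have tuC : t * `|u| <= t * C by rewrite ler_wpM2l // ltW.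
  have wd : `|w + t *: u - w| < d1.
    rewrite addrAC subrr add0r normrZ gtr0_norm //; apply: lt_le_trans dd1.
    apply: le_lt_trans tuC _; apply: small; rewrite /S.
    by have := normr_ge0 w; lra.
  have [y []] := H1 t (w + t *: u) t0 (lt_le_trans tdd dd1) wd.
  rewrite -uE => -[/(_ Dx') Ty _] _ _ yB.
  (* The second difference quotient: [local_dir] puts it near uJ + B(w), and y0 + t h in T puts it
     in the tangent cone T'. *)
  pose h := t^-1 *: (y - y0).
  have hE : t *: h = y - y0 by rewrite scalerA mulfV ?gt_eqF // scale1r.
  have hB : `|h - (u *m J + B w)| <= e / 2.
    have : t * `|h - (u *m J + B w)| <= t * (e / 2).
      rewrite -[t in X in X <= _]gtr0_norm // -normrZ [t * _]mulrC.
      apply: le_trans yB; rewrite le_eqVlt; apply/orP; left; apply/eqP; congr (`|_|).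
      rewrite scalerBr hE scalerDr mulmxDl -scalemxAl /y0.
      by rewrite !opprD !addrA.
    by rewrite ler_pM2l.
  have hK : `|h| <= K.
    rewrite -[h](subrK (u *m J + B w)); apply: le_trans (ler_normD _ _) _.
    apply: le_trans (lerD hB (ler_normD _ _)) _.
    have : `|u *m J| <= n%:R * C * `|J|.
      by apply: le_trans (norm_mulmx _ _) _; rewrite ler_wpM2r // ler_wpM2l.
    rewrite /K; lra.
  exists h; last by lra.
  have LZ : T' (t *: h) <-> T' h by exact: conic_dom LP cL3 t0.
  apply/LZ; rewrite hE; apply: (H4 (y - y0) _).1.1; last by rewrite addrC subrK.
  rewrite subr0 -hE normrZ gtr0_norm //; apply: lt_le_trans dd4.
  apply: (@le_lt_trans _ _ (t * K)); first by rewrite ler_wpM2l // ltW.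
  by apply: small; rewrite /S; have := normr_ge0 w; lra.
have /choice[u_ uP] : forall k : nat, exists u, `|u| <= C /\
    exists2 y, T' y & `|y - (u *m J + B w)| <= k.+1%:R^-1.
  by move=> k; apply: near_u; rewrite invr_gt0.
have [u uc] := bounded_row_cluster (fun k => (uP k).1).
exists u; apply: (plq_closed LP) => e e0.
pose K := n%:R * `|J| + 1; have K0 : 0 < K by rewrite ltr_wpDl // mulr_ge0.
have [N N2] : exists N : nat, N.+1%:R^-1 < e / 2.
  have := archi_boundP (ltW (divr_gt0 (@ltr0Sn R 1) e0)) => HN.
  exists (Num.bound (2 / e)); rewrite -[e / 2]invrK ltf_pV2 ?posrE ?invr_gt0 ?divr_gt0 //.
  by rewrite invf_div (lt_trans HN) // ltr_nat.
have [k Nk uk] := uc (e / 2 / K) N (divr_gt0 (divr_gt0 e0 (@ltr0Sn R 1)) K0).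
have [_ [y Ty yu]] := uP k; exists y => //.
have -> : y - (u *m J + B w) = (y - (u_ k *m J + B w)) + (u_ k - u) *m J.
  by rewrite mulmxBl; exact: subr_insert2.
apply: le_lt_trans (ler_normD _ _) _.
have k1 : k.+1%:R^-1 <= N.+1%:R^-1 :> R by rewrite lef_pV2 ?posrE // ler_nat.
have := norm_mulmx (u_ k - u) J.
move: uk; rewrite ltr_pdivlMr // /K => uk.
have yu' := le_lt_trans (le_trans yu k1) N2.
move: yu'; have := normr_ge0 (u_ k - u); clear k1 N2 yu uP.
lra.
Qed.

(** The curve x0 + t w + t^2 u is feasible up to e1 t^2, so subregularity replaces u by u' within
    (kappa + 1) e1. The value of g follows from two nested local models, that of g at z0 and that of
    p at y0, the latter having no quadratic part. *)
Lemma upper_path u e d : T' (u *m J + B w) -> 0 < e -> 0 < d -> exists t u',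
  [/\ 0 < t < d, `|w + t *: u' - w| < d, `|u' - u| <= e,
      D (f (x0 + t *: (w + t *: u'))) &
      g (f (x0 + t *: (w + t *: u'))) - g z0 <=
        t * p y0 + t ^+ 2 * (P (u *m J + B w) + 2^-1 * q y0 + e)].
Proof.
move=> T'y2 e0 d_gt0; set y2 := u *m J + B w in T'y2 *.
have e2 : 0 < e / 2 by rewrite divr_gt0.
have /near_normP[b1 b10 P1] := plq_cont y2 LP e2.
have /near_normP[b2 b20 P2] := plq_cont y0 Lq e0.
have [d5 d50 H5] := near_tangent y2.
have [d3 d30 H3] := near_cone y0 Lp cL' qZ near_z0.
have nJ0 : 0 <= n%:R * `|J| by rewrite mulr_ge0.
have M0 : 0 < (kappa + 1) * (1 + n%:R * `|J|) + 1.
  by rewrite ltr_wpDl // mulr_ge0 // addr_ge0.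
(* e1 must keep u' within e of u, and the second difference quotient h where P is close to P(y2) and
   the model at y0 is valid. *)
have [e1 [e10 e1e e1b]] : exists e1 : R, [/\ 0 < e1, (kappa + 1) * e1 <= e &
    e1 + n%:R * `|J| * ((kappa + 1) * e1) < Num.min b1 d5].
  pose c := Num.min e (Num.min b1 d5 / 2).
  have c0 : 0 < c by rewrite lt_min e0 divr_gt0 // lt_min b10.
  pose M := (kappa + 1) * (1 + n%:R * `|J|) + 1.
  have [r r0 rM] : exists2 r, 0 < r & r * M = c.
    by exists (c / M); [rewrite divr_gt0|rewrite divfK // gt_eqF].
  have k0 : 0 <= kappa + 1 by rewrite addr_ge0.
  have M1 : M = (kappa + 1) + ((kappa + 1) * (n%:R * `|J|) + 1) by rewrite /M; ring.
  have M2 : M = (1 + n%:R * `|J| * (kappa + 1)) + (kappa + 1) by rewrite /M; ring.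
  exists r; split=> //.
    apply: (@le_trans _ _ c); last by rewrite ge_min lexx.
    by rewrite -rM mulrC ler_wpM2l ?(ltW r0) // M1 lerDl addr_ge0 // mulr_ge0.
  apply: (@le_lt_trans _ _ c); last first.
    rewrite gt_min; apply/orP; right.
    by rewrite ltr_pdivrMr // ltr_pMr ?lt_min ?b10 // ltr1n.
  have -> : r + n%:R * `|J| * ((kappa + 1) * r) = r * (1 + n%:R * `|J| * (kappa + 1)).
    by ring.
  by rewrite -rM ler_wpM2l ?(ltW r0) // M2 lerDl.
have k1 : 0 <= kappa + 1 by rewrite addr_ge0.
have ke1 : 0 <= (kappa + 1) * e1 by rewrite mulr_ge0 // ltW.
have c0 : 0 < Num.min e1 (b2 / 2) by rewrite lt_min e10 divr_gt0.
have [d1 d10 H1] := local_dir w c0.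
have [d2 d20 H2] := f_exp w e10.
pose W := `|u| + e; pose S := `|w| + W + `|y2| + 1.
have W0 : 0 <= W by rewrite addr_ge0 // ltW.
have S0 : 0 <= S by rewrite addr_ge0 // addr_ge0 // addr_ge0.
pose dd := Num.min (Num.min (Num.min d0 d) (Num.min d1 1)) (Num.min d2 (Num.min d3 d5)).
have dd0 : 0 < dd by rewrite !lt_min d00 d_gt0 d10 d20 d30 d50 ltr01.
have [t [t0 _ tS]] := exists_small dd0 dd0 S0.
have small c : c <= S -> t * c < dd.
  by move=> cS; apply: le_lt_trans tS; rewrite ler_wpM2l // ltW.
have tdd : t < dd.
  rewrite -[t]mulr1; apply: small; rewrite /S.
  by have := normr_ge0 w; have := normr_ge0 y2; lra.
have ddd0 : dd <= d0 by rewrite /dd !ge_min lexx.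
have ddd : dd <= d by rewrite /dd !ge_min lexx !orbT.
have ddd1 : dd <= d1 by rewrite /dd !ge_min lexx !orbT.
have ddone : dd <= 1 by rewrite /dd !ge_min lexx !orbT.
have ddd2 : dd <= d2 by rewrite /dd !ge_min lexx !orbT.
have ddd3 : dd <= d3 by rewrite /dd !ge_min lexx !orbT.
have ddd5 : dd <= d5 by rewrite /dd !ge_min lexx !orbT.
have tuW v : `|v| <= W -> `|w + t *: v - w| < dd.
  move=> vW; rewrite addrAC subrr add0r normrZ gtr0_norm //.
  apply: small; rewrite /S; have := normr_ge0 w; have := normr_ge0 y2; lra.
have uW : `|u| <= W by rewrite lerDl ltW.
have Ty : T (y0 + t *: y2).
  by apply: (H5 t y2 t0 (lt_le_trans tdd ddd5) _).1.2 => //; rewrite subrr normr0.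
have Dt : D (z0 + t *: (y0 + t *: y2)).
  apply: (H3 t _ t0 (lt_le_trans tdd ddd3) _).1.2 => //.
  rewrite addrAC subrr add0r normrZ gtr0_norm //; apply: lt_le_trans ddd3.
  by apply: small; rewrite /S; have := normr_ge0 w; lra.
have t2 : 0 < t ^+ 2 by rewrite exprn_gt0.
have F1 := H2 t (w + t *: u) t0 (lt_le_trans tdd ddd2) (lt_le_trans (tuW u uW) ddd2).
have F2 : `|f (x0 + t *: (w + t *: u)) - (z0 + t *: (y0 + t *: y2))| <= e1 * t ^+ 2.
  apply: le_trans F1; rewrite le_eqVlt; apply/orP; left; apply/eqP; congr (`|_|).
  rewrite -/z0 mulmxDl -scalemxAl /y2 /y0 !scalerDr !scalerA -expr2.
  by rewrite !opprD !addrA.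
have [|x' [Dx' x'w]] := @msqc (x0 + t *: (w + t *: u)) _ _ _ Dt (mulr_gt0 e10 t2).
  rewrite addrAC subrr add0r normrZ gtr0_norm //; apply: lt_le_trans ddd0.
  apply: small; apply: le_trans (ler_normD _ _) _; rewrite normrZ gtr0_norm //.
  have : t * `|u| <= 1 * `|u| by rewrite ler_wpM2r // ltW // (lt_le_trans tdd).
  by rewrite /S /W; have := normr_ge0 y2; lra.
have [u' uE] : exists u', x' = x0 + t *: (w + t *: u').
  exists ((t ^+ 2)^-1 *: (x' - (x0 + t *: w))).
  rewrite scalerDr !scalerA -expr2 mulfV ?gt_eqF // scale1r.
  by rewrite addrA [_ + (x' - _)]addrC subrK.
have u'u : `|u' - u| <= (kappa + 1) * e1.
  have : t ^+ 2 * `|u' - u| <= t ^+ 2 * ((kappa + 1) * e1).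
    rewrite -[t ^+ 2 in X in X <= _]ger0_norm ?sqr_ge0 // -normrZ.
    have -> : t ^+ 2 *: (u' - u) = x' - (x0 + t *: (w + t *: u)).
      by rewrite uE scalerBr !scalerDr !scalerA -expr2 !addrA opprD addrACA subrr add0r.
    apply: le_trans x'w _; have := ler_wpM2l kappa0 F2; lra.
  by rewrite ler_pM2l.
have u'W : `|u'| <= W.
  rewrite -[u'](subrK u) addrC; apply: le_trans (ler_normD _ _) _.
  by rewrite lerD2l (le_trans u'u).
have wd := tuW u' u'W.
have [y []] := H1 t (w + t *: u') t0 (lt_le_trans tdd ddd1) (lt_le_trans wd ddd1).
rewrite -uE => -[/(_ Dx') Tyy _] /(_ Tyy) gE yb yB.
have c1 : Num.min e1 (b2 / 2) <= e1 by rewrite ge_min lexx.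
have c2 : Num.min e1 (b2 / 2) <= b2 / 2 by rewrite ge_min lexx orbT.
have [h hE] : exists h, y = y0 + t *: h.
  exists (t^-1 *: (y - y0)).
  by rewrite scalerA mulfV ?gt_eqF // scale1r [y0 + _]addrC subrK.
have hB : `|h - (u' *m J + B w)| <= e1.
  have : t * `|h - (u' *m J + B w)| <= t * e1.
    rewrite -[t in X in X <= _]gtr0_norm // -normrZ [t * _]mulrC.
    apply: (@le_trans _ _ (Num.min e1 (b2 / 2) * t)); last by rewrite ler_wpM2r // ltW.
    apply: le_trans yB; rewrite le_eqVlt; apply/orP; left; apply/eqP; congr (`|_|).
    rewrite hE scalerBr scalerDr mulmxDl -scalemxAl -/y0 !opprD !addrA.
    by rewrite [y0 + _]addrC addrK.
  by rewrite ler_pM2l.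
have hy2 : `|h - y2| < Num.min b1 d5.
  apply: le_lt_trans e1b; have -> : h - y2 = (h - (u' *m J + B w)) + (u' - u) *m J.
    by rewrite mulmxBl; exact: subr_insert2.
  apply: le_trans (ler_normD _ _) _; rewrite lerD //.
  apply: le_trans (norm_mulmx _ _) _; rewrite mulrAC.
  by rewrite ler_wpM2l.
move: hy2; rewrite lt_min => /andP[hb1 hd5].
have [Th pE] := H5 t h t0 (lt_le_trans tdd ddd5) hd5.
rewrite -hE in Th pE; have T'h := Th.1 Tyy.
have := P1 h hb1 T'h; rewrite ler_norml => /andP[_ Ph].
have := P2 y _ Tyy; rewrite ler_norml => /(_ _)/andP[|_ qy]; first by lra.
exists t, u'; split => //.
- by rewrite t0 (lt_le_trans tdd ddd).
- exact: lt_le_trans wd ddd.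
- exact: le_trans u'u e1e.
- by rewrite -uE.
rewrite -uE gE (pE T'h).
have -> : g z0 + t * (p y0 + t * P h) + 2^-1 * (t ^+ 2 * q y) - g z0 =
  t * p y0 + t ^+ 2 * (P h + 2^-1 * q y) by ring.
by rewrite lerD2l ler_wpM2l ?(ltW t2) //; lra.
Qed.

End Tangent.

(** The multiplier set expressed in the local model; [multipliersE] identifies it with the original
    one. *)
Definition cone_multiplier v l := (forall y, T y -> dotp l y <= p y) /\ l *m J^T = v.

(* LP duality turns the infimum over the curves x0 + t w + t^2 u of the       *)
(* second-order quotients into the maximum over the multipliers.              *)
Lemma critical_upper v w l0 : cone_multiplier v l0 -> T (w *m J) ->
  p (w *m J) = dotp v w -> exists l, [/\ cone_multiplier v l,
    forall l', cone_multiplier v l' -> dotp l' (B w) <= dotp l (B w) &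
    forall e d, 0 < e -> 0 < d -> exists t w',
      [/\ 0 < t < d, `|w' - w| < d, D (f (x0 + t *: w')) &
          g (f (x0 + t *: w')) - g z0 <= t * dotp v w' +
            t ^+ 2 * (dotp l (B w) + 2^-1 * q (w *m J) + e)]].
Proof.
move=> l0P Ty pv.
have [L3 [L4 [T' [P [q' [[LP cL3 cP] _ _ q'0 near_y0]]]]]] := plq_localize Lp cp Ty.
have {}q'0 : forall h, q' h = 0 by apply: q'0 => c /cL'[].
have [u0 Tu0] := feasible_direction Ty LP cL3 near_y0.
(* For a multiplier, <l, y0> = <v, w> = p(y0) since w is critical, so l <= p at y0 + t y can be
   divided by t. *)
have weak l y : cone_multiplier v l -> T' y -> dotp l y <= P y.
  move=> [lp lJ] T'y; have [d d_gt0 H] := near_tangent LP cL3 q'0 near_y0 y.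
  have [t [t0 td _]] := exists_small (divr_gt0 d_gt0 (@ltr0Sn R 1)) (@ltr01 R) (lexx 0).
  have yy : `|y - y| < d by rewrite subrr normr0.
  have {}td : t < d by lra.
  have [Tt /(_ T'y) pt] := H t y t0 td yy.
  have := lp _ (Tt.2 T'y); rewrite pt pv dotpDr dotpZr -lJ -dotp_mulmx.
  by rewrite lerD2l ler_pM2l.
(* Conversely, p(y0) + t P(y) = p(y0 + t y) <= p(y0) + t p(y) gives P <= p on T. *)
have PT l : (forall y, T' y -> dotp l y <= P y) -> forall y, T y -> dotp l y <= p y.
  move=> lP y Tyy; have [d d_gt0 H] := near_tangent LP cL3 q'0 near_y0 y.
  have [t [t0 td _]] := exists_small (divr_gt0 d_gt0 (@ltr0Sn R 1)) (@ltr01 R) (lexx 0).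
  have yy : `|y - y| < d by rewrite subrr normr0.
  have {}td : t < d by lra.
  have [Tt pt] := H t y t0 td yy.
  have Tty := (conic_dom y Lp cL' t0).2 Tyy.
  have [Tsum psum] := conic_sublinear Lp cL' cp Ty Tty.
  have T'y := Tt.1 Tsum; apply: le_trans (lP _ T'y) _.
  by move: psum; rewrite (pt T'y) (conic_homog Lp cL' t0 Tyy) lerD2l ler_pM2l.
have weak_u l u : cone_multiplier v l -> T' (u *m J + B w) ->
    dotp l (B w) <= P (u *m J + B w) - dotp v u.
  move=> lm T'u; have := weak l _ lm T'u; rewrite dotpDr dotp_mulmx lm.2.
  by rewrite lerBrDr addrC.
(* Weak duality makes sup S a lower bound of the linear program in u; duality with c = sup S returns
   a multiplier attaining the supremum. *)
pose S := [set dotp l (B w) | l in cone_multiplier v].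
have S0 : S !=set0 by exists (dotp l0 (B w)), l0.
have Sub : has_ubound S.
  by exists (P (u0 *m J + B w) - dotp v u0) => _ [l lm <-]; exact: weak_u.
have [u|l [lP lJ lc]] := @lp_duality _ _ _ _ _ _ J v (B w) (sup S) u0 LP cL3 cP Tu0.
  by move=> T'u; apply: sup_le_ub => // _ [l lm <-]; exact: weak_u.
have lm : cone_multiplier v l by split=> //; exact: PT.
have lmax l' : cone_multiplier v l' -> dotp l' (B w) <= dotp l (B w).
  by move=> lm'; apply: le_trans lc; apply: ub_le_sup => //; exists l'.
exists l; split=> // e d e0 d_gt0.
(* Otherwise the lower bound of the program could be raised by e / 3, and duality would produce a
   multiplier above the maximum. *)
have [u [T'u uP]] : exists u, T' (u *m J + B w) /\
    P (u *m J + B w) - dotp v u <= dotp l (B w) + e / 3.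
  apply: contrapT => /forallNP nu.
  have [u T'u|l' [lP' lJ' lc']] :=
    @lp_duality _ _ _ _ _ _ J v (B w) (dotp l (B w) + e / 3) u0 LP cL3 cP Tu0.
    have /not_andP[//|/negP] := nu u; by rewrite -ltNge => /ltW.
  have := lmax l' (conj (PT _ lP') lJ'); apply/negP; rewrite -ltNge.
  apply: lt_le_trans lc'; lra.
pose K := n%:R * `|v| + 1; have K0 : 0 < K by rewrite ltr_wpDl // mulr_ge0.
have e1 : 0 < Num.min (e / 3) (e / 3 / K) by rewrite lt_min !divr_gt0.
have [t [u' [td wd u'u Dx gx]]] :=
  upper_path LP cL3 q'0 near_y0 T'u e1 d_gt0.
exists t, (w + t *: u'); split=> //; apply: le_trans gx _.
have t0 : 0 < t by case/andP: td.
have -> : t * dotp v (w + t *: u') +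
      t ^+ 2 * (dotp l (B w) + 2^-1 * q (w *m J) + e) =
    t * dotp v w + t ^+ 2 * (dotp v u' + (dotp l (B w) + 2^-1 * q (w *m J) + e)).
  by rewrite dotpDr dotpZr; ring.
rewrite pv lerD2l ler_wpM2l ?sqr_ge0 //.
have m1 : Num.min (e / 3) (e / 3 / K) <= e / 3 by rewrite ge_min lexx.
have vu : dotp v u - dotp v u' <= e / 3.
  rewrite -dotpBr; apply: le_trans (ler_norm _) _.
  apply: le_trans (dotp_le_norm _ _) _; rewrite distrC.
  apply: (@le_trans _ _ (K * (e / 3 / K))).
    apply: ler_pM; rewrite ?mulr_ge0 // ?lerDl //.
    by apply: le_trans u'u _; rewrite ge_min lexx orbT.
  by rewrite mulrC divfK // gt_eqF.
lra.
Qed.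

End SecondOrder.

(** * From the extended-real definitions to the local cone model *)

Lemma scalar_mx00 {R : realType} (a : R) : (a%:M : 'rV_1) 0 0 = a.
Proof. by rewrite mxE eqxx mulr1n. Qed.

(** The slack eta pays for choosing a point instead of the infimum in the distance, and the constant
    absorbs the factor m between the Euclidean and the sup norm. *)
Lemma msqc_ineq {R : realType} {n m : nat} (f : 'rV[R]_n -> 'rV[R]_m)
    (theta : 'rV[R]_m -> \bar R) (x0 : 'rV[R]_n) : MSQC f theta x0 ->
  exists kappa d : R, [/\ 0 <= kappa, 0 < d &
    forall x z (eta : R), `|x - x0| < d -> dom theta z -> 0 < eta ->
      exists x', dom theta (f x') /\ `|x' - x| <= kappa * `|f x - z| + eta].
Proof.
move=> [k k0 /near_normP[d d0 H]]; exists (k * m%:R), d; split=> //.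
  by rewrite mulr_ge0.
move=> x z eta xd Dz eta0; have := H x xd => {}H.
have : (dist x [set x' | dom theta (f x')] < (k * m%:R * `|f x - z| + eta)%:E)%E.
  apply: (le_lt_trans H); apply: (@le_lt_trans _ _ (k%:E * (enorm (f x - z))%:E)%E).
    by apply: lee_wpmul2l; rewrite ?lee_fin //; apply: ereal_inf_lbound; exists z.
  rewrite -EFinM lte_fin; apply: (@le_lt_trans _ _ (k * (m%:R * `|f x - z|))).
    by rewrite ler_wpM2l // enorm_le_norm.
  by rewrite mulrA ltrDl.
move=> /ereal_inf_lt[_ [x' Dx' <-]]; rewrite lte_fin => xx'.
exists x'; split=> //; rewrite distrC; apply: le_trans (norm_le_enorm _) _.
exact: ltW.
Qed.

(** Regular normals to the epigraph tend to (v, -1), so the negated last coordinate serves as beta,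
    close to 1. *)
Lemma approx_normal_subdifferential {R : realType} {n m : nat}
    (f : 'rV[R]_n -> 'rV[R]_m) (theta : 'rV[R]_m -> \bar R) (x0 v : 'rV[R]_n) :
  (forall y, theta y != -oo%E) -> subdifferential (theta \o f) x0 v ->
  approx_normal f x0 (dom theta) (fval theta) v.
Proof.
move=> proper [_ [X_ [V_ [XC VN XX VV]]]] e e0.
have [k [Xk Vk]] := filter_ex (filterI (cvg_seq_near XX e0) (cvg_seq_near VV e0)).
set X := X_ k in Xk; set V := V_ k in Vk.
have subE (Y : 'rV[R]_(n + 1)) y (a : R) :
    Y - row_mx y a%:M = row_mx (lsubmx Y - y) (rsubmx Y 0 0 - a)%:M.
  by rewrite [Y in LHS]row_mx_hsub opp_row_mx add_row_mx raddfB.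
exists (lsubmx X), (lsubmx V), (rsubmx X 0 0), (- rsubmx V 0 0).
have := XC k; rewrite /epi /= => /(dom_le proper)[DX gX].
split=> //.
- apply: le_lt_trans Xk; rewrite subE; apply: le_trans (norm_lsubmx _).
  by rewrite row_mxKl.
- apply: le_lt_trans Vk; rewrite subE; apply: le_trans (norm_lsubmx _).
  by rewrite row_mxKl.
- apply: le_lt_trans Vk; rewrite subE; apply: le_trans (norm_rsubmx _).
  by rewrite row_mxKr scalar_mx00 -normrN !opprD !opprK.
move=> eta eta0.
have /near_normP[d d0 H] := regular_normal_near (VN k) eta0.
exists (d / 2); first by rewrite divr_gt0.
move=> x a Dx ga xd ad; pose Y : 'rV[R]_(n + 1) := row_mx x a%:M.
have YX : Y - X = row_mx (x - lsubmx X) (a - rsubmx X 0 0)%:M.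
  by rewrite [X in LHS]row_mx_hsub opp_row_mx add_row_mx raddfB.
have YXn : `|Y - X| <= `|x - lsubmx X| + `|a - rsubmx X 0 0|.
  by rewrite YX; exact: norm_row_mx.
have YC : epi (theta \o f) Y.
  rewrite /epi /= row_mxKl row_mxKr scalar_mx00; exact/(dom_le proper).
have YXd : `|Y - X| < d by lra.
have dE : dotp V (Y - X) = dotp (lsubmx V) (x - lsubmx X)
    - - rsubmx V 0 0 * (a - rsubmx X 0 0).
  by rewrite YX [V in LHS]row_mx_hsub dotp_row_mx dotp_scalar mulNr opprK.
by rewrite -dE; apply: le_trans (H Y YXd YC) _; rewrite ler_wpM2l // ltW.
Qed.

Section Quotient.
Context {R : realType} {m : nat} (theta : 'rV[R]_m -> \bar R).
Hypothesis proper : forall y, theta y != -oo%E.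

Lemma not_dom y : ~ dom theta y -> theta y = +oo%E.
Proof. by move=> /negP; rewrite -leNgt leye_eq => /eqP. Qed.

Lemma quotient_pinfty y (a c : R) : 0 < c -> ~ dom theta y ->
  ((theta y - a%:E) * c%:E)%E = +oo%E.
Proof. by move=> c0 /not_dom ->; rewrite /= gt0_mulye ?lte_fin. Qed.

Lemma quotient_fin y (a c : R) : dom theta y ->
  ((theta y - a%:E) * c%:E)%E = ((fval theta y - a) * c)%:E.
Proof. by move=> Dy; rewrite (fvalE proper Dy). Qed.

Lemma quotient_le y (a c r : R) : 0 < c ->
  ((theta y - a%:E) * c%:E <= r%:E)%E ->
  dom theta y /\ (fval theta y - a) * c <= r.
Proof.
move=> c0 H; have [Dy|nDy] := pselect (dom theta y).
  by move: H; rewrite (quotient_fin _ _ Dy) lee_fin.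
by move: H; rewrite quotient_pinfty.
Qed.

Lemma quotient_ge y (a c r : R) : 0 < c ->
  (dom theta y -> r <= (fval theta y - a) * c) ->
  (r%:E <= (theta y - a%:E) * c%:E)%E.
Proof.
move=> c0 H; have [Dy|nDy] := pselect (dom theta y).
  by rewrite quotient_fin // lee_fin H.
by rewrite quotient_pinfty // leey.
Qed.

Lemma sube2 (x : \bar R) (a b : R) : (x - a%:E - b%:E = x - (a + b)%:E)%E.
Proof. by case: x => [r||] //; rewrite -!EFinB opprD addrA. Qed.

(** On T the second-order quotient is (2 / t) (p(u) - <l, u>) + q(u). The first term is nonnegative
    because l <= p, and vanishes at u = y, so the constant direction y attains the lower limit. *)
Lemma second_subderivative_cone (T : set 'rV[R]_m) (p q : 'rV[R]_m -> R)
    (L' L'' : seq (@piece R m)) z l y :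
  plq_rep L' T p -> conic_pieces L' -> plq_rep L'' T q ->
  (forall h (t : R), 0 < t -> q (t *: h) = t ^+ 2 * q h) ->
  (\forall h \near (0 : 'rV[R]_m), (dom theta (z + h) <-> T h) /\
    (T h -> fval theta (z + h) = fval theta z + p h + 2^-1 * q h)) ->
  dom theta z -> (forall h, T h -> dotp l h <= p h) ->
  T y -> p y = dotp l y ->
  second_subderivative theta z l y = (q y)%:E.
Proof.
move=> Lp cL' Lq qZ near_z Dz lp Ty py; rewrite /second_subderivative.
have [d d_gt0 H] := near_cone y Lp cL' qZ near_z.
have c0 (t : R) : 0 < t -> 0 < (2^-1 * t ^+ 2)^-1.
  by move=> t0; rewrite invr_gt0 mulr_gt0 // exprn_gt0.
have fE t u : ((theta (z + t *: u) - theta z - (t * dotp l u)%:E) *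
    ((2^-1 * t ^+ 2)^-1)%:E =
    (theta (z + t *: u) - (fval theta z + t * dotp l u)%:E) *
    ((2^-1 * t ^+ 2)^-1)%:E)%E.
  by rewrite (fvalE proper Dz) sube2.
have qE t u : 0 < t -> t < d -> `|u - y| < d -> T u ->
    (fval theta (z + t *: u) - (fval theta z + t * dotp l u)) *
      (2^-1 * t ^+ 2)^-1 = 2 / t * (p u - dotp l u) + q u.
  move=> t0 td uy Tu; have [_ /(_ Tu) ->] := H t u t0 td uy.
  by field; rewrite gt_eqF.
apply/le_anti/andP; split.
  apply: limf_einf_le => e A e0 /near_prodP[d' d'0 dA].
  have m0 : 0 < Num.min d d' / 2 by rewrite divr_gt0 // lt_min d_gt0.
  have [m1 m2] : Num.min d d' / 2 < d /\ Num.min d d' / 2 < d'.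
    have i1 : Num.min d d' <= d by rewrite ge_min lexx.
    have i2 : Num.min d d' <= d' by rewrite ge_min lexx orbT.
    by split; lra.
  exists (Num.min d d' / 2, y); first by apply: dA => //; rewrite subrr normr0.
  rewrite /= fE; set t := Num.min d d' / 2 in m0 m1 m2 *.
  have yy : `|y - y| < d by rewrite subrr normr0.
  have [Dt _] := H t y m0 m1 yy.
  rewrite quotient_fin ?qE //; last exact/Dt.
  by rewrite py subrr mulr0 add0r lee_fin lerDl ltW.
apply: le_limf_einf => e e0; apply/near_prodP.
have /near_normP[b b0 qb] := plq_cont y Lq e0.
exists (Num.min d b) => [|t u t0]; first by rewrite lt_min d_gt0.
rewrite !lt_min => /andP[td _] /andP[ud ub]; rewrite /= fE.
apply: quotient_ge; first exact: c0.
move=> Dt; have [/(_ Dt) Tu _] : dom theta (z + t *: u) <-> T u := (H t u t0 td ud).1.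
rewrite qE //; have := qb u ub Tu; rewrite ler_norml => /andP[q1 _].
have : 0 <= 2 / t * (p u - dotp l u).
  by rewrite mulr_ge0 ?divr_ge0 ?(ltW t0) // subr_ge0 lp.
lra.
Qed.

(** Along a ray the subgradient inequality gives <l, h> <= p(h) to first order. Conversely,
    convexity between z and y gives p(y - z) <= theta(y) - theta(z). *)
Lemma subdifferential_cone (T : set 'rV[R]_m) (p q : 'rV[R]_m -> R)
    (L' : seq (@piece R m)) z l : convex_efun theta ->
  plq_rep L' T p -> conic_pieces L' ->
  (forall h (t : R), 0 < t -> q (t *: h) = t ^+ 2 * q h) ->
  (\forall h \near (0 : 'rV[R]_m), (dom theta (z + h) <-> T h) /\
    (T h -> fval theta (z + h) = fval theta z + p h + 2^-1 * q h)) ->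
  dom theta z ->
  subdifferential theta z l <-> forall h, T h -> dotp l h <= p h.
Proof.
move=> cth Lp cL' qZ near_z Dz; rewrite (subdifferentialP proper cth _ Dz).
have cg := convex_on_fval proper cth.
have dir h : \forall t \near (0 : R)^'+, 0 < t /\
    ((dom theta (z + t *: h) <-> T h) /\ (T h ->
    fval theta (z + t *: h) = fval theta z + t * p h + 2^-1 * (t ^+ 2 * q h))).
  have [d d_gt0 H] := near_cone h Lp cL' qZ near_z.
  have : \forall t \near (0 : R)^'+, 0 < t /\ t < d.
    near=> t; split; first by near: t; exact: nbhs_right_gt.
    by near: t; exact: nbhs_right_lt.
  apply: filterS => t [t0 td]; split=> //; apply: H => //.
  by rewrite subrr normr0.
split=> [H h Th|H y Dy].
  rewrite -subr_le0; apply: (@near0_linear_le _ _ (2^-1 * q h)).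
  apply: filterS (dir h) => t [t0 [Dt gt]].
  have := H _ (Dt.2 Th); rewrite (gt Th) [z + _]addrC addrK dotpZr; lra.
set h := y - z.
have near_t : \forall t \near (0 : R)^'+, T h /\
    t * (p h - (fval theta y - fval theta z)) <= t ^+ 2 * (2^-1 * (- q h)).
  have : \forall t \near (0 : R)^'+, t < 1 by exact: nbhs_right_lt.
  apply: filterS2 (dir h) => t [t0 [Dt gt]] t1.
  have t1' : 0 <= 1 - t by rewrite subr_ge0 ltW.
  have tt : t + (1 - t) = 1 by rewrite addrC subrK.
  have [] := cg y z t (1 - t) Dy Dz (ltW t0) t1' tt.
  have -> : t *: y + (1 - t) *: z = z + t *: h.
    by rewrite /h scalerBr scalerBl scale1r addrCA.
  move=> /Dt Th; rewrite (gt Th) => gth; split=> //; lra.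
have [_ [Th _]] := filter_ex near_t.
apply: le_trans (H h Th) _; rewrite -subr_le0.
apply: (@near0_linear_le _ _ (2^-1 * (- q h))).
by apply: filterS near_t => t [].
Unshelve. all: by end_near. Qed.

End Quotient.

Lemma map_expansion {R : realType} {n m : nat} (f : 'rV[R]_n -> 'rV[R]_m) x w
    (e : R) : twice_differentiable_map f x -> 0 < e ->
  exists2 d : R, 0 < d & forall t u, 0 < t -> t < d -> `|u - w| < d ->
    `|f (x + t *: u) - f x - t *: (u *m jacobian f x)
      - t ^+ 2 *: (2^-1 *: (w *m 'd (jacobian f) x w))| <= e * t ^+ 2.
Proof.
move=> f2 e0; have [k k0 dk] := linear_lipschitz (@diff_continuous _ _ _ _ _ f2.2).
apply: (@second_expansion _ _ _ f (fun h => h *m jacobian f x)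
  (fun h => 2^-1 *: (h *m 'd (jacobian f) x h)) x w e) => //.
- by move=> e1; exact: taylor2_map.
- by move=> t h; rewrite scalemxAl.
- move=> t h; rewrite linearZ -scalemxAl -scalemxAr !scalerA; congr (_ *: _).
  by rewrite expr2; ring.
move=> e1 e10; apply: (@bilinear_square_cont _ _ _
  (fun u v => 2^-1 *: (u *m 'd (jacobian f) x v)) (n%:R * k)) => //.
- by move=> u v y; rewrite mulmxBl scalerBr.
- by move=> u v y; rewrite linearB mulmxBr scalerBr.
move=> u v; rewrite normrZ ger0_norm ?invr_ge0 //.
have H : `|u *m 'd (jacobian f) x v| <= n%:R * k * `|u| * `|v|.
  apply: le_trans (norm_mulmx _ _) _.
  have -> : n%:R * k * `|u| * `|v| = n%:R * `|u| * (k * `|v|) by ring.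
  by rewrite ler_wpM2l // mulr_ge0.
by have := normr_ge0 (u *m 'd (jacobian f) x v); lra.
Qed.

Lemma fun_expansion {R : realType} {n : nat} (g : 'rV[R]_n -> R) x w (e : R) :
  twice_differentiable_fun g x -> 0 < e ->
  exists2 d : R, 0 < d & forall t u, 0 < t -> t < d -> `|u - w| < d ->
    `|g (x + t *: u) - g x - t * dotp (grad g x) u
      - t ^+ 2 * (2^-1 * dotp ('d (grad g) x w) w)| <= e * t ^+ 2.
Proof.
move=> g2 e0; have [k k0 dk] := linear_lipschitz (@diff_continuous _ _ _ _ _ g2.2).
apply: (@second_expansion _ _ R g (dotp (grad g x))
  (fun h => 2^-1 * dotp ('d (grad g) x h) h) x w e) => //.
- by move=> e1; exact: taylor2_fun.
- by move=> t h; rewrite dotpZr.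
- move=> t h; rewrite linearZ dotpZr dotpZl /GRing.scale /=; ring.
move=> e1 e10; apply: (@bilinear_square_cont _ _ R
  (fun u v => 2^-1 * dotp ('d (grad g) x v) u) (n%:R * k)) => //.
- by move=> u v y; rewrite dotpBr mulrBr.
- by move=> u v y; rewrite linearB dotpBl mulrBr.
move=> u v; rewrite normrM ger0_norm ?invr_ge0 //.
have H : `|dotp ('d (grad g) x v) u| <= n%:R * k * `|u| * `|v|.
  apply: le_trans (dotp_le_norm _ _) _.
  have -> : n%:R * k * `|u| * `|v| = n%:R * (k * `|v|) * `|u| by ring.
  by rewrite ler_wpM2r // ler_wpM2l.
by have := normr_ge0 (dotp ('d (grad g) x v) u); lra.
Qed.

(** * The composite problem *)

Section CompositeProblem.
Context {R : realType} {n m : nat}.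
Variables (phi0 : 'rV[R]_n -> R) (f : 'rV[R]_n -> 'rV[R]_m).
Variables (theta : 'rV[R]_m -> \bar R) (x0 : 'rV[R]_n).
Variables (T : set 'rV[R]_m) (p q : 'rV[R]_m -> R).
Variables (L' L'' : seq (@piece R m)) (kappa d0 : R) (l0 : 'rV[R]_m).

Let g := fval theta.
Let z0 := f x0.
Let J := jacobian f x0.
Let v := - grad phi0 x0.
Let B w := 2^-1 *: (w *m 'd (jacobian f) x0 w).
Let hess0 w := dotp ('d (grad phi0) x0 w) w.

Hypothesis phi02 : twice_differentiable_fun phi0 x0.
Hypothesis f2 : twice_differentiable_map f x0.
Hypothesis proper : forall y, theta y != -oo%E.
Hypothesis cth : convex_efun theta.
Hypothesis Dz0 : dom theta z0.
Hypothesis (Lp : plq_rep L' T p) (cL' : conic_pieces L') (cp : convex_on T p).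
Hypothesis (Lq : plq_rep L'' T q)
  (qZ : forall h (t : R), 0 < t -> q (t *: h) = t ^+ 2 * q h).
Hypothesis near_z0 : \forall h \near (0 : 'rV[R]_m),
  (dom theta (z0 + h) <-> T h) /\
  (T h -> g (z0 + h) = g z0 + p h + 2^-1 * q h).
Hypothesis (kappa0 : 0 <= kappa) (d00 : 0 < d0).
Hypothesis msqc : forall x z (eta : R), `|x - x0| < d0 -> dom theta z ->
  0 < eta -> exists x', dom theta (f x') /\ `|x' - x| <= kappa * `|f x - z| + eta.
Hypothesis l0P : cone_multiplier J T p v l0.

Implicit Types (u w x : 'rV[R]_n) (l : 'rV[R]_m) (t e d : R).

Let f_exp w e (e0 : 0 < e) := map_expansion w f2 e0.

Definition critical w := T (w *m J) /\ p (w *m J) = dotp v w.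

Definition max_multiplier w l := cone_multiplier J T p v l /\
  forall l', cone_multiplier J T p v l' -> dotp l' (B w) <= dotp l (B w).

Definition objective_gap x := phi0 x + g (f x) - (phi0 x0 + g z0).

(** The value of the second-order form when l maximizes; the factor 2 appears because [B] is half
    the second derivative. *)
Definition form_value w l := q (w *m J) + (hess0 w + 2 * dotp l (B w)).

Lemma lagrangian_quad_value w l :
  lagrangian_quad phi0 f theta x0 l w = hess0 w + 2 * dotp l (B w).
Proof.
rewrite lagrangian_quadE // /B dotpZr mulrA divff ?mul1r //.
Qed.

Lemma multipliersE l : multipliers f theta x0 v l <-> cone_multiplier J T p v l.
Proof.
rewrite /multipliers /cone_multiplier /adjoint_deriv /=.
by rewrite (subdifferential_cone proper l cth Lp cL' qZ near_z0 Dz0); split=> -[].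
Qed.

(** Since v = - grad phi0, the linear terms of phi0 and g cancel and half of the form remains. The
    bound on g alone serves to compute the subderivative in [critical_coneE]. *)
Lemma critical_gap_upper w : critical w -> exists2 l, max_multiplier w l &
  forall e d, 0 < e -> 0 < d -> exists t w',
    [/\ 0 < t < d, `|w' - w| < d, dom theta (f (x0 + t *: w')),
        g (f (x0 + t *: w')) - g z0 <=
          t * dotp v w' + t ^+ 2 * (dotp l (B w) + 2^-1 * q (w *m J) + e) &
        objective_gap (x0 + t *: w') <= t ^+ 2 * (2^-1 * form_value w l + e)].
Proof.
move=> [Tw pw].
have [l [lm lmax lu]] :=
  critical_upper f_exp Lp cL' cp Lq qZ near_z0 kappa0 d00 msqc l0P Tw pw.
exists l => // e d e0 d_gt0; have e2 : 0 < e / 2 by rewrite divr_gt0.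
have [d1 d10 H1] := fun_expansion w phi02 e2.
have dd : 0 < Num.min d d1 by rewrite lt_min d_gt0.
have [t [w' [/andP[t0 td] wd Dx gx]]] := lu _ _ e2 dd.
move: td wd; rewrite !lt_min => /andP[td td1] /andP[wd wd1].
have := H1 t w' t0 td1 wd1; rewrite ler_norml => /andP[_ F1].
have t2 := sqr_ge0 t.
exists t, w'; split=> //; first by rewrite t0.
  apply: le_trans gx _; rewrite lerD2l ler_wpM2l //; lra.
rewrite /objective_gap /form_value.
move: gx F1; rewrite /v dotpNl -/(hess0 w); lra.
Qed.

Lemma gap_lower w l e : T (w *m J) -> cone_multiplier J T p v l -> 0 < e ->
  exists2 d, 0 < d & forall t u, 0 < t -> t < d -> `|u - w| < d ->
    dom theta (f (x0 + t *: u)) ->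
    t ^+ 2 * (2^-1 * form_value w l - e) <= objective_gap (x0 + t *: u).
Proof.
move=> Tw [lp lJ] e0; have e2 : 0 < e / 2 by rewrite divr_gt0.
have [d1 d10 H1] := fun_expansion w phi02 e2.
have [d2 d20 H2] := second_lower f_exp Lp cL' Lq qZ near_z0 Tw lp e2.
exists (Num.min d1 d2); first by rewrite lt_min d10.
move=> t u t0; rewrite !lt_min => /andP[td1 td2] /andP[ud1 ud2] Dx.
have := H1 t u t0 td1 ud1; rewrite ler_norml => /andP[F1 _].
have := H2 t u t0 td2 ud2 Dx.
rewrite dotp_mulmx lJ /objective_gap /form_value.
move: F1; rewrite /v dotpNl -/(hess0 w) -/g -/z0; lra.
Qed.

(** A positive excess p(wJ) - <v, w> makes psi grow at first order; this excludes noncritical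
    directions in [sufficient]. *)
Lemma gap_first_lower w e : T (w *m J) -> 0 < e ->
  exists2 d, 0 < d & forall t u, 0 < t -> t < d -> `|u - w| < d ->
    dom theta (f (x0 + t *: u)) ->
    t * (p (w *m J) - dotp v w - e) <= objective_gap (x0 + t *: u).
Proof.
move=> Tw e0.
have [e4 e40 e4E] : exists2 e4, 0 < e4 & e = 4 * e4.
  by exists (e / 4); [rewrite divr_gt0|rewrite mulrC divfK].
have [d1 d10 H1] := fun_expansion w phi02 (@ltr01 R).
have [d2 d20 H2] := first_lower f_exp Lp cL' Lq qZ near_z0 Tw e40.
pose K := n%:R * `|v| + 1; have K0 : 0 < K by rewrite ltr_wpDl // mulr_ge0.
pose H := `|2^-1 * hess0 w| + 1; have H0 : 0 < H by rewrite ltr_wpDl.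
exists (Num.min (Num.min d1 d2) (Num.min (e4 / K) (e4 / H))).
  by rewrite !lt_min d10 d20 !divr_gt0.
move=> t u t0; rewrite !lt_min !ltr_pdivlMr // -!andbA.
move=> /and4P[td1 td2 _ tH] /and4P[ud1 ud2 uK _] Dx.
have := H1 t u t0 td1 ud1; rewrite ler_norml mul1r => /andP[F1 _].
have F2 := H2 t u t0 td2 ud2 Dx.
have vu : dotp v u - dotp v w <= e4.
  rewrite -dotpBr; apply: le_trans (ler_norm _) _.
  apply: le_trans (dotp_le_norm _ _) _; apply: le_trans (ltW uK).
  by rewrite mulrC ler_wpM2l // lerDl.
have tq : t * (1 - 2^-1 * hess0 w) <= e4.
  apply: le_trans (ltW tH); rewrite ler_wpM2l ?(ltW t0) // /H addrC lerD2r.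
  by rewrite -normrN ler_norm.
have : t * (p (w *m J) - dotp v w - e) <=
    t * (p (w *m J) - e4 - dotp v u - t * (1 - 2^-1 * hess0 w)).
  by rewrite ler_wpM2l ?(ltW t0) //; lra.
move=> /le_trans; apply.
move: F1 F2; rewrite -/(hess0 w) /objective_gap /v !dotpNl -/g -/z0; lra.
Qed.

(** If the subderivative equals <v, w>, small quotients occur at feasible points arbitrarily near w;
    these force wJ into the closed cone T and p(wJ) <= <v, w>, the reverse inequality coming from
    [l0]. Conversely, the curves of [critical_gap_upper] attain the lower bound of [first_lower]. *)
Lemma critical_coneE w :
  critical_cone (theta \o f) x0 v w <-> critical w.
Proof.
have fin0 := fvalE proper Dz0.
have fE t u : (((theta \o f) (x0 + t *: u)%R - (theta \o f) x0) * (t^-1)%:E =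
    (theta (f (x0 + t *: u)%R) - (g z0)%:E) * (t^-1)%:E)%E by rewrite /= -/z0 fin0.
rewrite /critical_cone /= /subderivative; split=> [K|cw].
  have {}K : (limf_einf (fun tu : R * 'rV[R]_n =>
      (((theta \o f) (x0 + tu.1 *: tu.2)%R - (theta \o f) x0) * (tu.1^-1)%:E)%E)
      (filter_prod (0 : R)^'+ (nbhs w)) <= (dotp v w)%:E)%E by rewrite K.
  have freq e d : 0 < e -> 0 < d -> exists t u, [/\ 0 < t, t < d, `|u - w| < d,
      dom theta (f (x0 + t *: u)) &
      g (f (x0 + t *: u)) - g z0 <= t * (dotp v w + e)].
    move=> e0 d_gt0.
    pose A := [set tu : R * 'rV[R]_n | [/\ 0 < tu.1, tu.1 < d & `|tu.2 - w| < d]].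
    have FA : filter_prod (0 : R)^'+ (nbhs w) A by apply/near_prodP; exists d.
    have [[t u] [/= t0 td ud]] := limf_einf_freq K e0 FA.
    rewrite fE => /(quotient_le proper)[|Dx]; first by rewrite invr_gt0.
    by rewrite ler_pdivrMr // mulrC => H; exists t, u.
  have Tw : T (w *m J).
    apply: (dom_dir f_exp Lp cL' qZ near_z0) => d d_gt0.
    by have [t [u [t0 td ud Dx _]]] := freq 1 d ltr01 d_gt0; exists t, u.
  split=> //; apply/le_anti/andP; split; last first.
    by have [lp lJ] := l0P; rewrite -lJ -dotp_mulmx; exact: lp.
  rewrite -subr_le0 leNgt; apply/negP => gap.
  have e3 : 0 < (p (w *m J) - dotp v w) / 3 by rewrite divr_gt0.
  have [d d_gt0 H] := first_lower f_exp Lp cL' Lq qZ near_z0 Tw e3.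
  have [t [u [t0 td ud Dx]]] := freq _ d e3 d_gt0.
  have := H t u t0 td ud Dx => H1 H2.
  have := le_trans H1 H2; rewrite ler_pM2l //; lra.
have [Tw pw] := cw; apply/le_anti/andP; split.
  apply: limf_einf_le => e A e0 /near_prodP[d d_gt0 dA].
  have [l _ lu] := critical_gap_upper cw.
  pose c := dotp l (B w) + 2^-1 * q (w *m J) + 1.
  pose K := n%:R * `|v| + `|c| + 1.
  have K0 : 0 < K by rewrite ltr_wpDl // addr_ge0 // mulr_ge0.
  have dd0 : 0 < Num.min d (e / K) by rewrite lt_min d_gt0 divr_gt0.
  have [t [u [/andP[t0 td] ud Dx gx _]]] := lu 1 _ ltr01 dd0.
  move: td ud; rewrite !lt_min !ltr_pdivlMr // => /andP[td tK] /andP[ud uK].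
  exists (t, u); first exact: dA.
  rewrite fE (quotient_fin proper) // lee_fin ler_pdivrMr //.
  apply: le_trans gx _; rewrite -/c.
  have vu : dotp v u <= dotp v w + n%:R * `|v| * `|u - w|.
    rewrite addrC -lerBlDr -dotpBr; apply: le_trans (ler_norm _) _.
    exact: dotp_le_norm.
  have tc : t * c <= t * `|c| by rewrite ler_wpM2l ?(ltW t0) // ler_norm.
  have -> : t * dotp v u + t ^+ 2 * c = t * (dotp v u + t * c) by ring.
  rewrite mulrC ler_wpM2r ?(ltW t0) //.
  have [s [us ts sK]] : exists s, [/\ `|u - w| <= s, t <= s & s * K < e].
    exists (Num.max t `|u - w|); split; rewrite ?le_max ?lexx ?orbT //.
    by rewrite /Num.max; case: ifP.
  have K1 : n%:R * `|v| * `|u - w| <= n%:R * `|v| * s.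
    by rewrite ler_wpM2l // mulr_ge0.
  have K2 : t * `|c| <= s * `|c| by rewrite ler_wpM2r.
  have s0 : 0 < s by apply: lt_le_trans t0 ts.
  move: sK; rewrite /K; lra.
apply: le_limf_einf => e e0; apply/near_prodP.
have [d d_gt0 H] := first_lower f_exp Lp cL' Lq qZ near_z0 Tw e0.
exists d => // t u t0 td ud; rewrite fE.
apply: (quotient_ge proper); first by rewrite invr_gt0.
move=> Dx; have := H t u t0 td ud Dx.
by rewrite ler_pdivlMr // pw mulrC.
Qed.

(** All multipliers satisfy <l, wJ> = <v, w> = p(wJ) at a critical w, so each gives the same second
    subderivative q(wJ). *)
Lemma second_order_formE w l lm : critical w -> cone_multiplier J T p v l ->
  max_multiplier w lm ->
  second_order_form phi0 f theta x0 v l w = (form_value w lm)%:E.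
Proof.
move=> [Tw pw] [lp lJ] [lmP lmax]; rewrite /second_order_form -jacobianE.
rewrite (second_subderivative_cone proper Lp cL' Lq qZ near_z0 Dz0 lp Tw); last first.
  by rewrite pw dotp_mulmx lJ.
rewrite /form_value EFinD; congr (_ + _)%E; rewrite -lagrangian_quad_value.
apply/le_anti/andP; split.
  apply: ge_ereal_sup => _ [mu /multipliersE muP <-].
  by rewrite lee_fin !lagrangian_quad_value lerD2l ler_pM2l ?lmax.
by apply: ereal_sup_ubound; exists lm => //; exact/multipliersE.
Qed.

Let psi x : \bar R := ((phi0 x)%:E + theta (f x))%E.

Lemma psi_le x (a : R) : (psi x0 + a%:E <= psi x)%E <->
  (dom theta (f x) -> a <= objective_gap x).
Proof.
rewrite /psi (fvalE proper Dz0) -!EFinD; have [Dx|nDx] := pselect (dom theta (f x)).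
  rewrite (fvalE proper Dx) -EFinD lee_fin /objective_gap -/g -/z0.
  by split=> [H _|/(_ Dx)]; lra.
by rewrite (not_dom nDx) /= leey; split=> // _ /nDx.
Qed.

Lemma necessary w l : local_minimizer psi x0 -> cone_multiplier J T p v l ->
  critical w -> (0 <= second_order_form phi0 f theta x0 v l w)%E.
Proof.
move=> /near_normP[d d_gt0 dmin] lP cw; have [lm lmP lu] := critical_gap_upper cw.
rewrite (second_order_formE cw lP lmP) lee_fin.
suff : 0 <= 2^-1 * form_value w lm by lra.
apply: (@le_small_mul _ _ _ 1 1 ltr01) => e e0 _; rewrite mulr1.
pose N := `|w| + 1; have N0 : 0 < N by rewrite ltr_wpDl.
have c0 : 0 < Num.min 1 (d / N) by rewrite lt_min ltr01 divr_gt0.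
have [t [u [/andP[t0 td] ud Dx _ gap]]] := lu e _ e0 c0.
move: td ud; rewrite !lt_min ltr_pdivlMr // => /andP[_ tN] /andP[u1 _].
have uN : `|u| <= N.
  by rewrite -[u](subrK w) addrC; apply: le_trans (ler_normD _ _) _; rewrite lerD2l ltW.
have tud : `|x0 + t *: u - x0| < d.
  rewrite addrAC subrr add0r normrZ gtr0_norm //; apply: le_lt_trans tN.
  by rewrite ler_wpM2l // ltW.
have := dmin _ tud; rewrite -[X in (X <= _)%E]adde0 => /psi_le/(_ Dx)/le_trans/(_ gap).
by rewrite pmulr_rge0 // exprn_gt0.
Qed.

Lemma growth_positive w l : quadratic_growth psi x0 ->
  cone_multiplier J T p v l -> critical w -> w != 0 ->
  (0 < second_order_form phi0 f theta x0 v l w)%E.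
Proof.
move=> [c [eps [c0 eps0 growth]]] lP cw w0.
have [lm lmP lu] := critical_gap_upper cw.
rewrite (second_order_formE cw lP lmP) lte_fin.
have nw : 0 < `|w| by rewrite normr_gt0.
(* Directions within r = |w| / 2 of w keep norm at least r, so the quadratic growth does not
   degenerate as u tends to w. *)
have [r r0 rE] : exists2 r, 0 < r & `|w| = 2 * r.
  by exists (`|w| / 2); [rewrite divr_gt0|rewrite mulrC divfK].
have cr : 0 < c * r ^+ 2 by rewrite mulr_gt0 // exprn_gt0.
suff : c * r ^+ 2 <= 2^-1 * form_value w lm by lra.
apply: (@le_small_mul _ _ _ 1 1 ltr01) => e e0 _; rewrite mulr1.
pose N := n%:R * (`|w| + 1) + 1.
have N0 : 0 < N by rewrite ltr_wpDl // mulr_ge0 // addr_ge0.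
have d_gt0 : 0 < Num.min (Num.min 1 r) (eps / N).
  by rewrite !lt_min ltr01 r0 divr_gt0.
have [t [u [/andP[t0 td] ud Dx _ gap]]] := lu e _ e0 d_gt0.
move: td ud; rewrite !lt_min ltr_pdivlMr // => /andP[_ tN] /andP[/andP[u1 ur] _].
have uN : `|u| <= `|w| + 1.
  by rewrite -[u](subrK w) addrC; apply: le_trans (ler_normD _ _) _; rewrite lerD2l ltW.
have ru : r <= `|u|.
  have := ler_normD u (w - u); rewrite addrC subrK [`|w - u|]distrC; lra.
have xu : x0 + t *: u - x0 = t *: u by rewrite addrAC subrr add0r.
have tu : `|t *: u| = t * `|u| by rewrite normrZ gtr0_norm.
have small : enorm (x0 + t *: u - x0) <= eps.
  rewrite xu; apply: le_trans (enorm_le_norm _) _; apply: le_trans (ltW tN).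
  rewrite tu mulrCA ler_wpM2l ?(ltW t0) // /N.
  by have : n%:R * `|u| <= n%:R * (`|w| + 1); [rewrite ler_wpM2l|lra].
have := growth _ small => /psi_le/(_ Dx)/le_trans/(_ gap).
rewrite xu => H; have t2 : 0 < t ^+ 2 by rewrite exprn_gt0.
rewrite -(ler_pM2l t2); apply: le_trans H.
have tr0 : 0 <= t * r by rewrite mulr_ge0 // ltW.
have en0 : 0 <= enorm (t *: u) by exact: sqrtr_ge0.
have tr : t * r <= enorm (t *: u).
  by apply: le_trans (norm_le_enorm _); rewrite tu ler_wpM2l // ltW.
by rewrite mulrCA ler_wpM2l ?(ltW c0) // -exprMn lerXn2r.
Qed.

(** Compactness of the unit sphere: if growth fails, feasible points with gap o(|y - x0|^2) exist
    arbitrarily near x0, and a cluster point w of their directions is nonzero with wJ in T. A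
    first-order excess is impossible, so w is critical, and then [gap_lower] contradicts a positive
    form. *)
Lemma sufficient : (forall w, critical w -> w != 0 -> exists2 l,
    cone_multiplier J T p v l & 0 < form_value w l) ->
  quadratic_growth psi x0.
Proof.
move=> pos; apply: contrapT => ng.
have /choice[y_ yP] : forall k : nat, exists y,
    [/\ enorm (y - x0) <= k.+1%:R^-1, dom theta (f y) &
        objective_gap y < k.+1%:R^-1 * enorm (y - x0) ^+ 2].
  move=> k; apply: contrapT => ny; apply: ng.
  exists k.+1%:R^-1, k.+1%:R^-1; split; rewrite ?invr_gt0 // => y yk.
  apply/psi_le => Dy; rewrite leNgt; apply/negP => H.
  by apply: ny; exists y.
have yx k : 0 < `|y_ k - x0|.
  rewrite normr_gt0 subr_eq0; apply/eqP => yk; have [_ _] := yP k.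
  by rewrite yk subrr /enorm dotp0l sqrtr0 expr0n mulr0 /objective_gap subrr ltxx.
pose w_ k := `|y_ k - x0|^-1 *: (y_ k - x0).
have w1 k : `|w_ k| = 1.
  by rewrite normrZ gtr0_norm ?invr_gt0 // mulVf // gt_eqF.
have wE k : y_ k = x0 + `|y_ k - x0| *: w_ k.
  by rewrite /w_ scalerA mulfV ?gt_eqF // scale1r addrC subrK.
have [w wc] : exists w, forall (e : R) (N : nat), 0 < e ->
    exists2 k, (N <= k)%N & `|w_ k - w| < e.
  by apply: (@bounded_row_cluster _ _ w_ 1) => k; rewrite w1.
have freq d : 0 < d -> exists t u, [/\ 0 < t, t < d, `|u - w| < d,
    dom theta (f (x0 + t *: u)) & objective_gap (x0 + t *: u) <= d * t ^+ 2].
  (* M converts squared Euclidean to squared sup norms; the added 1 ensures M >= 1, so that M / (k +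
     1) < d also bounds the distance to x0. *)
  move=> d_gt0; pose M := n%:R ^+ 2 + 1 : R.
  have M1 : 1 <= M by rewrite lerDr sqr_ge0.
  have M0 : 0 < M by apply: lt_le_trans M1.
  pose N := Num.bound (M / d).
  have HN : M / d < N%:R by apply: archi_boundP; rewrite divr_ge0 ?ltW.
  have [k Nk wk] := wc d N d_gt0; have [yk Dk gk] := yP k.
  have k1 : M * k.+1%:R^-1 < d.
    rewrite ltr_pdivrMr ?ltr0n // mulrC -ltr_pdivrMr //.
    by apply: (lt_trans HN); rewrite ltr_nat ltnS.
  have kpos : 0 < k.+1%:R^-1 :> R by rewrite invr_gt0 ltr0n.
  exists `|y_ k - x0|, (w_ k); rewrite -wE; split=> //.
    apply: le_lt_trans (norm_le_enorm _) _; apply: le_lt_trans yk _.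
    by apply: le_lt_trans k1; rewrite ler_peMl // ltW.
  apply: le_trans (ltW gk) _.
  have en : enorm (y_ k - x0) ^+ 2 <= M * `|y_ k - x0| ^+ 2.
    apply: (@le_trans _ _ ((n%:R * `|y_ k - x0|) ^+ 2)).
      by rewrite lerXn2r ?nnegrE ?sqrtr_ge0 ?mulr_ge0 // enorm_le_norm.
    by rewrite exprMn ler_wpM2r ?sqr_ge0 // lerDl.
  apply: le_trans (ler_wpM2l (ltW kpos) en) _.
  by rewrite mulrA ler_wpM2r ?sqr_ge0 // mulrC ltW.
have w0 : w != 0.
  apply/eqP => w0; have [k _] := wc 1 0%N ltr01.
  by rewrite w0 subr0 w1 ltxx.
have Tw : T (w *m J).
  apply: (dom_dir f_exp Lp cL' qZ near_z0) => d /freq[t [u [t0 td ud Dx _]]].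
  by exists t, u.
have cw : critical w.
  split=> //; apply/le_anti/andP; split; last first.
    by have [lp lJ] := l0P; rewrite -lJ -dotp_mulmx; exact: lp.
  rewrite -subr_le0 leNgt; apply/negP => gap.
  have e2 : 0 < (p (w *m J) - dotp v w) / 2 by rewrite divr_gt0.
  have [d d_gt0 H] := gap_first_lower Tw e2.
  pose d' := Num.min (Num.min d 1) ((p (w *m J) - dotp v w) / 4).
  have d'0 : 0 < d' by rewrite !lt_min d_gt0 ltr01 divr_gt0.
  have [t [u [t0 td ud Dx gx]]] := freq d' d'0.
  have [i1 i2 i3] : [/\ d' <= d, d' <= 1 & d' <= (p (w *m J) - dotp v w) / 4].
    by rewrite /d' !ge_min !lexx !orbT.
  have := H t u t0 (lt_le_trans td i1) (lt_le_trans ud i1) Dx.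
  move=> /le_trans/(_ gx); rewrite expr2 mulrCA ler_pM2l // => K1.
  have K2 : d' * t <= d' by rewrite ler_piMr ?ltW // (lt_le_trans td).
  lra.
have [l lP l_gt0] := pos w cw w0.
have e8 : 0 < form_value w l / 8 by rewrite divr_gt0.
have [d d_gt0 H] := gap_lower Tw lP e8.
have d'0 : 0 < Num.min d (form_value w l / 8) by rewrite lt_min d_gt0.
have [t [u [t0 td ud Dx gx]]] := freq _ d'0.
move: td ud; rewrite !lt_min => /andP[td _] /andP[ud _].
have := H t u t0 td ud Dx => /le_trans/(_ gx).
rewrite [X in _ <= X]mulrC ler_pM2l ?exprn_gt0 //.
have : Num.min d (form_value w l / 8) <= form_value w l / 8 by rewrite ge_min lexx orbT.
lra.
Qed.

End CompositeProblem.

Lemma growth_local_minimizer {R : realType} {n : nat} (psi : 'rV[R]_n -> \bar R) x :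
  quadratic_growth psi x -> local_minimizer psi x.
Proof.
move=> [l [eps [l0 eps0 H]]]; have N0 : 0 < n%:R + 1 :> R by rewrite ltr_wpDl.
apply/near_normP; exists (eps / (n%:R + 1)); first by rewrite divr_gt0.
move=> y; rewrite ltr_pdivlMr // => yx.
apply: le_trans (H y _); last first.
  apply: le_trans (enorm_le_norm _) _; apply: le_trans (ltW yx).
  by rewrite mulrC ler_wpM2l // lerDl.
by rewrite leeDl // lee_fin mulr_ge0 ?sqr_ge0 // ltW.
Qed.


Theorem theorem6p1 (R : realType) (n m : nat)
    (phi0 : 'rV[R]_n -> R) (f : 'rV[R]_n -> 'rV[R]_m)
    (theta : 'rV[R]_m -> \bar R) (xbar : 'rV[R]_n)
    (phi0_diff : twice_differentiable_fun phi0 xbar)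
    (f_diff : twice_differentiable_map f xbar)
    (theta_proper : forall y, theta y != -oo%E)
    (theta_convex : convex_efun theta)
    (theta_plq : piecewise_linear_quadratic theta)
    (f_dom : dom theta (f xbar))
    (msqc : MSQC f theta xbar)
    (stationary : exists2 v, subdifferential (theta \o f) xbar v
                           & 0 = grad phi0 xbar + v) :
  let phi := theta \o f in
  let psi := fun x => ((phi0 x)%:E + theta (f x))%E in
  let vbar := - grad phi0 xbar in
  let Lambda := multipliers f theta xbar vbar in
  let K := critical_cone phi xbar vbar in
  let Q := second_order_form phi0 f theta xbar vbar in
  let SOSC := fun lambda => forall w, K w -> w != 0 -> (0 < Q lambda w)%E in
  [/\ (* the suprema over Lambda are attained *)
      forall w, K w -> exists2 mu, Lambda mu & forall mu', Lambda mu' ->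
        lagrangian_quad phi0 f theta xbar mu' w
          <= lagrangian_quad phi0 f theta xbar mu w,
      (* (i) *)
      local_minimizer psi xbar ->
        forall lambda, Lambda lambda -> forall w, K w -> (0 <= Q lambda w)%E,
      (* (ii) *)
      (forall lambda, Lambda lambda -> SOSC lambda)
        <-> quadratic_growth psi xbar,
      forall lambda, Lambda lambda ->
        (SOSC lambda <-> quadratic_growth psi xbar) &
      forall lambda, Lambda lambda ->
        SOSC lambda -> local_minimizer psi xbar].
Proof.
move=> phi psi vbar Lambda K Q SOSC.
have Dz0 : dom theta (f xbar) by exact: f_dom.
have cg := convex_on_fval theta_proper theta_convex.
have [L Lg] := plq_fval theta_plq.
have [L' [L'' [T [p [q [[Lp cL' cp] Lq qZ _ near_z0]]]]]] := plq_localize Lg cg Dz0.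
have [kappa [d0 [kappa0 d00 msqc_at]]] := msqc_ineq msqc.
have [v sv gradv] := stationary.
have vE : v = vbar.
  by rewrite /vbar; move/eqP: gradv; rewrite eq_sym addrC addr_eq0 => /eqP.
rewrite {}vE in sv.
have [l0 l0P] := multiplier_exists f_diff Lg cg Dz0 Lp cL' cp qZ near_z0
  kappa0 d00 msqc_at (approx_normal_subdifferential theta_proper sv).
have LambdaE l : Lambda l <-> cone_multiplier (jacobian f xbar) T p vbar l.
  exact: (multipliersE phi0 theta_proper theta_convex Dz0 Lp cL' qZ near_z0 l).
have KE w : K w <-> critical phi0 f xbar T p w.
  exact: (critical_coneE phi0_diff f_diff theta_proper Dz0 Lp cL' cp Lq qZ near_z0
    kappa0 d00 msqc_at l0P w).
have Kmax w : K w -> exists l, max_multiplier phi0 f xbar T p w l.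
  move=> /KE cw; have [l lP _] := critical_gap_upper phi0_diff f_diff Lp cL' cp Lq
    qZ near_z0 kappa0 d00 msqc_at l0P cw.
  by exists l.
have QE w l lm : K w -> Lambda l -> max_multiplier phi0 f xbar T p w lm ->
    Q l w = (form_value phi0 f xbar q w lm)%:E.
  move=> /KE cw /LambdaE lP lmP.
  exact: (second_order_formE phi0_diff f_diff theta_proper theta_convex Dz0 Lp cL'
    Lq qZ near_z0 cw lP lmP).
have SOSC_growth l : Lambda l -> SOSC l -> quadratic_growth psi xbar.
  move=> lL sosc; apply: (sufficient phi0_diff f_diff theta_proper Dz0 Lp cL' Lq qZ
    near_z0 l0P) => w cw w0.
  have Kw : K w by apply/KE.
  have [lm lmP] := Kmax w Kw; exists lm; first exact: lmP.1.
  by have := sosc w Kw w0; rewrite (QE w l lm).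
have growth_SOSC l : quadratic_growth psi xbar -> Lambda l -> SOSC l.
  move=> growth /LambdaE lP w /KE cw w0.
  exact: (growth_positive phi0_diff f_diff theta_proper theta_convex Dz0 Lp cL' cp
    Lq qZ near_z0 kappa0 d00 msqc_at l0P growth lP cw w0).
split.
- move=> w Kw; have [l [lP lmax]] := Kmax w Kw.
  exists l => [|l' /LambdaE l'P]; first exact/LambdaE.
  rewrite !(lagrangian_quad_value _ phi0_diff f_diff) lerD2l ler_pM2l //.
  exact: lmax.
- move=> xmin l /LambdaE lP w /KE cw.
  exact: (necessary phi0_diff f_diff theta_proper theta_convex Dz0 Lp cL' cp
    Lq qZ near_z0 kappa0 d00 msqc_at l0P xmin lP cw).
(* The existing multiplier [l0] keeps the condition over all multipliers from being vacuous. *)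
- split=> [sosc|growth l lL]; last exact: growth_SOSC.
  by apply: (SOSC_growth l0); [exact/LambdaE|apply: sosc; exact/LambdaE].
- move=> l lL; split=> [|growth]; first exact: SOSC_growth.
  exact: growth_SOSC.
- by move=> l lL /(SOSC_growth l lL); exact: growth_local_minimizer.
Qed.
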